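(* Let $p\ge 3$ and let $V_h$ be the space of piecewise polynomials of degree at most $p$ on the exponentially graded (eXp) mesh (see context), with maximum meshwidth $h$. Let $(\lambda_k,u_k)$, $0\neq u_k\in H^2_0(I)$, be the $k$-th eigenpair of $$\mathcal{B}_\varepsilon(u_k,v)=\lambda_k\langle u_k,v\rangle_I\quad\forall v\in H^2_0(I),$$ and let $(\lambda_k^h,u_k^h)$, $0\ne u_k^h\in V_h$, be the $k$-th discrete eigenpair of $$\mathcal{B}_\varepsilon(u_k^h,v)=\lambda_k^h\langle u_k^h,v\rangle_I\quad\forall v\in V_h .$$ Assume $\langle u_k,u_k\rangle_I=1=\langle u_k^h,u_k^h\rangle_I$ and $\langle u_k,u_k^h\rangle_I>0$. Then, for all $h\le h_0$, with $h_0$ independent of $\varepsilon$, $$\lambda_k\le \lambda_k^h\lesssim \bar C(k)\,\lambda_k\left(1+h^{2p-2}\right),$$ with $\bar C(k)$ independent of $\varepsilon$.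
   Context: Setting. $I=(0,1)$, $0<\varepsilon\le 1$, and $a,b$ are given functions, sufficiently smooth on $\overline I=[0,1]$, with $a(x)\ge a_0>0$ and $b(x)\ge 0$ for all $x\in\overline I$, for some $a_0\in\mathbb{R}$. $\langle\cdot,\cdot\rangle_I$ is the $L^2(I)$ inner product, $H^2_0(I)=\{u\in H^2(I): u=u'=0 \text{ on } \partial I\}$, and $$\mathcal{B}_\varepsilon(u,v)=\varepsilon^2\langle u'',v''\rangle_I+\langle a u',v'\rangle_I+\langle bu,v\rangle_I .$$ This is the weak form of $\varepsilon^2u^{(4)}-(au')'+bu=\lambda u$ in $I$, $u(0)=u'(0)=u'(1)=u(1)=0$. The problem is self-adjoint; continuous and discrete eigenvalues are numbered in increasing order. Constant $\beta$. $\beta>0$ is a constant independent of $\varepsilon$ for which the ($L^2$-normalized) eigenfunctions admit a decomposition $u_k=u_S+u_{BL}^L+u_{BL}^R$ with, for $j=0,1,2,\dots$, $|u_S^{(j)}(x)|\lesssim C_j(k)$, $|(u_{BL}^L)^{(j)}(x)|\lesssim \bar C_j(k)\varepsilon^{1-j}e^{-\beta x/\varepsilon}$, $|(u_{BL}^R)^{(j)}(x)|\lesssim\hat C_j(k)\varepsilon^{1-j}e^{-\beta(1-x)/\varepsilon}$, where $C_j(k),\bar C_j(k),\hat C_j(k)$ are positive and independent of $\varepsilon$. eXp mesh. Let $N>4$ be a multiple of $4$, with $\varepsilon<N^{-1}$ (standing assumption). Put $C_{p,\varepsilon}=1-\exp\left(-\frac{\beta}{(p+1)\varepsilon}\right)$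 and $\phi(t)=-\ln[1-4C_{p,\varepsilon}t]$ for $t\in[0,1/4-1/N]$. The nodes are $$x_j=\frac{\varepsilon}{\beta}(p+1)\phi\left(\frac jN\right),\quad j=0,\dots,\tfrac N4-1,$$ $$x_j=1-\frac{\varepsilon}{\beta}(p+1)\phi\left(\frac{N-j}N\right),\quad j=\tfrac{3N}4+1,\dots,N,$$ $$x_j=x_{N/4-1}+\left(\frac{x_{3N/4+1}-x_{N/4-1}}{N/2+2}\right)\left(j-\tfrac N4+1\right),\quad j=\tfrac N4,\dots,\tfrac{3N}4,$$ and they are assumed to form a partition $0=x_0<x_1<\dots<x_N=1$. Let $I_j=(x_{j-1},x_j)$, $h_j=x_j-x_{j-1}$, $h=\max_j h_j$, and $$V_h=\{u\in H^2_0(I): u|_{I_j}\in\mathbb{P}_p(I_j),\ j=1,\dots,N\},$$ where $\mathbb{P}_p(I_j)$ denotes polynomials of degree at most $p$ on $I_j$. Notation. $A\lesssim B$ means $A\le CB$ with $C$ a generic positive constant independent of any discretization or singular perturbation parameters; dependence on other constants is indicated. *)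

(* Defs.v *)
From HB Require Import structures.
From mathcomp Require Import all_boot all_order all_algebra.
From mathcomp Require Import all_classical all_reals all_analysis.
Set Implicit Arguments.
Unset Strict Implicit.
Unset Printing Implicit Defensive.
Import Order.TTheory GRing.Theory Num.Theory.
Import numFieldNormedType.Exports.
Local Open Scope classical_set_scope.
Local Open Scope ring_scope.

Section FunctionSpaces.
Context {R : realType}.
Implicit Types u v g phi : R -> R.
Local Notation mu := (@lebesgue_measure R).

Definition I01 : set R := `]0, 1[.

Definition dotI u v : R := \int[mu]_(x in I01) (u x * v x).

Definition ae_eqI u v : Prop := {ae mu, forall x, I01 x -> u x = v x}.

Definition L2I : set (R -> R) :=
  [set u : R -> R | measurable_fun I01 u /\ mu.-integrable I01 (fun x => (u x ^+ 2)%:E)].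

Definition test_fun phi : Prop :=
  [/\ forall x, derivable phi x 1, continuous (derive1 phi) &
      closure [set x | phi x != 0] `<=` I01].

(* Functions stand for their classes modulo equality a.e. on (0,1). In
   dimension one, C^1 test functions with compact support define the same weak
   derivatives as C^oo ones (this is Brezis' definition of H^1). *)
Definition is_wderiv u g : Prop :=
  L2I g /\ forall phi, test_fun phi -> dotI u (derive1 phi) = - dotI g phi.

(* Some weak derivative; it is unique up to equality a.e. on (0,1). *)
Definition wderiv u : R -> R := get (is_wderiv u).

Definition H1 : set (R -> R) := [set u : R -> R | L2I u /\ exists g, is_wderiv u g].

Definition H2 : set (R -> R) := [set u : R -> R | H1 u /\ H1 (wderiv u)].

(* Boundary values are those of the continuous representative on [0,1]. *)
Definition zero_trace u : Prop :=
  exists U : R -> R, [/\ {within `[0, 1], continuous U}, ae_eqI U u,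
                         U 0 = 0 & U 1 = 0].

Definition H20 : set (R -> R) :=
  [set u : R -> R | [/\ H2 u, zero_trace u & zero_trace (wderiv u)]].

Definition Bform (eps : R) (a b : R -> R) u v : R :=
  eps ^+ 2 * dotI (wderiv (wderiv u)) (wderiv (wderiv v))
  + dotI (a \* wderiv u) (wderiv v) + dotI (b \* u) v.

(* f is of class C^m on the closed interval [0,1]; g j is the j-th derivative
   of f, extended continuously to the end points. *)
Definition Cclosed (m : nat) (f : R -> R) : Prop :=
  exists g : nat -> R -> R,
  [/\ g 0%N = f,
      forall j, (j <= m)%N -> {within `[0, 1], continuous (g j)} &
      forall j x, (j < m)%N -> I01 x -> is_derive x 1 (g j) (g j.+1 x)].

Definition eigenpair (V : set (R -> R)) (B : (R -> R) -> (R -> R) -> R)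
    (lam : R) u : Prop :=
  [/\ V u, ~ ae_eqI u (cst 0) & forall v, V v -> B u v = lam * dotI u v].

(* Eigenvalues are numbered from 1, in increasing order and repeated according
   to their multiplicity: (ls i, us i), 1 <= i <= k, are the first k eigenpairs,
   chosen pairwise L^2-orthogonal, and any eigenfunction orthogonal to all of
   them belongs to an eigenvalue which is at least the k-th one. *)
Definition kth_eigenpair (V : set (R -> R)) (B : (R -> R) -> (R -> R) -> R)
    (k : nat) (lam : R) u : Prop :=
  exists (ls : nat -> R) (us : nat -> R -> R),
  [/\ ls k = lam /\ us k = u,
      forall i, (1 <= i <= k)%N -> eigenpair V B (ls i) (us i),
      forall i j, (1 <= i)%N -> (i < j)%N -> (j <= k)%N ->
        ls i <= ls j /\ dotI (us i) (us j) = 0 &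
      forall nu w, eigenpair V B nu w ->
        (forall i, (1 <= i <= k)%N -> dotI (us i) w = 0) -> lam <= nu].

Definition derivs_bounded (m : nat) (f : R -> R) (bound : nat -> R -> R) : Prop :=
  forall j x, (j <= m)%N -> I01 x ->
    ((j < m)%N -> derivable (derive1n j f) x 1) /\
    `|derive1n j f x| <= bound j x.

(* beta is an admissible layer rate: normalized eigenfunctions split into a
   smooth part and two boundary layers, with bounds on as many derivatives (m)
   as the smoothness of the data permits, uniformly in eps. The generic
   constants implied in the bounds are absorbed in CS, CL, CR. *)
Definition layer_rate (a b : R -> R) (m : nat) (beta : R) : Prop :=
  0 < beta /\
  forall k : nat, (1 <= k)%N ->
  exists CS CL CR : nat -> R,
  (forall j, [/\ 0 < CS j, 0 < CL j & 0 < CR j]) /\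
  forall (eps lam : R) u, 0 < eps -> eps <= 1 ->
    kth_eigenpair H20 (Bform eps a b) k lam u -> dotI u u = 1 ->
    exists uS uL uR : R -> R,
    [/\ ae_eqI u (fun x => uS x + uL x + uR x),
        derivs_bounded m uS (fun j _ => CS j),
        derivs_bounded m uL
          (fun j x => CL j * eps ^ (1 - j%:Z) * expR (- (beta * x / eps))) &
        derivs_bounded m uR
          (fun j x => CR j * eps ^ (1 - j%:Z) * expR (- (beta * (1 - x) / eps)))].

End FunctionSpaces.

Section Mesh.
Context {R : realType}.
Variables (beta eps : R) (p N : nat).

Definition Cpeps : R := 1 - expR (- (beta / (p.+1%:R * eps))).

(* The mesh generating function, meant for t in [0, 1/4 - 1/N]. *)
Definition mesh_phi (t : R) : R := - ln (1 - 4 * Cpeps * t).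

Definition left_node (j : nat) : R :=
  eps / beta * p.+1%:R * mesh_phi (j%:R / N%:R).

Definition right_node (j : nat) : R :=
  1 - eps / beta * p.+1%:R * mesh_phi ((N - j)%N%:R / N%:R).

Definition exp_node (j : nat) : R :=
  let q := (N %/ 4)%N in
  if (j < q)%N then left_node j
  else if (3 * q < j)%N then right_node j
  else left_node q.-1
       + (right_node (3 * q).+1 - left_node q.-1) / (N%:R / 2 + 2)
         * (j%:R - q%:R + 1).

Definition exp_partition : Prop :=
  [/\ exp_node 0 = 0, exp_node N = 1 &
      forall j, (j < N)%N -> exp_node j < exp_node j.+1].

Definition mesh_width : R :=
  \big[Num.max/0]_(j < N) (exp_node j.+1 - exp_node j).

Definition Vh : set (R -> R) :=
  [set u : R -> R | H20 u /\ forall j, (j < N)%N ->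
    exists2 q : {poly R}, (size q <= p.+1)%N &
      {ae @lebesgue_measure R, forall x,
         exp_node j < x < exp_node j.+1 -> u x = q.[x]}].

End Mesh.

(* Main.v *)
Require Import Defs.
From HB Require Import structures.
From mathcomp Require Import all_boot all_order all_algebra.
From mathcomp Require Import all_classical all_reals all_analysis.
From mathcomp Require Import measurable_realfun ring lra.
Set Implicit Arguments.
Unset Strict Implicit.
Unset Printing Implicit Defensive.
Import Order.TTheory GRing.Theory Num.Theory.
Import numFieldNormedType.Exports.
Local Open Scope classical_set_scope.
Local Open Scope ring_scope.

(** The bound on [lamh] compares it with [lam] only up to a constant, so that it
    splits into two estimates that do not see [eps] nor the mesh: [a0 <= lam],
    by the Poincare inequality, and [lamh <= C] with [C] depending on [k] and on
    upper bounds of [a] and [b].  The discrete space is rich enough for the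
    second one whatever the grading of the mesh: choose four increasing mesh
    nodes in each of [k] equal cells of [0, 1], at distances comparable to the
    length of the cell ([node_near]; this is why [h] has to be small in terms of
    [k]).  The C^1 cubic spline on those four knots which rises from 0 to 1, is
    constant, and falls back to 0 belongs to the discrete space, since a function
    that is a polynomial between some of the nodes is one between all of them.
    The [k] bumps have disjoint supports, second derivatives bounded in terms of
    [k], and plateaus of length bounded below, so that the Rayleigh quotient is
    bounded on their span ([bump_energy], [bump_mass],
    [discrete_eigenvalue_le]).

    Both [lam <= lamh] and the passage from a bound on Rayleigh quotients to a
    bound on [lamh] rest on one min-max principle ([minmax],
    [kth_eigenvalue_le]): if the Rayleigh quotient is at most [m] on a
    [k]-dimensional subspace, then the [k]-th eigenvalue is at most [m].  The
    latter is only known through the fact that eigenfunctions orthogonal to the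
    first [k] ones have larger eigenvalues, hence eigenfunctions must be
    produced: a nonzero element of the subspace is orthogonal to the first
    [k - 1] eigenfunctions, and the Rayleigh quotient has a minimizer under
    these constraints, which is an eigenfunction ([minimizer_exists]).  The
    minimizing sequence is compact in L^2; the parallelogram identity applied to
    the form [B - nu D] then makes it Cauchy in energy, so that no weak
    convergence is needed.

    For the continuous problem this takes Rellich compactness ([rellich]),
    obtained from the 1/2-Hoelder continuity of primitives of L^2 functions, and
    the completeness of the energy space ([complete_H20]), which reduces to that
    of L^2 ([L2_complete]).  Weak derivatives enter through the operator [prim],
    the primitive vanishing at 0: by a lemma of du Bois-Reymond
    ([du_bois_reymond]) the functions of [H20] are the [prim (prim g)] with [g]
    in L^2 such that [prim g] and [prim (prim g)] vanish at 1 ([H20_repr],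
    [H20_intro]).  The discrete space is a subspace of [H20], closed because
    polynomials of bounded degree are closed in L^2 of an interval
    ([poly_closed_itv]). *)

(** * Symmetric bilinear forms and minimizers of Rayleigh quotients *)

Section Forms.
Context {R : realType} {E : lmodType R}.
Implicit Types (V W : set E) (B D Q : E -> E -> R).

(** Linear subspaces, given as sets. *)
Definition lin_subspace V :=
  V 0 /\ forall (c : R) u v, V u -> V v -> V (c *: u + v).

(** [Q] is a symmetric bilinear form on the subspace [V]; nothing is asked of
    its values outside [V].  This suits forms of functions known up to equality
    almost everywhere. *)
Definition sym_bilin V Q :=
  (forall u v, V u -> V v -> Q u v = Q v u) /\
  (forall (c : R) u v w, V u -> V v -> V w ->
     Q (c *: u + v) w = c * Q u w + Q v w).

(** [Q] is positive semidefinite on [V]. *)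
Definition psd V Q := forall u, V u -> 0 <= Q u u.

Section Basics.
Variables (V : set E) (Q : E -> E -> R).
Hypotheses (sV : lin_subspace V) (bQ : sym_bilin V Q).

Lemma subspaceZ c u : V u -> V (c *: u).
Proof. by move=> Vu; rewrite -[_ *: _]addr0; apply: sV.2 => //; exact: sV.1. Qed.

Lemma subspaceD u v : V u -> V v -> V (u + v).
Proof. by move=> Vu Vv; rewrite -[u]scale1r; apply: sV.2. Qed.

Lemma subspaceB u v : V u -> V v -> V (u - v).
Proof. by move=> Vu Vv; rewrite addrC -scaleN1r; apply: sV.2. Qed.

Lemma subspace_sum (I : Type) (r : seq I) (c : I -> R) (f : I -> E) :
  (forall i, V (f i)) -> V (\sum_(i <- r) c i *: f i).
Proof.
move=> Vf; elim: r => [|i r IH]; first by rewrite big_nil; exact: sV.1.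
by rewrite big_cons; apply: sV.2.
Qed.

Lemma bilinZ c u w : V u -> V w -> Q (c *: u) w = c * Q u w.
Proof.
move=> Vu Vw; have V0 := sV.1.
have Q0 : Q 0 w = 0.
  by have := bQ.2 1 0 0 w V0 V0 Vw; rewrite scaler0 addr0; lra.
by rewrite -[_ *: _]addr0 bQ.2// Q0 addr0.
Qed.

Lemma bilinD u v w : V u -> V v -> V w -> Q (u + v) w = Q u w + Q v w.
Proof. by move=> Vu Vv Vw; rewrite -[u in LHS]scale1r bQ.2// mul1r. Qed.

Lemma bilinB u v w : V u -> V v -> V w -> Q (u - v) w = Q u w - Q v w.
Proof.
move=> Vu Vv Vw; rewrite addrC -scaleN1r bQ.2// mulN1r; ring.
Qed.

Lemma bilinZr c u w : V u -> V w -> Q u (c *: w) = c * Q u w.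
Proof.
by move=> Vu Vw; rewrite bQ.1 ?bilinZ// 1?bQ.1//; exact: subspaceZ.
Qed.

Lemma bilinDr u v w : V u -> V v -> V w -> Q w (u + v) = Q w u + Q w v.
Proof.
by move=> Vu Vv Vw; rewrite bQ.1 ?bilinD// 1?(bQ.1 u) 1?(bQ.1 v)//;
  exact: subspaceD.
Qed.

Lemma bilinBr u v w : V u -> V v -> V w -> Q w (u - v) = Q w u - Q w v.
Proof.
by move=> Vu Vv Vw; rewrite bQ.1 ?bilinB// 1?(bQ.1 u) 1?(bQ.1 v)//;
  exact: subspaceB.
Qed.

Lemma bilin_suml (I : Type) (r : seq I) (c : I -> R) (f : I -> E) w :
  (forall i, V (f i)) -> V w ->
  Q (\sum_(i <- r) c i *: f i) w = \sum_(i <- r) c i * Q (f i) w.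
Proof.
move=> Vf Vw; elim: r => [|i r IH].
  by rewrite !big_nil -(scale0r (0 : E)) bilinZ ?mul0r//; exact: sV.1.
by rewrite !big_cons bQ.2// ?IH//; exact: subspace_sum.
Qed.

Hypothesis pQ : psd V Q.

Lemma psd_leD u v : V u -> V v -> Q (u + v) (u + v) <= 2 * Q u u + 2 * Q v v.
Proof.
move=> Vu Vv; have := pQ (subspaceB Vu Vv).
have VD := subspaceD Vu Vv; have VB := subspaceB Vu Vv.
rewrite (bilinB Vu Vv VB) (bilinD Vu Vv VD) !bilinBr// !bilinDr// (bQ.1 v u)//.
lra.
Qed.

Lemma psd_leB u v : V u -> V v -> Q (u - v) (u - v) <= 2 * Q u u + 2 * Q v v.
Proof.
move=> Vu Vv; have := pQ (subspaceD Vu Vv).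
have VD := subspaceD Vu Vv; have VB := subspaceB Vu Vv.
rewrite (bilinB Vu Vv VB) (bilinD Vu Vv VD) !bilinBr// !bilinDr// (bQ.1 v u)//.
lra.
Qed.

(** The Cauchy-Schwarz inequality, without square roots. *)
Lemma psd_CS u v : V u -> V v -> Q u v ^+ 2 <= Q u u * Q v v.
Proof.
move=> Vu Vv.
have key t : 0 <= Q u u + 2 * t * Q u v + t ^+ 2 * Q v v.
  have VZ := subspaceZ t Vv.
  have := pQ (subspaceD Vu VZ).
  rewrite bilinD ?bilinDr// ?bilinZr ?bilinZ ?bilinZr// ?(bQ.1 v u)//;
    try by [exact: subspaceD | exact: subspaceZ].
  lra.
have Qu := pQ Vu; have Qv := pQ Vv.
have [v0|v0] := eqVneq (Q v v) 0.
  have h : Q u v = 0.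
    apply/eqP/negPn/negP => uv0.
    have := key (- (Q u u + 1) / (2 * Q u v)); rewrite v0.
    rewrite (_ : Q u u + _ + _ = -1) //; first by lra.
    by field.
  by rewrite h v0 mulr0 expr0n.
have vp : 0 < Q v v by rewrite lt_neqAle eq_sym v0.
have := key (- Q u v / Q v v).
rewrite (_ : _ + _ + _ = (Q u u * Q v v - Q u v ^+ 2) / Q v v); last by field.
by rewrite pmulr_lge0 ?invr_gt0// subr_ge0.
Qed.

End Basics.

Section DirectMethod.
Variables (V : set E) (B D : E -> E -> R).

(** From a sequence of bounded [B]-energy a [D]-Cauchy subsequence can be
    extracted; [f] need not be increasing, only [n <= f n]. *)
Definition precompact_form := forall (M : R) (w : nat -> E),
  (forall n, V (w n)) -> (forall n, B (w n) (w n) <= M) ->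
  exists f : nat -> nat, (forall n, (n <= f n)%N) /\
    forall e : R, 0 < e -> exists N, forall n m, (N <= n)%N -> (N <= m)%N ->
      D (w (f n) - w (f m)) (w (f n) - w (f m)) <= e.

(** [B]-Cauchy sequences of [V] converge in [V], for [B] and for [D]. *)
Definition complete_form := forall (w : nat -> E),
  (forall n, V (w n)) ->
  (forall e : R, 0 < e -> exists N, forall n m, (N <= n)%N -> (N <= m)%N ->
      B (w n - w m) (w n - w m) <= e) ->
  exists2 v, V v & forall e : R, 0 < e -> exists N, forall n, (N <= n)%N ->
    B (w n - v) (w n - v) <= e /\ D (w n - v) (w n - v) <= e.

Hypotheses (sV : lin_subspace V) (bB : sym_bilin V B) (bD : sym_bilin V D).
Hypotheses (pB : psd V B) (pD : psd V D).
Hypotheses (cpt : precompact_form) (cpl : complete_form).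

Lemma sub_sym_bilin (W : set E) Q : W `<=` V -> sym_bilin V Q -> sym_bilin W Q.
Proof.
move=> WV [h1 h2]; split=> [u v /WV ? /WV ?|c u v w /WV ? /WV ? /WV ?].
  exact: h1.
exact: h2.
Qed.

Lemma sub_psd (W : set E) Q : W `<=` V -> psd V Q -> psd W Q.
Proof. by move=> WV h u /WV; exact: h. Qed.

Lemma shift_sym_bilin (nu : R) :
  sym_bilin V (fun u v => B u v - nu * D u v).
Proof.
split=> [u v Vu Vv|c u v w Vu Vv Vw]; first by rewrite bB.1 1?bD.1.
rewrite bB.2// bD.2//; ring.
Qed.

(** The direct method: on a [D]-closed subspace [W] the quotient [B / D] has a
    minimizer, which satisfies the Euler equation on [W]; its quotient [nu] is at
    most that of the given [w0]. *)
Lemma minimizer_exists (W : set E) (w0 : E) :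
  lin_subspace W -> W `<=` V ->
  (forall (w : nat -> E) v, (forall n, W (w n)) -> V v ->
     (forall e : R, 0 < e -> exists n, D (w n - v) (w n - v) <= e) -> W v) ->
  W w0 -> 0 < D w0 w0 ->
  exists (nu : R) (w : E),
    [/\ W w, 0 < D w w, nu * D w0 w0 <= B w0 w0 &
        forall v, W v -> B w v = nu * D w v].
Proof.
move=> sW WV clW Ww0 D0.
pose S := [set r : R | exists w, [/\ W w, D w w = 1 & r = B w w]].
have normalize x : W x -> 0 < D x x ->
    exists y, [/\ W y, D y y = 1 & B y y = B x x / D x x].
  move=> Wx Dx; exists ((Num.sqrt (D x x))^-1 *: x).
  have Vx := WV _ Wx; have VZ c := subspaceZ sV c Vx.
  have s2 : Num.sqrt (D x x) ^+ 2 = D x x by rewrite sqr_sqrtr// ltW.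
  have sn0 : Num.sqrt (D x x) != 0 by rewrite gt_eqF// sqrtr_gt0.
  split; first exact: subspaceZ.
    rewrite (bilinZ sV bD)// (bilinZr sV bD)// -{3}s2; by field.
  by rewrite (bilinZ sV bB)// (bilinZr sV bB)// -{3}s2; field.
have Sn0 : S !=set0.
  by have [y [Wy Dy By]] := normalize _ Ww0 D0; exists (B y y), y.
have Slb : lbound S 0 by move=> _ [w [Ww _ ->]]; exact/pB/WV.
have hinf : has_inf S by split => //; exists 0.
pose nu := inf S.
pose F u v := B u v - nu * D u v.
have bF : sym_bilin W F.
  by apply: sub_sym_bilin WV _; exact: shift_sym_bilin.
have bDW : sym_bilin W D by exact: sub_sym_bilin.
have pDW : psd W D by exact: sub_psd.
have pF : psd W F.
  move=> x Wx; rewrite /F subr_ge0.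
  have [Dx|Dx] := leP (D x x) 0.
    have -> : D x x = 0 by apply/eqP; rewrite eq_le Dx; exact: pDW.
    by rewrite mulr0; exact/pB/WV.
  have [y [Wy Dy By]] := normalize _ Wx Dx.
  by rewrite -ler_pdivlMr// -By; apply: ge_inf; [exists 0|exists y].
have [w hw] : exists w : nat -> E, forall n,
    [/\ W (w n), D (w n) (w n) = 1 & F (w n) (w n) <= n.+1%:R^-1].
  suff /choice[w hw] : forall n : nat, exists x,
      [/\ W x, D x x = 1 & F x x <= n.+1%:R^-1] by exists w.
  move=> n; have e0 : 0 < n.+1%:R^-1 :> R by rewrite invr_gt0.
  have [_ [x [Wx Dx ->]] xlt] := inf_adherent e0 hinf.
  by exists x; split => //; rewrite /F Dx mulr1 -/nu lerBlDl ltW.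
have Ww n : W (w n) by case: (hw n).
have Dw n : D (w n) (w n) = 1 by case: (hw n).
have Fw n : F (w n) (w n) <= n.+1%:R^-1 by case: (hw n).
have nu0 : 0 <= nu by apply: lb_le_inf.
have Bw n : B (w n) (w n) <= nu + 1.
  have := Fw n; rewrite /F Dw mulr1 => h.
  have h1 : n.+1%:R^-1 <= 1 :> R by rewrite invf_le1// ler1n.
  by have := le_trans h h1; rewrite lerBlDl.
have [f [fge fC]] := cpt (fun n => WV _ (Ww n)) Bw.
pose g n := w (f n).
have Fg e : 0 < e -> exists N, forall n, (N <= n)%N -> F (g n) (g n) <= e.
  move=> e0; exists (Num.trunc e^-1) => n Nn; apply: (le_trans (Fw _)).
  rewrite invf_ple ?posrE//; apply: (le_trans (ltW (truncnS_gt _))).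
  by rewrite ler_nat ltnS (leq_trans Nn)// fge.
(* B = F + nu D, where F is small at g n - g m by the parallelogram identity *)
have gC e : 0 < e -> exists N, forall n m, (N <= n)%N -> (N <= m)%N ->
    B (g n - g m) (g n - g m) <= e.
  move=> e0.
  have e8 : 0 < e / 8 by lra.
  have e2 : 0 < e / (2 * (nu + 1)) by rewrite divr_gt0// mulr_gt0//; lra.
  have [N1 h1] := Fg _ e8.
  have [N2 h2] := fC _ e2.
  exists (maxn N1 N2) => n m; rewrite !geq_max => /andP[n1 n2] /andP[m1 m2].
  have := psd_leB sW bF pF (Ww (f n)) (Ww (f m)).
  rewrite -/(g n) -/(g m) {1}/F.
  have := h1 _ n1; have := h1 _ m1; have := h2 _ _ n2 m2.
  rewrite -/(g n) -/(g m); set d := D _ _.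
  rewrite ler_pdivlMr; last by move=> *; lra.
  have d0 : 0 <= d by apply: pDW; apply: (subspaceB sW); exact: Ww.
  lra.
have [v Vv vlim] := cpl (fun n => WV _ (Ww (f n))) gC.
have Wv : W v.
  apply: (clW g) => [n|//|e e0]; first exact: Ww.
  by have [n /(_ n (leqnn n))[_ ?]] := vlim _ e0; exists n.
have Vg n : V (g n) by exact/WV/Ww.
have Dv : 0 < D v v.
  have [n /(_ n (leqnn n))[_ hn]] := vlim (1/4) ltac:(lra).
  have := psd_leD sV bD pD Vv (subspaceB sV (Vg n) Vv).
  rewrite subrKC Dw => h.
  have : D (g n - v) (g n - v) <= 1 / 4 := hn.
  lra.
(* F is nonnegative on W and tends to 0 along g *)
have Fv : F v v <= 0.
  apply/ler_addgt0Pl => e e0; rewrite addr0.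
  have e4 : 0 < e / 4 by lra.
  have [N1 h1] := Fg _ e4; have [N2 h2] := vlim _ e4.
  pose n := maxn N1 N2.
  have Fn := h1 n (leq_maxl _ _).
  have [Bn _] := h2 n (leq_maxr _ _).
  have Wgv := subspaceB sW (Ww (f n)) Wv.
  have := psd_leB sW bF pF (Ww (f n)) Wgv.
  rewrite -/(g n) subKr {3}/F.
  have := mulr_ge0 nu0 (pDW _ Wgv).
  rewrite -/(g n) in Bn Wgv *; lra.
exists nu, v; split => //.
  by have := pF _ Ww0; rewrite subr_ge0.
move=> x Wx; apply/eqP; rewrite -subr_eq0 -/(F v x) -sqrf_eq0 eq_le sqr_ge0 andbT.
apply: (le_trans (psd_CS sW bF pF Wv Wx)).
by rewrite mulr_le0_ge0//; exact: pF.
Qed.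

End DirectMethod.
End Forms.

(** * The min-max principle *)

Section MinMax.
Context {R : realType} {E : lmodType R}.
Variables (V : set E) (B D : E -> E -> R).
Hypotheses (sV : lin_subspace V) (bB : sym_bilin V B) (bD : sym_bilin V D).
Hypotheses (pB : psd V B) (pD : psd V D).
Hypotheses (cpt : precompact_form V B D) (cpl : complete_form V B D).

(** [k] linear conditions have a nontrivial solution in [k + 1] unknowns. *)
Lemma exists_combination_orthogonal (k : nat) (us : 'I_k -> E) (f : 'I_k.+1 -> E) :
  (forall i, V (us i)) -> (forall i, V (f i)) ->
  exists2 c : 'I_k.+1 -> R, (exists i, c i != 0) &
    forall j, D (us j) (\sum_i c i *: f i) = 0.
Proof.
move=> Vus Vf.
pose M : 'M[R]_(k.+1, k) := \matrix_(i, j) D (f i) (us j).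
have /rowV0Pn[v /sub_kermxP vM v0] : kermx M != 0.
  by rewrite -mxrank_eq0 mxrank_ker -lt0n subn_gt0 ltnS rank_leq_col.
exists (fun i => v 0 i).
  apply: contrapT => /forallNP h; move/eqP: v0; apply.
  by apply/rowP => i; rewrite mxE; apply/eqP/negPn/negP; exact: h.
move=> j; have := congr1 (fun A : 'rV_k => A 0 j) vM; rewrite !mxE => h.
rewrite bD.1 ?(bilin_suml sV bD)//; last exact: subspace_sum.
by rewrite -[RHS]h; apply: eq_bigr => i _; rewrite mxE.
Qed.

(** If [B <= m D] on the span of [k + 1] vectors on which [D] is definite, then the
    [k + 1]-st eigenvalue is at most [m].  The pairs [(ls i, us i)] with
    [1 <= i <= k + 1] are orthogonal eigenpairs, and they are the first ones in the
    sense that eigenvectors orthogonal to all of them belong to eigenvalues that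
    are at least [ls k.+1]. *)
Lemma minmax (k : nat) (ls : nat -> R) (us : nat -> E) (f : 'I_k.+1 -> E) (m : R) :
  (forall i, (1 <= i <= k.+1)%N -> [/\ V (us i), 0 < D (us i) (us i) &
     forall v, V v -> B (us i) v = ls i * D (us i) v]) ->
  (forall i j, (1 <= i)%N -> (i < j)%N -> (j <= k.+1)%N -> D (us i) (us j) = 0) ->
  (forall nu w, V w -> 0 < D w w -> (forall v, V v -> B w v = nu * D w v) ->
     (forall i, (1 <= i <= k.+1)%N -> D (us i) w = 0) -> ls k.+1 <= nu) ->
  (forall i, V (f i)) ->
  (forall c : 'I_k.+1 -> R, (exists i, c i != 0) ->
     0 < D (\sum_i c i *: f i) (\sum_i c i *: f i) /\
     B (\sum_i c i *: f i) (\sum_i c i *: f i) <=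
     m * D (\sum_i c i *: f i) (\sum_i c i *: f i)) ->
  ls k.+1 <= m.
Proof.
move=> Hus Horth Hmax Vf Hf.
pose vs (i : 'I_k) := us i.+1.
have vsP i : [/\ V (vs i), 0 < D (vs i) (vs i) &
     forall v, V v -> B (vs i) v = ls i.+1 * D (vs i) v].
  by apply: Hus; rewrite /= ltnS ltnW.
have Vvs i : V (vs i) by case: (vsP i).
have vsO i j : i != j -> D (vs i) (vs j) = 0.
  have aux (p q : 'I_k) : (p < q)%N -> D (vs p) (vs q) = 0.
    by move=> pq; apply: Horth => //; exact: leqW.
  rewrite neq_ltn => /orP[|] ij; first exact: aux.
  by rewrite bD.1// aux.
pose W := [set v | V v /\ forall i, D (vs i) v = 0].
have WV : W `<=` V by move=> v [].
have sW : lin_subspace W.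
  split.
    split; first exact: sV.1.
    move=> i; rewrite -(scale0r (0 : E)) (bilinZr sV bD) ?mul0r//; exact: sV.1.
  move=> c u v [Vu hu] [Vv hv]; split; first exact: sV.2.
  move=> i; rewrite bD.1//; last exact: sV.2.
  by rewrite bD.2// (bD.1 u)// (bD.1 v)// hu hv mulr0 addr0.
have clW (w : nat -> E) v : (forall n, W (w n)) -> V v ->
   (forall e : R, 0 < e -> exists n, D (w n - v) (w n - v) <= e) -> W v.
  move=> Ww Vv wv; split => // i.
  have [Vi Di _] := vsP i.
  apply/eqP; rewrite -sqrf_eq0 eq_le sqr_ge0 andbT.
  apply/ler_addgt0Pl => e e0; rewrite addr0.
  have [n hn] := wv (e / D (vs i) (vs i)) ltac:(by rewrite divr_gt0).
  have [Vw ow] := Ww n.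
  have VB := subspaceB sV Vw Vv.
  have := psd_CS sV bD pD Vi VB.
  rewrite (bilinBr sV bD)// ow sub0r sqrrN => /le_trans; apply.
  by rewrite mulrC -ler_pdivlMr.
have [c c0 co] := exists_combination_orthogonal Vvs Vf.
have [D0 BD] := Hf _ c0.
set w0 := \sum_i _ in D0 BD co.
have Ww0 : W w0 by split => //; exact: subspace_sum.
have [nu [w [Ww Dw nuw0 Bw]]] :=
  minimizer_exists sV bB bD pB pD cpt cpl sW WV clW Ww0 D0.
have Vw := WV _ Ww.
have num : nu <= m by rewrite -(ler_pM2r D0); exact: le_trans nuw0 BD.
(* the Euler equation on W extends to V because w is orthogonal to the vs i,
   for D and hence for B *)
have wE v : V v -> B w v = nu * D w v.
  move=> Vv.
  pose P := \sum_i (D (vs i) v / D (vs i) (vs i)) *: vs i.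
  have VP : V P by exact: subspace_sum.
  have WvP : W (v - P).
    split; first exact: subspaceB.
    move=> j; rewrite (bilinBr sV bD)//.
    rewrite (bD.1 _ P)// (bilin_suml sV bD)//.
    rewrite (bigD1 j)//= big1 => [|i ij]; last by rewrite (vsO _ _ ij) mulr0.
    have [_ Dj _] := vsP j.
    by rewrite addr0 divfK ?subrr// gt_eqF.
  have BP : B w P = 0.
    rewrite bB.1// (bilin_suml sV bB)// big1// => i _.
    have [_ _ Bi] := vsP i; by rewrite Bi// (Ww.2 i) !mulr0.
  have DP : D w P = 0.
    by rewrite bD.1// (bilin_suml sV bD)// big1// => i _; rewrite (Ww.2 i) mulr0.
  by have := Bw _ WvP; rewrite (bilinBr sV bB)// (bilinBr sV bD)// BP DP !subr0.
(* if m < ls k.+1 then nu <> ls k.+1, so w is also orthogonal to us k.+1 *)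
rewrite leNgt; apply/negP => mls.
have ulast : (1 <= k.+1 <= k.+1)%N by rewrite leqnn.
have [Vk Dk Bk] := Hus _ ulast.
have : ls k.+1 <= nu.
  apply: (Hmax nu w) => // i /andP[i1]; rewrite leq_eqVlt => /orP[/eqP ->|ik].
    have := wE _ Vk; rewrite bB.1// Bk// (bD.1 w)// => /eqP.
    rewrite -subr_eq0 -mulrBl mulf_eq0 => /orP[|/eqP//].
    by rewrite subr_eq0 => /eqP h; move: mls; rewrite h ltNge num.
  case: i i1 ik => // i _ ik; exact: (Ww.2 (Ordinal (ik : (i < k)%N))).
by move/(lt_le_trans mls); rewrite ltNge num.
Qed.

End MinMax.

(** * Square integrable functions on the unit interval *)

Section SquareIntegrable.
Context {R : realType}.
Implicit Types u v w g : R -> R.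
Local Notation mu := (@lebesgue_measure R).
Local Notation I := (@I01 R).

(** Integrability on the open unit interval. *)
Definition intI u := mu.-integrable I (EFin \o u).

Lemma measurable_I01 : measurable (I : set R).
Proof. exact: measurable_itv. Qed.
Hint Resolve measurable_I01 : core.

Lemma lebesgue_I01 : mu I = 1%E.
Proof. by rewrite /I01 lebesgue_measure_itv/= lte01 sube0. Qed.

Lemma I01P (x : R) : I x <-> 0 < x < 1.
Proof. by rewrite /I01/= in_itv. Qed.

Lemma Rintegral_I01_cst (c : R) : \int[mu]_(x in I) c = c.
Proof.
rewrite Rintegral_cst; last exact: measurable_I01.
by rewrite [X in fine X](_ : _ = 1%E) ?mulr1//; exact: lebesgue_I01.
Qed.

Lemma bound_ge0 (u : R -> R) (M : R) : (forall x, I x -> `|u x| <= M) -> 0 <= M.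
Proof.
have I2 : I (1 / 2) by apply/I01P; lra.
by move=> /(_ _ I2); exact: le_trans.
Qed.

Lemma intI_cst (c : R) : intI (cst c).
Proof.
apply/integrableP; split; first exact/measurable_EFinP.
rewrite (_ : (\int[mu]_(x in I) _)%E = (\int[mu]_(x in I) `|c|%:E)%E)//.
rewrite integral_cst// [X in (_ * X)%E](_ : _ = 1%E) ?mule1 ?ltry//.
exact: lebesgue_I01.
Qed.

Lemma intI_add u v : intI u -> intI v -> intI (fun x => u x + v x).
Proof. by move=> iu iv; apply: (integrableD _ iu iv); exact: measurable_I01. Qed.

Lemma intI_scale (c : R) u : intI u -> intI (fun x => c * u x).
Proof. by move=> iu; apply: (integrableZl _ c iu); exact: measurable_I01. Qed.

Lemma intI_le u v : measurable_fun I u -> (forall x, I x -> `|u x| <= v x) ->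
  intI v -> intI u.
Proof.
move=> mu_ uv iv; apply: (le_integrable _ _ _ iv) => //.
  exact/measurable_EFinP.
move=> x Ix /=; rewrite lee_fin (le_trans (uv _ Ix))//; exact: ler_norm.
Qed.

Lemma L2I_mul_int u v : L2I u -> L2I v -> intI (fun x => u x * v x).
Proof.
move=> [mu_ iu] [mv iv].
have iuv : intI (fun x => u x ^+ 2 + v x ^+ 2) by exact: intI_add.
apply: intI_le iuv; first exact: measurable_funM.
move=> x _; rewrite normrM -(real_normK (num_real (u x))).
rewrite -(real_normK (num_real (v x))).
have := sqr_ge0 (`|u x| - `|v x|); have := normr_ge0 (u x).
have := normr_ge0 (v x); nra.
Qed.

Lemma L2I_bounded u (M : R) : measurable_fun I u ->
  (forall x, I x -> `|u x| <= M) -> L2I u.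
Proof.
move=> mu_ uM; split=> //.
apply: (@intI_le _ (cst (M ^+ 2))) => //; last exact: intI_cst.
  exact: measurable_funX.
move=> x Ix; rewrite normrX lerXn2r ?nnegrE//; first exact: le_trans (uM _ Ix).
exact: uM.
Qed.

Lemma L2I_cst (c : R) : L2I (cst c).
Proof. by apply: (@L2I_bounded _ `|c|). Qed.

Lemma L2I_subspace : @lin_subspace R (R -> R) L2I.
Proof.
split; first exact: (L2I_cst 0).
move=> c u v [mu_ iu] [mv iv].
have muv : measurable_fun I (c *: u + v).
  by apply: measurable_funD => //; exact: measurable_funM.
split => //.
have iuv : intI (fun x => (2 * c ^+ 2) * u x ^+ 2 + 2 * v x ^+ 2).
  by apply: intI_add => //; exact: intI_scale.
apply: intI_le iuv; first exact: measurable_funX.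
move=> x _; rewrite ger0_norm ?sqr_ge0//.
change ((c * u x + v x) ^+ 2 <= 2 * c ^+ 2 * u x ^+ 2 + 2 * v x ^+ 2).
have := sqr_ge0 (c * u x - v x); nra.
Qed.

(** [dotI] is an inner product on [L2I], up to equality almost everywhere. *)
Lemma dotI_sym_bilin : @sym_bilin R (R -> R) L2I dotI.
Proof.
split=> [u v _ _|c u v w Lu Lv Lw].
  by rewrite /dotI; apply: eq_Rintegral => x _; rewrite mulrC.
have iuw := L2I_mul_int Lu Lw; have ivw := L2I_mul_int Lv Lw.
rewrite /dotI -RintegralZl// -RintegralD//; last exact: intI_scale.
by apply: eq_Rintegral => x _; rewrite mulrA -mulrDl.
Qed.

Lemma dotI_psd : @psd R (R -> R) L2I dotI.
Proof. by move=> u _; apply: Rintegral_ge0 => x _; rewrite -expr2 sqr_ge0. Qed.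

Lemma L2I_mulb (M : R) (a u : R -> R) : measurable_fun I a ->
  (forall x, I x -> `|a x| <= M) -> L2I u -> L2I (a \* u).
Proof.
move=> ma aM [mu_ iu]; have mau : measurable_fun I (a \* u).
  exact: measurable_funM.
split => //.
have iM : intI (fun x => M ^+ 2 * u x ^+ 2) by exact: intI_scale.
apply: intI_le iM; first exact: measurable_funX.
move=> x Ix; rewrite ger0_norm ?sqr_ge0//= exprMn ler_wpM2r ?sqr_ge0//.
rewrite -(real_normK (num_real (a x))) lerXn2r ?nnegrE//; last exact: aM.
exact: le_trans (aM _ Ix).
Qed.

Lemma ae_filterS (P Q : R -> Prop) : (forall x, P x -> Q x) ->
  {ae mu, forall x, P x} -> {ae mu, forall x, Q x}.
Proof. exact: (@filterS _ _ (ae_filter_ringOfSetsType mu)). Qed.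

Lemma ae_filterS2 (P Q S : R -> Prop) : (forall x, P x -> Q x -> S x) ->
  {ae mu, forall x, P x} -> {ae mu, forall x, Q x} -> {ae mu, forall x, S x}.
Proof. exact: (@filterS2 _ _ (ae_filter_ringOfSetsType mu)). Qed.

Lemma ae_eqI_refl u : ae_eqI u u.
Proof. exact: aeW. Qed.

Lemma ae_eqI_sym u v : ae_eqI u v -> ae_eqI v u.
Proof. by apply: ae_filterS => x h Ix; rewrite h. Qed.

Lemma ae_eqI_trans v u w : ae_eqI u v -> ae_eqI v w -> ae_eqI u w.
Proof. by apply: ae_filterS2 => x h1 h2 Ix; rewrite h1// h2. Qed.

Lemma dotI_ael u u' v : L2I u -> L2I u' -> L2I v -> ae_eqI u u' ->
  dotI u v = dotI u' v.
Proof.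
move=> [mu_ _] [mu' _] [mv _] uu'; rewrite /dotI /Rintegral; congr fine.
apply: ae_eq_integral => //.
- by apply/measurable_EFinP; exact: measurable_funM.
- by apply/measurable_EFinP; exact: measurable_funM.
- by apply: ae_filterS uu' => x h Ix; rewrite h.
Qed.

Lemma dotI_aer u v v' : L2I u -> L2I v -> L2I v' -> ae_eqI v v' ->
  dotI u v = dotI u v'.
Proof.
move=> Lu Lv Lv' vv'.
by rewrite dotI_sym_bilin.1// (dotI_ael Lv Lv' Lu vv') dotI_sym_bilin.1.
Qed.

Lemma dotI_eq0 u : L2I u -> dotI u u = 0 -> ae_eqI u (cst 0).
Proof.
move=> Lu u0; have iu := L2I_mul_int Lu Lu; have [mu_ _] := Lu.
have h : (\int[mu]_(x in I) `|(u x * u x)%:E| = 0)%E.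
  rewrite (_ : (\int[mu]_(x in I) _)%E = (\int[mu]_(x in I) (u x * u x)%:E)%E).
    rewrite -[LHS]fineK ?[X in X%:E]u0//.
    exact: integrable_fin_num.
  by apply: eq_integral => x _; rewrite gee0_abs// lee_fin -expr2 sqr_ge0.
have m2 : measurable_fun I (fun x => (u x * u x)%:E).
  by apply/measurable_EFinP; exact: measurable_funM.
have /= := (ae_eq_integral_abs mu measurable_I01 m2).1 h.
apply: ae_filterS => x + Ix => /(_ Ix)[] /eqP.
by rewrite mulf_eq0 orbb => /eqP.
Qed.

Lemma ae_eq0_dotI u : L2I u -> ae_eqI u (cst 0) -> dotI u u = 0.
Proof.
move=> Lu u0; rewrite (dotI_ael Lu (L2I_cst 0) Lu u0) /dotI.
transitivity (\int[mu]_(x in I) (0 : R)).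
  by apply: eq_Rintegral => x _; rewrite mul0r.
exact: Rintegral_I01_cst.
Qed.

End SquareIntegrable.

(** * Primitives of square integrable functions *)

Section Primitive.
Context {R : realType}.
Implicit Types u v w g f : R -> R.
Local Notation mu := (@lebesgue_measure R).
Local Notation I := (@I01 R).
Local Notation E := (R -> R).

(** The indicator functions of the half-lines below and above [x]. *)
Definition below (x : R) : R -> R := fun t => (t < x)%R%:R.

Definition above (x : R) : R -> R := fun t => (x < t)%R%:R.

(** The primitive of [g] that vanishes at 0, for [x] in [0, 1]; writing it as an
    inner product makes it linear in [g] and lets Cauchy-Schwarz bound its
    increments.  It is constant outside [0, 1]. *)
Definition prim g (x : R) : R := dotI (below x) g.

Lemma below_indic x : below x = \1_(`]-oo, x[).
Proof.
apply/funext => t; rewrite /below indicE; congr (_%:R).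
by rewrite mem_setE in_itv.
Qed.

Lemma measurable_below (D : set R) x : measurable_fun D (below x).
Proof. by rewrite below_indic; exact: measurable_indic. Qed.

Lemma L2I_below x : L2I (below x).
Proof.
apply: (@L2I_bounded _ _ 1); first exact: measurable_below.
by move=> t _; rewrite /below; case: (t < x)%R; rewrite ?normr1 ?normr0.
Qed.

Lemma L2I_above x : L2I (above x).
Proof.
apply: (@L2I_bounded _ _ 1); last first.
  by move=> t _; rewrite /above; case: (x < t)%R; rewrite ?normr1 ?normr0.
rewrite (_ : above x = \1_(`]x, +oo[ : set R)); first exact: measurable_indic.
by apply/funext => t; rewrite /above indicE mem_setE in_itv/= andbT.
Qed.

Lemma primZD (c : R) u v x : L2I u -> L2I v ->
  prim (c *: (u : E) + v) x = c * prim u x + prim v x.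
Proof.
move=> Lu Lv; rewrite /prim dotI_sym_bilin.1//; first last.
- exact: L2I_subspace.2.
- exact: L2I_below.
rewrite dotI_sym_bilin.2//; last exact: L2I_below.
have Lb := L2I_below x.
by rewrite (dotI_sym_bilin.1 u (below x))// (dotI_sym_bilin.1 v (below x)).
Qed.

Lemma primB u v x : L2I u -> L2I v -> prim ((u : E) - v) x = prim u x - prim v x.
Proof.
move=> Lu Lv; apply: (bilinBr L2I_subspace dotI_sym_bilin) => //.
exact: L2I_below.
Qed.

Lemma prim_ae u v x : L2I u -> L2I v -> ae_eqI u v -> prim u x = prim v x.
Proof. by move=> Lu Lv uv; apply: dotI_aer => //; exact: L2I_below. Qed.

Lemma prim0 g x : x <= 0 -> prim g x = 0.
Proof.
move=> x0; rewrite /prim /dotI.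
transitivity (\int[mu]_(x in I) (0 : R)).
  apply: eq_Rintegral => t /set_mem/I01P/andP[t0 _].
  by rewrite /below ltNge (ltW (le_lt_trans x0 t0)) mul0r.
exact: Rintegral_I01_cst.
Qed.

Lemma prim_ge1 g x : 1 <= x -> prim g x = prim g 1.
Proof.
move=> x1; apply: eq_Rintegral => t /set_mem/I01P/andP[_ t1].
by rewrite /below t1 (lt_le_trans t1 x1).
Qed.

Lemma below_dist x y : x <= y ->
  dotI ((below y : E) - below x) ((below y : E) - below x) <= y - x.
Proof.
move=> xy; rewrite /dotI.
have pw (t : R) : ((below y : E) - below x) t * ((below y : E) - below x) t =
    \1_(`[x, y[ : set R) t.
  rewrite indicE mem_setE in_itv/=.
  change (((t < y)%R%:R - (t < x)%R%:R) * ((t < y)%R%:R - (t < x)%R%:R) =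
    (x <= t < y)%R%:R :> R).
  have [tx|xt] := ltP t x; first by rewrite (lt_le_trans tx xy) subrr mul0r.
  by rewrite subr0 -natrM mulnb andbb.
rewrite (eq_Rintegral mu (fun t _ => pw t)).
rewrite /Rintegral integral_indic//; last exact: measurable_I01.
have h : (mu (`[x, y[ `&` I) <= mu `[x, y[)%E.
  by apply: le_measure; rewrite ?inE//; apply: measurableI => //; exact: measurable_I01.
have muxy : mu `[x, y[ = (y - x)%:E.
  rewrite lebesgue_measure_itv/= lte_fin; have [//|yx] := ltP.
  by have -> : x = y; [apply/eqP; rewrite eq_le xy yx|rewrite subrr].
rewrite -[leRHS]/(fine (y - x)%:E) -muxy fine_le//.
  by rewrite ge0_fin_numE// (le_lt_trans h)// muxy ltry.
by rewrite muxy.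
Qed.

(** Primitives of L^2 functions are 1/2-Hoelder continuous. *)
Lemma prim_holder g x y : L2I g ->
  (prim g y - prim g x) ^+ 2 <= `|y - x| * dotI g g.
Proof.
move=> Lg; wlog xy : x y / x <= y.
  move=> H; have [/H//|/ltW yx] := leP x y.
  by rewrite -sqrrN opprB -normrN opprB; exact: H.
have Lx := L2I_below x; have Ly := L2I_below y.
have LB := subspaceB L2I_subspace Ly Lx.
rewrite /prim -(bilinB dotI_sym_bilin)//.
apply: (le_trans (psd_CS L2I_subspace dotI_sym_bilin dotI_psd LB Lg)).
rewrite ler_wpM2r//; first exact: dotI_psd.
by rewrite ger0_norm ?subr_ge0//; exact: below_dist.
Qed.

Lemma prim_sq_le g x : L2I g -> prim g x ^+ 2 <= dotI g g.
Proof.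
move=> Lg; have g0 := dotI_psd Lg.
have [x0|x0] := leP x 0; first by rewrite prim0// expr0n.
have aux (y : R) : 0 <= y -> y <= 1 -> prim g y ^+ 2 <= dotI g g.
  move=> y0 y1; have := prim_holder 0 y Lg.
  rewrite (prim0 _ (lexx 0)) !subr0 => /le_trans; apply.
  by rewrite ger0_norm// ler_piMl.
have [x1|x1] := leP x 1; first exact: aux (ltW x0) x1.
by rewrite prim_ge1 ?(ltW x1)//; exact: aux.
Qed.

Lemma prim_continuous g : L2I g -> continuous (prim g).
Proof.
move=> Lg x; apply/cvgrPdist_le => e e0.
have g0 := dotI_psd Lg.
have d0 : 0 < e ^+ 2 / (dotI g g + 1) by rewrite divr_gt0 ?exprn_gt0//; lra.
near=> y.
rewrite -(@ler_pXn2r _ 2) ?nnegrE// ?(ltW e0)//.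
rewrite real_normK ?num_real//; apply: (le_trans (prim_holder _ _ Lg)).
have : `|x - y| <= e ^+ 2 / (dotI g g + 1).
  by near: y; apply: cvgr_dist_le.
rewrite ler_pdivlMr; last by lra.
have := normr_ge0 (x - y); nra.
Unshelve. all: by end_near. Qed.

Lemma L2I_continuous f (M : R) : continuous f -> (forall x, I x -> `|f x| <= M) ->
  L2I f.
Proof.
move=> cf; apply: L2I_bounded.
apply: (measurable_funS measurableT) => //; exact: continuous_measurable_fun.
Qed.

Lemma L2I_prim g : L2I g -> L2I (prim g).
Proof.
move=> Lg; apply: (@L2I_continuous _ (dotI g g + 1)); first exact: prim_continuous.
move=> x _; have g0 := dotI_psd Lg.
rewrite -(@ler_pXn2r _ 2) ?nnegrE//; last by lra.
rewrite real_normK ?num_real//; apply: (le_trans (prim_sq_le x Lg)); nra.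
Qed.

Lemma dotI_prim_le g : L2I g -> dotI (prim g) (prim g) <= dotI g g.
Proof.
move=> Lg; have Lp := L2I_prim Lg.
have -> : dotI g g = \int[mu]_(x in I) (dotI g g : R).
  by rewrite Rintegral_I01_cst.
apply: le_Rintegral.
- exact: measurable_I01.
- exact: L2I_mul_int.
- exact: intI_cst.
- by move=> x _; rewrite -expr2; exact: prim_sq_le.
Qed.

(** Lebesgue's differentiation theorem for primitives. *)
Lemma prim_derive g : L2I g ->
  {ae mu, forall x, I x -> derivable (prim g) x 1 /\ derive1 (prim g) x = g x}.
Proof.
move=> Lg; pose f := g \_ I.
have ig : intI g.
  have := L2I_mul_int (L2I_cst 1) Lg; congr (_.-integrable _ _).
  by apply/funext => x /=; rewrite mul1r.
have if_ : mu.-integrable setT (EFin \o f).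
  rewrite /f -restrict_EFin; apply/integrable_restrict => //.
    exact: measurable_I01.
  by rewrite setTI.
have iF (A : set R) : measurable A -> mu.-integrable A (EFin \o f).
  by move=> mA; apply: (integrableS measurableT).
have FE : (fun x => \int[mu]_(t in [set` Interval (BLeft 0) (BRight x)]) f t)%R = prim g.
  apply/funext => x; rewrite -Rintegral_itv_bndo_bndc; last exact: iF.
  rewrite Rintegral_mkcond [RHS]Rintegral_mkcond.
  apply: eq_Rintegral => t _; rewrite /f !patchE.
  have [|tI] := boolP (t \in I); last first.
    by case: ifP => //.
  rewrite inE => /I01P/andP[t0 t1]; rewrite mem_setE in_itv/= (ltW t0)/= /below.
  by case: ifP => _; rewrite ?mul1r ?mul0r.
have := @FTC1 R f (BLeft 0) (fun y => iF _ (measurable_itv _)).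
have lf : locally_integrable setT f by exact: (integrable_locally measurable_I01).
move=> /(_ lf); rewrite FE.
apply: ae_filterS => x + Ix; have /I01P/andP[x0 x1] := Ix.
have h : (BLeft (0%R : R) < BRight x)%E by rewrite lte_fin.
move=> /(_ h)[? ->]; split => //.
by rewrite /f patchE mem_set.
Qed.

End Primitive.

(** * Integration by parts *)

Section KernelFubini.
Context {d : measure_display} {T : measurableType d} {R : realType}.
Variable m : {sigma_finite_measure set T -> \bar R}.
Variables (k : T * T -> R) (f g : T -> R).
Hypothesis mk : measurable_fun setT k.
Hypothesis k1 : forall z, `|k z| <= 1.
Hypothesis intf : m.-integrable setT (EFin \o f).
Hypothesis intg : m.-integrable setT (EFin \o g).

Let mf : measurable_fun setT f.
Proof. by apply/measurable_EFinP; exact: measurable_int intf. Qed.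

Let mg : measurable_fun setT g.
Proof. by apply/measurable_EFinP; exact: measurable_int intg. Qed.

Let integrable_kf x : m.-integrable setT (fun y => (k (x, y) * f y)%:E).
Proof.
apply: (le_integrable _ _ _ intf) => //.
  apply/measurable_EFinP; apply: measurable_funM => //.
  by apply: measurableT_comp => //; exact: measurable_pair1.
move=> y _ /=; rewrite lee_fin normrM ler_piMl//.
Qed.

Let integrable_kg y : m.-integrable setT (fun x => (k (x, y) * g x)%:E).
Proof.
apply: (le_integrable _ _ _ intg) => //.
  apply/measurable_EFinP; apply: measurable_funM => //.
  by apply: measurableT_comp => //; exact: measurable_pair2.
move=> x _ /=; rewrite lee_fin normrM ler_piMl//.
Qed.

(** Fubini's theorem for a bounded kernel [k] applied to integrable functions. *)
Lemma Rintegral_kernel_swap :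
  \int[m]_x (\int[m]_y (k (x, y) * f y) * g x) =
  \int[m]_y (\int[m]_x (k (x, y) * g x) * f y).
Proof.
pose F (z : T * T) := (k z * f z.2 * g z.1)%:E.
have mF : measurable_fun setT F.
  apply/measurable_EFinP; apply: measurable_funM.
    by apply: measurable_funM => //; apply: measurableT_comp.
  by apply: measurableT_comp.
have mgn : measurable_fun setT (fun x => `|g x|) by exact: measurableT_comp.
have mfn : measurable_fun setT (fun x => `|f x|) by exact: measurableT_comp.
have maF : measurable_fun setT (abse \o F) by exact: measurableT_comp.
have iF : (m \x m)%E.-integrable setT F.
  apply/integrable12ltyP => //.
  apply: (@le_lt_trans _ _ (\int[m]_x \int[m]_y (`|g x| * `|f y|)%:E)%E).
    apply: ge0_le_integral => //.
    - by move=> x _; exact: integral_ge0.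
    - apply: (measurable_fun_fubini_tonelli_F (abse \o F)).
        exact: maF.
      by move=> z; exact: abse_ge0.
    - apply: (measurable_fun_fubini_tonelli_F (fun z => (`|g z.1| * `|f z.2|)%:E)) .
        apply/measurable_EFinP; apply: measurable_funM.
          exact: (measurableT_comp mgn measurable_fst).
        exact: (measurableT_comp mfn measurable_snd).
      by move=> z; rewrite lee_fin mulr_ge0.
    - move=> x _; apply: ge0_le_integral => //.
      + exact: (measurableT_comp maF (measurable_pair1 x)).
      + apply/measurable_EFinP; exact: measurable_funM.
      + move=> y _; rewrite lee_fin /= !normrM mulrC ler_wpM2l//.
        by rewrite ler_piMl.
  rewrite (_ : (\int[m]_x _)%E = (\int[m]_x (`|g x|%:E * \int[m]_y `|f y|%:E))%E).
    have [_ fy] := integrableP _ _ _ intf; have [_ gy] := integrableP _ _ _ intg.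
    rewrite ge0_integralZr//.
    + by apply: lte_mul_pinfty => //; rewrite ?integral_ge0 ?ge0_fin_numE ?integral_ge0.
    + by apply/measurable_EFinP; apply: measurableT_comp.
    + by rewrite integral_ge0.
  apply: eq_integral => x _; rewrite -ge0_integralZl//.
  by apply/measurable_EFinP; apply: measurableT_comp.
have := Fubini iF; rewrite /Rintegral.
have E1 x : (\int[m]_y F (x, y) = (fine (\int[m]_y (k (x, y) * f y)%:E) * g x)%:E)%E.
  rewrite EFinM fineK; last exact: integrable_fin_num.
  by rewrite muleC -integralZl//; apply: eq_integral => y _; rewrite /F muleC.
have E2 y : (\int[m]_x F (x, y) = (fine (\int[m]_x (k (x, y) * g x)%:E) * f y)%:E)%E.
  rewrite EFinM fineK; last exact: integrable_fin_num.
  rewrite muleC -integralZl//; apply: eq_integral => x _.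
  by rewrite /F -EFinM; congr EFin; rewrite /=; ring.
move=> h; congr fine.
rewrite -(eq_integral _ _ (fun x _ => E1 x)) h.
by apply: eq_integral => y _; rewrite E2.
Qed.

End KernelFubini.

Section IntegrationByParts.
Context {R : realType}.
Implicit Types u v w g f : R -> R.
Local Notation mu := (@lebesgue_measure R).
Local Notation I := (@I01 R).
Local Notation E := (R -> R).

Lemma L2I_int g : L2I g -> intI g.
Proof.
move=> Lg; have := L2I_mul_int (L2I_cst 1) Lg; congr (_.-integrable _ _).
by apply/funext => x /=; rewrite mul1r.
Qed.

Lemma restrict_int g : L2I g -> mu.-integrable setT (EFin \o (g \_ I)).
Proof.
move=> Lg; rewrite -restrict_EFin; apply/integrable_restrict => //.
  exact: measurable_I01.
by rewrite setTI; exact: L2I_int.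
Qed.

Lemma measurable_lt_pair :
  measurable_fun [set: measurableTypeR R * measurableTypeR R]
    (fun z => ((z.1 : R) < z.2)%R%:R : R).
Proof.
rewrite (_ : (fun _ => _) = fun z => if ((z.1 : R) < z.2)%R then 1 else 0 : R).
  apply: measurable_fun_ifT => //.
  apply: measurable_fun_ltr; [exact: measurable_fst|exact: measurable_snd].
by apply/funext => z; case: ifP.
Qed.

Lemma ae_neq (x : R) : {ae mu, forall t, t != x}.
Proof.
exists [set x]; split; first exact: measurable_set1.
  exact: lebesgue_measure_set1.
by move=> t /= /negP; rewrite negbK => /eqP.
Qed.

Lemma dotI_above f (x : R) : L2I f ->
  dotI (above x) f = prim f 1 - prim f x.
Proof.
move=> Lf; have L1 := L2I_below 1; have Lx := L2I_below x.
rewrite /prim -(bilinB dotI_sym_bilin)//.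
apply: dotI_ael => //.
- exact: L2I_above.
- exact: (subspaceB L2I_subspace).
apply: ae_filterS (ae_neq x) => t tx /I01P/andP[_ t1].
rewrite /above [RHS](_ : _ = (t < 1)%R%:R - (t < x)%R%:R)// t1.
by case: (ltgtP t x) tx => //= _ _; rewrite ?subrr ?subr0.
Qed.

Lemma restrictM (h g : E) x : h x * (g \_ I) x = ((fun x => h x * g x) \_ I) x.
Proof. by rewrite !patchE; case: ifP => //; rewrite mulr0. Qed.

Lemma Rintegral_restrict (h g : E) :
  \int[mu]_x (h x * (g \_ I) x) = dotI h g.
Proof.
by rewrite /dotI [RHS]Rintegral_mkcond; apply: eq_Rintegral => x _; exact: restrictM.
Qed.

(** Fubini's theorem for the indicator of the triangle [t < x]. *)
Lemma dotI_prim_above f g : L2I f -> L2I g ->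
  dotI (prim g) f = dotI (fun t => prim f 1 - prim f t) g.
Proof.
move=> Lf Lg.
pose k (z : measurableTypeR R * measurableTypeR R) : R := ((z.1 : R) < z.2)%R%:R.
have k1 z : `|k z| <= 1.
  by rewrite /k; case: (_ < _)%R; rewrite ?normr1 ?normr0.
have mkk : measurable_fun setT k by exact: measurable_lt_pair.
have := Rintegral_kernel_swap mkk k1 (restrict_int Lf) (restrict_int Lg).
have E1 (x : R) : \int[mu]_y (k (x, y) * (f \_ I) y) = prim f 1 - prim f x.
  by rewrite -dotI_above// -Rintegral_restrict.
have E2 (y : R) : \int[mu]_x (k (x, y) * (g \_ I) x) = prim g y.
  by rewrite Rintegral_restrict.
rewrite (eq_Rintegral mu (g := fun x => (prim f 1 - prim f x) * (g \_ I) x)); last first.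
  by move=> x _; rewrite E1.
rewrite Rintegral_restrict => ->; rewrite -Rintegral_restrict.
by apply: eq_Rintegral => y _; rewrite E2.
Qed.

Lemma prim1E g : prim g 1 = dotI (cst 1) g.
Proof.
apply: eq_Rintegral => t /set_mem/I01P/andP[_ t1].
by rewrite /below t1.
Qed.

Lemma dotI_cstl (c : R) g : L2I g -> dotI (cst c) g = c * prim g 1.
Proof.
move=> Lg; rewrite prim1E -(bilinZ L2I_subspace dotI_sym_bilin)//.
  congr dotI; apply/funext => t; change (c = c * 1); by rewrite mulr1.
exact: L2I_cst.
Qed.

Lemma prim_by_parts f g : L2I f -> L2I g ->
  dotI (prim g) f = prim g 1 * prim f 1 - dotI g (prim f).
Proof.
move=> Lf Lg; rewrite dotI_prim_above//.
have Lp := L2I_prim Lf; have Lc := L2I_cst (prim f 1).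
rewrite -[X in dotI X _]/((cst (prim f 1) : E) - prim f).
rewrite (bilinB dotI_sym_bilin)// dotI_cstl// mulrC.
by rewrite (dotI_sym_bilin.1 g).
Qed.

End IntegrationByParts.

(** * Truncated powers *)

Section TruncatedPowers.
Context {R : realType}.
Implicit Types (x y c d : R) (f F : R -> R).

(** A first-order expansion with a quadratic remainder yields the derivative. *)
Lemma is_derive_quadratic f x (l C : R) :
  (forall y, `|f y - f x - l * (y - x)| <= C * (y - x) ^+ 2) ->
  is_derive x 1 f l.
Proof.
move=> h.
have C0 : 0 <= C.
  have := h (x + 1); rewrite (_ : x + 1 - x = 1); last by ring.
  by rewrite expr1n !mulr1; exact: le_trans.
have cv : (fun k : R => k^-1 *: (f (k *: 1 + x) - f x)) @ 0^' --> l.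
  apply/cvgrPdist_le => e e0; near=> k.
  have k0 : k != 0 by near: k; exact: nbhs_dnbhs_neq.
  have ke : `|k| <= e / (C + 1).
    by near: k; apply: dnbhs0_le; rewrite divr_gt0//; lra.
  have := h (k *: 1 + x); rewrite addrK [k *: 1]mulr1 => hk.
  rewrite -(@ler_pM2l _ `|k|) ?normr_gt0// -normrM.
  rewrite (_ : k * (l - _) = - (f (k + x) - f x - l * k)); last first.
    by rewrite [_ *: _]mulrC; field.
  rewrite normrN; apply: (le_trans hk); rewrite -(real_normK (num_real k)).
  rewrite expr2 mulrCA ler_wpM2l//.
  apply: (@le_trans _ _ ((C + 1) * `|k|)); first by rewrite ler_wpM2r//; lra.
  by rewrite mulrC -ler_pdivlMr//; lra.
apply: DeriveDef; first by apply/cvg_ex; exists l.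
exact: cvg_lim.
Unshelve. all: by end_near. Qed.

(** The positive part of [x]; its powers are truncated powers. *)
Definition pos x : R := Num.max x 0.

Lemma pos_ge0 x : 0 <= pos x.
Proof. by rewrite /pos le_max lexx orbT. Qed.

Lemma pos_le0 x : x <= 0 -> pos x = 0.
Proof. by move=> x0; apply/max_idPr. Qed.

Lemma pos_id x : 0 <= x -> pos x = x.
Proof. by move=> x0; apply/max_idPl. Qed.

Lemma pos_continuous : continuous pos.
Proof. by move=> x; apply: continuous_max => //; exact: cvg_cst. Qed.

Lemma is_derive_pos2 x : is_derive x 1 (fun x => pos x ^+ 2) (2 * pos x).
Proof.
apply: (@is_derive_quadratic _ _ _ 1) => y; rewrite ler_norml.
have sxy := sqr_ge0 (y - x); have sy := sqr_ge0 y.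
have [x0|x0] := leP x 0; have [y0|y0] := leP y 0; rewrite ?(pos_le0 x0)
  ?(pos_le0 y0) ?(pos_id (ltW x0)) ?(pos_id (ltW y0)); apply/andP; split.
- lra.
- lra.
- have := mulr_ge0_le0 (ltW y0) x0; nra.
- have := mulr_ge0_le0 (ltW y0) x0; nra.
- have := mulr_ge0_le0 (ltW x0) y0; nra.
- have := mulr_ge0_le0 (ltW x0) y0; nra.
- nra.
- nra.
Qed.

Lemma is_derive_pos3 x : is_derive x 1 (fun x => pos x ^+ 3) (3 * pos x ^+ 2).
Proof.
have E : (fun x => pos x ^+ 3) = (fun x => pos x ^+ 2) * id.
  apply/funext => y; rewrite [RHS](_ : _ = pos y ^+ 2 * y)//.
  have [y0|y0] := leP y 0; first by rewrite pos_le0// !expr0n mul0r.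
  by rewrite pos_id ?(ltW y0)// exprSr.
rewrite E; have h := is_derive_pos2 x.
apply: is_derive_eq.
change (pos x ^+ 2 * 1 + x * (2 * pos x) = 3 * pos x ^+ 2).
have [x0|x0] := leP x 0; first by rewrite pos_le0//; ring.
by rewrite pos_id ?(ltW x0)//; ring.
Qed.

End TruncatedPowers.

(** * Continuous functions on the closed unit interval *)

Section ContinuousFunctions.
Context {R : realType}.
Implicit Types (x y c d : R) (f g F u v : R -> R).
Local Notation mu := (@lebesgue_measure R).
Local Notation I := (@I01 R).
Local Notation E := (R -> R).

Lemma sub_I01_cc : I `<=` `[0, 1].
Proof. by move=> x /I01P/andP[x0 x1]; rewrite /= in_itv/= !ltW. Qed.

Lemma within_measurable f : {within `[0, 1], continuous f} -> measurable_fun I f.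
Proof.
move=> cf; apply: (measurable_funS _ sub_I01_cc) => //.
exact: subspace_continuous_measurable_fun.
Qed.

Lemma within_bounded f : {within `[0, 1], continuous f} ->
  exists2 M : R, 0 <= M & forall x, 0 <= x <= 1 -> `|f x| <= M.
Proof.
move=> cf; have [c _ fc] := EVT_max ler01 cf; have [d _ fd] := EVT_min ler01 cf.
exists (`|f c| + `|f d|) => [|x x01]; first by rewrite addr_ge0.
have h1 := fc x ltac:(by rewrite in_itv). have h2 := fd x ltac:(by rewrite in_itv).
rewrite ler_norml; have := ler_norm (f c); have := ler_norm (- f d).
rewrite normrN; have := normr_ge0 (f c); have := normr_ge0 (f d).
move=> *; apply/andP; split; lra.
Qed.

Lemma L2I_within f : {within `[0, 1], continuous f} -> L2I f.
Proof.
move=> cf; have [M _ fM] := within_bounded cf.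
apply: (@L2I_bounded _ _ M); first exact: within_measurable.
by move=> x /I01P/andP[x0 x1]; apply: fM; rewrite !ltW.
Qed.

Lemma L2I_cont f : continuous f -> L2I f.
Proof. by move=> cf; apply: L2I_within; exact: continuous_subspaceT. Qed.

Lemma is_derive_continuous F f : (forall x, is_derive x 1 F (f x)) -> continuous F.
Proof.
move=> dF x; apply: differentiable_continuous; apply/derivable1_diffP.
by have [] := dF x.
Qed.

Lemma prim_itv f (a b : R) : 0 <= a -> a <= b -> b <= 1 -> measurable_fun I f ->
  \int[mu]_(t in `[a, b]) f t = \int[mu]_(t in I) ((a < t < b)%R%:R * f t).
Proof.
move=> a0 ab b1 mf.
have -> : \int[mu]_(t in `[a, b]) f t = \int[mu]_(t in `]a, b[) f t.
  rewrite /Rintegral integral_itv_bndoo//; apply/measurable_EFinP.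
  apply: measurable_funS mf; first exact: measurable_itv.
  by apply: subset_itv; rewrite bnd_simp.
rewrite Rintegral_mkcond [RHS]Rintegral_mkcond; apply: eq_Rintegral => t _.
rewrite !patchE /I01 !mem_setE !in_itv/=.
have [/andP[at_ tb]|h] := boolP (a < (t : R) < b).
  by rewrite (le_lt_trans a0 at_) (lt_le_trans tb b1) /= mul1r.
by rewrite mul0r; case: ifP.
Qed.

Lemma prim_itv0 f x : 0 <= x <= 1 -> measurable_fun I f ->
  \int[mu]_(t in `[0, x]) f t = prim f x.
Proof.
move=> /andP[x0 x1] mf; rewrite prim_itv//; apply: eq_Rintegral => t.
by move=> /set_mem/I01P/andP[t0 _]; rewrite /below t0.
Qed.

(** The fundamental theorem of calculus for C^1 functions. *)
Lemma prim_of_derive F f x : (forall x, is_derive x 1 F (f x)) -> continuous f ->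
  0 <= x <= 1 -> prim f x = F x - F 0.
Proof.
move=> dF cf x01; have /andP[x0 x1] := x01.
have cF := is_derive_continuous dF.
move: x0; rewrite le_eqVlt => /predU1P[<-|x0]; first by rewrite prim0// subrr.
have cwf : {within `[0, 1], continuous f} by exact: continuous_subspaceT.
rewrite -prim_itv0//; last exact: within_measurable.
rewrite /Rintegral (@continuous_FTC2 _ _ F)//.
- exact: continuous_subspaceT.
- split.
  + by move=> y _; have [] := dF y.
  + by apply: cvg_at_right_filter; exact: cF.
  + by apply: cvg_at_left_filter; exact: cF.
- by move=> y _; rewrite derive1E; have [_] := dF y.
Qed.

(** A property that holds almost everywhere cannot fail on a whole interval. *)
Lemma ae_not_itv (c d : R) (P : R -> Prop) : 0 <= c -> c < d -> d <= 1 ->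
  {ae mu, forall x, I x -> P x} -> ~ (forall y, c < y < d -> ~ P y).
Proof.
move=> c0 cd d1 [N [mN N0 hN]] h.
have : (mu `]c, d[ <= mu N)%E.
  apply: le_measure; [by rewrite inE; exact: measurable_itv|by rewrite inE|].
  move=> y; rewrite /= in_itv/= => /[dup] cyd /andP[cy yd]; apply: hN => /= hy.
  by apply: (h y cyd); apply: hy; apply/I01P; rewrite (le_lt_trans c0 cy) (lt_le_trans yd d1).
rewrite lebesgue_measure_itv/= lte_fin cd N0 -EFinD lee_fin.
by rewrite subr_le0 leNgt cd.
Qed.

Lemma ae_within_eq f g : {within `[0, 1], continuous f} -> {within `[0, 1], continuous g} ->
  ae_eqI f g -> forall x, 0 <= x <= 1 -> f x = g x.
Proof.
move=> cf cg fg x /andP[x0 x1]; apply: contrapT => /eqP fgx.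
have /(continuous_within_itvP _ ltr01)[cf1 cf2 cf3] := cf.
have /(continuous_within_itvP _ ltr01)[cg1 cg2 cg3] := cg.
have h0 : 0 < `|f x - g x| by rewrite normr_gt0 subr_eq0.
have sep y : `|(f x - g x) - (f y - g y)| < `|f x - g x| -> f y <> g y.
  by move=> + E0; rewrite E0 subrr subr0 ltxx.
have [xlt1|xge1] := ltP x 1.
  have ch : (fun y => f y - g y) @ x^'+ --> f x - g x.
    move: x0; rewrite le_eqVlt => /predU1P[<-|x0]; first exact: cvgB.
    by apply: cvg_at_right_filter; apply: cvgB; [apply: cf1|apply: cg1]; rewrite in_itv/= x0.
  move: ch => /cvgrPdist_lt/(_ _ h0)[e /= e0 he].
  apply: (@ae_not_itv x (Num.min 1 (x + e)) (fun y => f y = g y)) => //.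
  - by rewrite lt_min xlt1 ltrDl.
  - by rewrite ge_min lexx.
  - move=> y /andP[xy]; rewrite lt_min => /andP[y1 ye]; apply: sep; apply: he => //=.
    by rewrite ltr_norml; apply/andP; split; lra.
have xE : x = 1 by apply/eqP; rewrite eq_le x1.
have : (fun y => f y - g y) @ x^'- --> f x - g x by rewrite xE; exact: cvgB.
move=> /cvgrPdist_lt/(_ _ h0)[e /= e0 he].
apply: (@ae_not_itv (Num.max 0 (1 - e)) 1 (fun y => f y = g y)) => //.
- by rewrite le_max lexx.
- by rewrite gt_max ltr01 ltrBlDr ltrDl.
- move=> y /andP[]; rewrite gt_max => /andP[y0 ye] y1; apply: sep; apply: he => //=.
    by rewrite xE ltr_norml; apply/andP; split; lra.
  by rewrite xE.
Qed.

End ContinuousFunctions.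

(** * Test functions *)

Section DuBoisReymond.
Context {R : realType}.
Implicit Types (x y c d : R) (f g F u v : R -> R).
Local Notation mu := (@lebesgue_measure R).
Local Notation I := (@I01 R).
Local Notation E := (R -> R).

Lemma is_derive_translate F (c x l : R) :
  is_derive (x - c) 1 F l -> is_derive x 1 (fun y => F (y - c)) l.
Proof.
move=> dF; have := @is_derive1_comp R F (fun y => y - c) x l 1.
rewrite mulr1; apply=> //.
rewrite -[X in is_derive _ _ _ X]subr0.
by apply: is_deriveB.
Qed.

(** The continuous function which is 0 up to [c], 1 from [c + e] on, and affine
    in between, for [0 < e]. *)
Definition ramp (e c x : R) : R := e^-1 * (pos (x - c) - pos (x - (c + e))).

(** A primitive of [ramp e c]. *)
Definition ramp_int (e c x : R) : R :=
  (2 * e)^-1 * (pos (x - c) ^+ 2 - pos (x - (c + e)) ^+ 2).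

Lemma is_derive_ramp_int e c x : 0 < e -> is_derive x 1 (ramp_int e c) (ramp e c x).
Proof.
move=> e0.
have d1 k : is_derive x 1 (fun y => pos (y - k) ^+ 2) (2 * pos (x - k)).
  by apply: (@is_derive_translate (fun x => pos x ^+ 2)); exact: is_derive_pos2.
have d1c := d1 c; have d1e := d1 (c + e).
have -> : ramp_int e c =
  (2 * e)^-1 *: ((fun y => pos (y - c) ^+ 2) - (fun y => pos (y - (c + e)) ^+ 2) : E).
  by [].
apply: is_derive_eq.
rewrite /ramp; change ((2 * e)^-1 * (2 * pos (x - c) - 2 * pos (x - (c + e))) =
  e^-1 * (pos (x - c) - pos (x - (c + e)))).
by field; rewrite gt_eqF.
Qed.

Lemma ramp_continuous e c : continuous (ramp e c).
Proof.
move=> x; rewrite /ramp; apply: cvgM; first exact: cvg_cst.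
have hp k : {for x, continuous (fun y : R => pos (y - k))}.
  apply: (@continuous_comp _ _ _ (fun y => y - k) pos); last exact: pos_continuous.
  by apply: cvgB; [exact: cvg_id|exact: cvg_cst].
by apply: cvgB; exact: hp.
Qed.

Lemma ramp_int_left e c x : 0 < e -> x <= c -> ramp_int e c x = 0.
Proof. by move=> e0 xc; rewrite /ramp_int !pos_le0 ?subrr ?mulr0//; lra. Qed.

Lemma ramp_int_right e c x : 0 < e -> c + e <= x -> ramp_int e c x = x - c - e / 2.
Proof.
move=> e0 xc; rewrite /ramp_int !pos_id; [|lra|lra].
by field; rewrite gt_eqF.
Qed.

(** The functions [ramp e c - ramp e d] and [ramp e c' - ramp e d'] have the same
    integral when [d - c = d' - c'], so that their difference is the derivative of
    a test function; [lo] and [hi] bound its support. *)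
Lemma test_fun_ramps (e c d c' d' lo hi : R) : 0 < e -> 0 < lo -> hi < 1 ->
  d - c = d' - c' ->
  lo <= c <= hi - e -> lo <= d <= hi - e ->
  lo <= c' <= hi - e -> lo <= d' <= hi - e ->
  exists2 phi, test_fun phi &
    derive1 phi = (ramp e c : E) - ramp e d - (ramp e c' - ramp e d').
Proof.
move=> e0 lo0 hi1 dc hc hd hc' hd'.
pose phi : E := (ramp_int e c : E) - ramp_int e d - (ramp_int e c' - ramp_int e d').
pose psi : E := (ramp e c : E) - ramp e d - (ramp e c' - ramp e d').
have dphi x : is_derive x 1 phi (psi x).
  have h1 := is_derive_ramp_int c x e0; have h2 := is_derive_ramp_int d x e0.
  have h3 := is_derive_ramp_int c' x e0; have h4 := is_derive_ramp_int d' x e0.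
  by apply: is_derive_eq.
have ephi : derive1 phi = psi.
  by apply/funext => x; rewrite derive1E; have [_] := dphi x.
exists phi => //; split.
- by move=> x; have [] := dphi x.
- rewrite ephi => x.
  by apply: cvgB; apply: cvgB; exact: ramp_continuous.
- apply: (@subset_trans _ `[lo, hi]).
    rewrite closureEbigcap => z; apply; split; first exact: interval_closed.
    move=> x /= phx; rewrite in_itv/=; apply/andP; split.
      rewrite leNgt; apply/negP => xlo; move/eqP: phx; apply.
      change (ramp_int e c x - ramp_int e d x - (ramp_int e c' x - ramp_int e d' x) = 0).
      by rewrite !ramp_int_left//; lra.
    rewrite leNgt; apply/negP => xhi; move/eqP: phx; apply.
    change (ramp_int e c x - ramp_int e d x - (ramp_int e c' x - ramp_int e d' x) = 0).
    by rewrite !ramp_int_right//; lra.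
  by move=> x; rewrite /= in_itv/= => /andP[h1 h2]; apply/I01P; apply/andP; split; lra.
Qed.

Lemma ramp_above e c x : 0 < e ->
  (ramp e c x - above c x) ^+ 2 <= (below (c + e) x - below c x) ^+ 2.
Proof.
move=> e0; rewrite /ramp /below /above.
have [xc|cx] := leP x c.
  rewrite !pos_le0 ?subrr ?mulr0 ?subr0 ?expr0n ?sqr_ge0//; lra.
have [xe|ex] := ltP x (c + e).
  rewrite ltNge (ltW cx)/= subr0 expr1n.
  rewrite pos_id ?pos_le0 ?subr0; [|lra|lra].
  have h : 0 <= e^-1 * (x - c) <= 1.
    apply/andP; split; first by rewrite mulr_ge0 ?invr_ge0 ?subr_ge0// ltW.
    by rewrite mulrC ler_pdivrMr// mul1r; lra.
  move: h; set t := _ * _ => /andP[]; nra.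
rewrite ltNge (ltW cx)/= !pos_id; [|lra|lra].
rewrite (_ : _ - 1 = 0) ?expr0n ?sqr_ge0//.
by field; rewrite gt_eqF.
Qed.

Lemma ramp_limit v e c : L2I v -> 0 < e ->
  (dotI (ramp e c) v - (prim v 1 - prim v c)) ^+ 2 <= e * dotI v v.
Proof.
move=> Lv e0; rewrite -dotI_above//.
have La := L2I_above c.
have Lr : L2I (ramp e c) by apply: L2I_cont; exact: ramp_continuous.
have LB := subspaceB L2I_subspace Lr La.
have Lb := subspaceB L2I_subspace (L2I_below (c + e)) (L2I_below c).
rewrite -(bilinB dotI_sym_bilin)//.
apply: (le_trans (psd_CS L2I_subspace dotI_sym_bilin dotI_psd LB Lv)).
rewrite ler_wpM2r//; first exact: dotI_psd.
have : c <= c + e by lra.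
move=> /below_dist; rewrite addrAC subrr add0r; apply: le_trans.
apply: le_Rintegral.
- exact: measurable_I01.
- exact: L2I_mul_int.
- exact: L2I_mul_int.
- by move=> x _; rewrite -!expr2; exact: ramp_above.
Qed.

(** If [v] is orthogonal to the derivatives of test functions, the increments of
    [prim v] over intervals of the same length coincide: let the ramps of
    [test_fun_ramps] tend to indicator functions. *)
Lemma prim_increment v c d c' d' : L2I v ->
  (forall phi, test_fun phi -> dotI v (derive1 phi) = 0) ->
  I c -> I d -> I c' -> I d' -> d - c = d' - c' ->
  prim v d - prim v c = prim v d' - prim v c'.
Proof.
move=> Lv hv /I01P/andP[c0 c1] /I01P/andP[d0 d1] /I01P/andP[c'0 c'1] /I01P/andP[d'0 d'1] dc.
pose lo := Num.min (Num.min c d) (Num.min c' d').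
pose M := Num.max (Num.max c d) (Num.max c' d').
have [loc lod loc' lod'] : [/\ lo <= c, lo <= d, lo <= c' & lo <= d'].
  by rewrite /lo !ge_min !lexx !orbT.
have [cM dM c'M d'M] : [/\ c <= M, d <= M, c' <= M & d' <= M].
  by rewrite /M !le_max !lexx !orbT.
have lo0 : 0 < lo by rewrite /lo !lt_min c0 d0 c'0.
have M1 : M < 1 by rewrite /M !gt_max c1 d1 c'1.
have v0 := dotI_psd Lv.
pose Q := (prim v d - prim v c) - (prim v d' - prim v c').
suff : Q ^+ 2 <= 0.
  move=> Q2; have : Q ^+ 2 == 0 by rewrite eq_le Q2 sqr_ge0.
  by rewrite sqrf_eq0 /Q subr_eq0 => /eqP.
apply/ler_addgt0Pl => eta eta0; rewrite addr0.
pose e := Num.min ((1 - M) / 2) (eta / (16 * (dotI v v + 1))).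
have e0 : 0 < e by rewrite lt_min !divr_gt0//; lra.
have eM : e <= (1 - M) / 2 by rewrite /e ge_min lexx.
have eE : e * dotI v v <= eta / 16.
  have h : e <= eta / (16 * (dotI v v + 1)) by rewrite /e ge_min lexx orbT.
  have : e * (16 * (dotI v v + 1)) <= eta by rewrite -ler_pdivlMr//; lra.
  have : 0 <= e * dotI v v by rewrite mulr_ge0// ltW.
  lra.
have [phi tphi dphi] := @test_fun_ramps e c d c' d' lo (M + e) e0 lo0 ltac:(lra) dc
  ltac:(lra) ltac:(lra) ltac:(lra) ltac:(lra).
have := hv _ tphi; rewrite dphi.
have Lr k : L2I (ramp e k) by apply: L2I_cont; exact: ramp_continuous.
rewrite dotI_sym_bilin.1//; last by do !apply: (subspaceB L2I_subspace).
rewrite !(bilinB dotI_sym_bilin)//; try exact: (subspaceB L2I_subspace).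
have := ramp_limit c Lv e0; have := ramp_limit d Lv e0.
have := ramp_limit c' Lv e0; have := ramp_limit d' Lv e0.
set jc := dotI (ramp e c) v; set jd := dotI (ramp e d) v.
set jc' := dotI (ramp e c') v; set jd' := dotI (ramp e d') v.
set p1 := jd' - _; set p2 := jc' - _; set p3 := jd - _; set p4 := jc - _.
move=> h1 h2 h3 h4 h.
have -> : Q = - (p4 - p3 - (p2 - p1)) by rewrite /Q /p1 /p2 /p3 /p4; lra.
have := sqr_ge0 (p1 + p2); have := sqr_ge0 (p1 + p3); have := sqr_ge0 (p1 - p4).
have := sqr_ge0 (p2 - p3); have := sqr_ge0 (p2 + p4); have := sqr_ge0 (p3 + p4).
lra.
Qed.

End DuBoisReymond.

(** * Weak derivatives and primitives *)

Section WeakDerivatives.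
Context {R : realType}.
Implicit Types (x y c d : R) (f g F u v phi : R -> R).
Local Notation mu := (@lebesgue_measure R).
Local Notation I := (@I01 R).
Local Notation E := (R -> R).

(** The derivative only depends on the increments. *)
Lemma derive1_transfer f x y : derivable f x 1 ->
  (\forall h \near (0 : R), f (h + x) - f x = f (h + y) - f y) ->
  derive1 f y = derive1 f x.
Proof.
move=> dfx E0; rewrite derive1E /derive.
have cv : (fun h : R => h^-1 *: (f (h *: 1 + x) - f x)) @ 0^' --> derive1 f x.
  by rewrite derive1E /derive; exact: dfx.
apply: (@cvg_lim R^o (@Rhausdorff R)); apply: cvg_trans cv.
apply: near_eq_cvg; apply: nbhs_dnbhs; near=> h => /=.
by rewrite [h *: 1]mulr1; congr (_ *: _); near: h.
Unshelve. all: by end_near. Qed.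

(** Lemma of du Bois-Reymond: since its increments over
    intervals of the same length coincide, [prim v] has the same derivative at all
    points where it is differentiable. *)
Lemma du_bois_reymond v : L2I v ->
  (forall phi, test_fun phi -> dotI v (derive1 phi) = 0) ->
  exists c, ae_eqI v (cst c).
Proof.
move=> Lv hv.
have pd := prim_derive Lv.
have [x0 [Ix0 [dx0 vx0]]] : exists x0, I x0 /\
    (derivable (prim v) x0 1 /\ derive1 (prim v) x0 = v x0).
  apply: contrapT => /forallNP h.
  apply: (@ae_not_itv R 0 1 _ (lexx _) ltr01 (lexx _) pd) => y y01 hy.
  by apply: (h y); split => //; apply/I01P.
exists (v x0); apply: ae_filterS pd => x + Ix => /(_ Ix)[dx vx].
rewrite /= -vx -vx0; apply: derive1_transfer => //.
have nI y : I y -> \forall h \near (0 : R), I (h + y).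
  move=> /I01P/andP[y0 y1].
  have e0 : 0 < Num.min y (1 - y) by rewrite lt_min y0 subr_gt0.
  apply: filterS (nbhs0_lt e0) => h; rewrite lt_min => /andP[h1 h2].
  have n1 := ler_norm h; have n2 := ler_norm (- h); rewrite normrN in n2.
  by apply/I01P; clear -h1 h2 n1 n2 y0 y1; apply/andP; split; lra.
have n1 := nI _ Ix; have n2 := nI _ Ix0.
apply: filterS2 n1 n2 => h I1 I2; apply: prim_increment => //; ring.
Qed.

Lemma test_fun_ends phi : test_fun phi -> phi 0 = 0 /\ phi 1 = 0.
Proof.
move=> [_ _ sub].
have aux x : ~ I x -> phi x = 0.
  move=> nIx; apply/eqP/negPn/negP => px; apply: nIx; apply: sub.
  exact: subset_closure.
by split; apply: aux => /I01P; rewrite ltxx ?andbF.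
Qed.

Lemma test_fun_derive phi : test_fun phi -> forall x, is_derive x 1 phi (derive1 phi x).
Proof. by move=> [d _ _] x; apply: DeriveDef => //; rewrite derive1E. Qed.

Lemma test_fun_L2 phi : test_fun phi -> L2I phi /\ L2I (derive1 phi).
Proof.
move=> tp; split; apply: L2I_cont; last by case: tp.
exact: is_derive_continuous (test_fun_derive tp).
Qed.

Lemma test_fun_prim phi x : test_fun phi -> 0 <= x <= 1 ->
  prim (derive1 phi) x = phi x.
Proof.
move=> tp x01; rewrite (prim_of_derive (test_fun_derive tp))//; last by case: tp.
by rewrite (test_fun_ends tp).1 subr0.
Qed.

Lemma dotI_prim_test g phi : L2I g -> test_fun phi ->
  dotI (prim g) (derive1 phi) = - dotI g phi.
Proof.
move=> Lg tp; have [L1 L2] := test_fun_L2 tp.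
rewrite prim_by_parts// test_fun_prim ?ler01 ?lexx//.
rewrite (test_fun_ends tp).2 mulr0 sub0r; congr (- _).
apply: eq_Rintegral => x /set_mem/I01P/andP[x0 x1].
by rewrite test_fun_prim// !ltW.
Qed.

(** A function with a weak derivative is a primitive of it; [prim_is_wderiv] is
    the converse. *)
Lemma is_wderiv_prim u g : L2I u -> is_wderiv u g ->
  exists c, ae_eqI u (fun x => c + prim g x).
Proof.
move=> Lu [Lg hg]; have Lp := L2I_prim Lg.
have LB := subspaceB L2I_subspace Lu Lp.
have [phi tp|c hc] := du_bois_reymond LB.
  have [L1 L2] := test_fun_L2 tp.
  by rewrite (bilinB dotI_sym_bilin)// dotI_prim_test// hg// subrr.
exists c; apply: ae_filterS hc => x h Ix; have := h Ix.
change (u x - prim g x = c -> u x = c + prim g x) => <-; by rewrite subrK.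
Qed.

Lemma prim_is_wderiv u g c : L2I u -> L2I g -> ae_eqI u (fun x => c + prim g x) ->
  is_wderiv u g.
Proof.
move=> Lu Lg ug; split => // phi tp; have [L1 L2] := test_fun_L2 tp.
have Lp := L2I_prim Lg; have Lc := L2I_cst c.
have LD := subspaceD L2I_subspace Lc Lp.
rewrite (dotI_ael Lu LD L2 ug) (bilinD dotI_sym_bilin)// dotI_cstl//.
by rewrite test_fun_prim ?ler01 ?lexx// (test_fun_ends tp).2 mulr0 add0r dotI_prim_test.
Qed.

Lemma cont_addc (c : R) g : L2I g -> continuous (fun x => c + prim g x).
Proof.
by move=> Lg x; apply: cvgD; [exact: cvg_cst|exact: prim_continuous].
Qed.

Lemma prim_inj_ae (c1 c2 : R) g1 g2 : L2I g1 -> L2I g2 ->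
  ae_eqI (fun x => c1 + prim g1 x) (fun x => c2 + prim g2 x) -> ae_eqI g1 g2.
Proof.
move=> L1 L2 h.
have e12 x : 0 <= x <= 1 -> c1 + prim g1 x = c2 + prim g2 x.
  by apply: (ae_within_eq _ _ h); apply: continuous_subspaceT; exact: cont_addc.
apply: ae_filterS2 (prim_derive L1) (prim_derive L2) => x d1 d2 Ix.
have [dx1 <-] := d1 Ix; have [dx2 <-] := d2 Ix.
have : prim g1 = (prim (g1 - g2 : E) : E) + prim g2.
  by apply/funext => y; rewrite [RHS](_ : _ = prim (g1 - g2 : E) y + prim g2 y)// primB// subrK.
have near12 : {near x, prim g1 =1 (fun y => (c2 - c1) + prim g2 y)}.
  have /I01P/andP[x0 x1] := Ix.
  have : \forall y \near x, y \in `]0, 1[ by apply: near_in_itvoo; rewrite in_itv/= x0.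
  apply: filterS => y; rewrite in_itv/= => /andP[y0 y1].
  by have := e12 y; rewrite !ltW// => /(_ isT); lra.
move=> _; rewrite !derive1E.
rewrite (near_eq_derive _ near12) ?oner_neq0//.
have -> : (fun y => c2 - c1 + prim g2 y) = (cst (c2 - c1) : E) + prim g2 by [].
by rewrite (deriveD (derivable_cst _ _ _) dx2) derive_cst add0r.
Qed.

Lemma wderiv_uniq u g1 g2 : L2I u -> is_wderiv u g1 -> is_wderiv u g2 -> ae_eqI g1 g2.
Proof.
move=> Lu h1 h2; have [c1 e1] := is_wderiv_prim Lu h1.
have [c2 e2] := is_wderiv_prim Lu h2; have [L1 _] := h1; have [L2 _] := h2.
apply: (@prim_inj_ae c1 c2) => //.
exact: (ae_eqI_trans (ae_eqI_sym e1) e2).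
Qed.

Lemma wderivP u : H1 u -> is_wderiv u (wderiv u).
Proof. by move=> [_ [g hg]]; exact: (getPex (ex_intro _ g hg)). Qed.

Lemma wderiv_ae u g : L2I u -> is_wderiv u g -> ae_eqI (wderiv u) g.
Proof.
move=> Lu ug; apply: (wderiv_uniq Lu) => //; apply: wderivP.
by split => //; exists g.
Qed.

Lemma zero_trace_prim u g c : L2I g -> ae_eqI u (fun x => c + prim g x) ->
  zero_trace u -> c = 0 /\ prim g 1 = 0.
Proof.
move=> Lg ug [U [cU Uu U0 U1]].
have e12 x : 0 <= x <= 1 -> U x = c + prim g x.
  apply: (@ae_within_eq R U (fun x => c + prim g x)) => //; last first.
    exact: ae_eqI_trans Uu ug.
  by apply: continuous_subspaceT; exact: cont_addc.
have := e12 0; rewrite lexx ler01 U0 prim0// addr0 => /(_ isT) <-; split => //.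
by have := e12 1; rewrite lexx ler01 U1 => /(_ isT); have := e12 0; rewrite lexx ler01 U0 prim0//; lra.
Qed.

Lemma zero_trace_intro u g : L2I g -> ae_eqI u (prim g) -> prim g 1 = 0 -> zero_trace u.
Proof.
move=> Lg ug g1; exists (prim g); split => //.
- by apply: continuous_subspaceT; exact: prim_continuous.
- exact: ae_eqI_sym.
- exact: prim0.
Qed.

(** The second weak derivative. *)
Definition wderiv2 u := wderiv (wderiv u).

(** A function of [H20] is twice the primitive of its second weak derivative, and
    the boundary conditions say that both primitives vanish at 1. *)
Lemma H20_repr u : H20 u -> [/\ L2I u, L2I (wderiv u), L2I (wderiv2 u),
  ae_eqI (wderiv u) (prim (wderiv2 u)) & ae_eqI u (prim (wderiv u))] /\
  [/\ prim (wderiv2 u) 1 = 0, prim (wderiv u) 1 = 0,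
      prim (prim (wderiv2 u)) 1 = 0 & ae_eqI u (prim (prim (wderiv2 u)))].
Proof.
move=> [[H1u H1u'] zu zu'].
have w1 := wderivP H1u; have w2 := wderivP H1u'.
have [Lu _] := H1u; have [L1 _] := w1; have [L2 _] := w2.
have [c1 e1] := is_wderiv_prim Lu w1; have [c2 e2] := is_wderiv_prim L1 w2.
have [c10 p1] := zero_trace_prim L1 e1 zu.
have [c20 p2] := zero_trace_prim L2 e2 zu'.
have e1' : ae_eqI u (prim (wderiv u)).
  by apply: ae_filterS e1 => x h /h ->; rewrite c10 add0r.
have e2' : ae_eqI (wderiv u) (prim (wderiv2 u)).
  by apply: ae_filterS e2 => x h /h ->; rewrite c20 add0r.
have pp x : prim (wderiv u) x = prim (prim (wderiv2 u)) x.
  by apply: prim_ae => //; exact: L2I_prim.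
split; first by split.
split => //; first by rewrite -pp.
by apply: ae_filterS e1' => x h /h ->.
Qed.

Lemma H20_intro u g : L2I u -> L2I g -> prim g 1 = 0 -> prim (prim g) 1 = 0 ->
  ae_eqI u (prim (prim g)) ->
  [/\ H20 u, ae_eqI (wderiv u) (prim g) & ae_eqI (wderiv2 u) g].
Proof.
move=> Lu Lg g1 gg1 ug; have Lp := L2I_prim Lg.
have w1 : is_wderiv u (prim g).
  apply: (@prim_is_wderiv u (prim g) 0) => //.
  by apply: ae_filterS ug => x h /h ->; rewrite add0r.
have H1u : H1 u by split => //; exists (prim g).
have e1 := wderiv_ae Lu w1.
have [L1 _] := wderivP H1u.
have w2 : is_wderiv (wderiv u) g.
  apply: (@prim_is_wderiv (wderiv u) g 0) => //.
  by apply: ae_filterS e1 => x h /h ->; rewrite add0r.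
split => //; last exact: wderiv_ae.
split; first by split => //; split => //; exists g.
- exact: (zero_trace_intro Lp ug gg1).
- exact: (zero_trace_intro Lg e1 g1).
Qed.

End WeakDerivatives.

(** * The energy form *)

(* unification must not unfold the choice operator behind wderiv *)
#[local] Opaque wderiv.

Section EnergyForm.
Context {R : realType}.
Implicit Types (x y c d : R) (f g F u v w : R -> R).
Local Notation mu := (@lebesgue_measure R).
Local Notation I := (@I01 R).
Local Notation E := (R -> R).

Lemma prim_funZD (c : R) u v : L2I u -> L2I v ->
  prim (c *: (u : E) + v) = c *: (prim u : E) + prim v.
Proof. by move=> Lu Lv; apply/funext => x; exact: primZD. Qed.

Lemma ae_eqI_lin (c : R) u u' v v' : ae_eqI u u' -> ae_eqI v v' ->
  ae_eqI (c *: (u : E) + v) (c *: (u' : E) + v').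
Proof.
apply: ae_filterS2 => x h1 h2 Ix.
by change (c * u x + v x = c * u' x + v' x); rewrite h1// h2.
Qed.

(** [H20_lin] in terms of arbitrary representatives [u1], [u2], [v1], [v2] of the
    weak derivatives of [u] and [v]. *)
Lemma H20_lin_prim (c : R) u v u1 u2 v1 v2 :
  L2I u -> L2I v -> L2I u2 -> L2I v2 ->
  ae_eqI u1 (prim u2) -> ae_eqI u (prim (prim u2)) ->
  prim u2 1 = 0 -> prim (prim u2) 1 = 0 ->
  ae_eqI v1 (prim v2) -> ae_eqI v (prim (prim v2)) ->
  prim v2 1 = 0 -> prim (prim v2) 1 = 0 ->
  [/\ H20 (c *: (u : E) + v),
    ae_eqI (wderiv (c *: (u : E) + v)) (c *: (u1 : E) + v1) &
    ae_eqI (wderiv2 (c *: (u : E) + v)) (c *: (u2 : E) + v2)].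
Proof.
move=> Lu Lv Lu2 Lv2 e1 ee p1 pp1 f1 ff q1 qq1.
have Lg := L2I_subspace.2 c _ _ Lu2 Lv2.
have P := prim_funZD c Lu2 Lv2.
have PP : prim (prim (c *: (u2 : E) + v2)) =
    c *: (prim (prim u2) : E) + prim (prim v2).
  by rewrite P prim_funZD//; exact: L2I_prim.
have [] := @H20_intro R (c *: (u : E) + v) (c *: (u2 : E) + v2).
- exact: L2I_subspace.2.
- exact: Lg.
- rewrite P; change (c * prim u2 1 + prim v2 1 = 0).
  by rewrite p1 q1 mulr0 addr0.
- rewrite PP; change (c * prim (prim u2) 1 + prim (prim v2) 1 = 0).
  by rewrite pp1 qq1 mulr0 addr0.
- by rewrite PP; exact: ae_eqI_lin.
- move=> h1 h2 h3; split => //; apply: (ae_eqI_trans h2); rewrite P.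
  by apply: ae_eqI_sym; exact: ae_eqI_lin.
Qed.

Lemma H20_lin (c : R) u v : H20 u -> H20 v ->
  [/\ H20 (c *: (u : E) + v),
    ae_eqI (wderiv (c *: (u : E) + v)) (c *: (wderiv u : E) + wderiv v) &
    ae_eqI (wderiv2 (c *: (u : E) + v)) (c *: (wderiv2 u : E) + wderiv2 v)].
Proof.
move=> /H20_repr[[Lu Lu1 Lu2 e1 e0] [p1 _ pp1 ee]].
move=> /H20_repr[[Lv Lv1 Lv2 f1 f0] [q1 _ qq1 ff]].
exact: H20_lin_prim.
Qed.

Lemma H20_zero : H20 (0 : E).
Proof.
have L0 := L2I_cst (0 : R).
have p0 : prim (cst 0 : E) = cst 0.
  apply/funext => x; change (dotI (below x) (0 : E) = 0).
  by rewrite -(scale0r (0 : E)) (bilinZr L2I_subspace dotI_sym_bilin 0 (L2I_below x) L0) mul0r.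
have [] := @H20_intro R (cst 0) (cst 0) L0 L0; rewrite ?p0//.
exact: ae_eqI_refl.
Qed.

Lemma H20_subspace : @lin_subspace R E H20.
Proof. by split=> [|c u v Hu Hv]; [exact: H20_zero|case: (H20_lin c Hu Hv)]. Qed.

Lemma H20_L2 : (H20 : set E) `<=` L2I.
Proof. by move=> u /H20_repr[[]]. Qed.

Section Weighted.
Variables (a : R -> R) (M : R).
Hypothesis ma : measurable_fun I a.
Hypothesis aM : forall x, I x -> `|a x| <= M.

Lemma wdot_sym_bilin : @sym_bilin R E L2I (fun u v => dotI (a \* u) v).
Proof.
split=> [u v _ _|c u v w Lu Lv Lw].
  by apply: eq_Rintegral => x _ /=; rewrite mulrAC.
have Lau := L2I_mulb ma aM Lu; have Lav := L2I_mulb ma aM Lv.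
rewrite -dotI_sym_bilin.2//; congr dotI; apply/funext => x.
change (a x * (c * u x + v x) = c * (a x * u x) + a x * v x); ring.
Qed.

Lemma wdot_ae u u' v v' : L2I u -> L2I u' -> L2I v -> L2I v' ->
  ae_eqI u u' -> ae_eqI v v' -> dotI (a \* u) v = dotI (a \* u') v'.
Proof.
move=> Lu Lu' Lv Lv' uu' vv'.
have Lau := L2I_mulb ma aM Lu; have Lau' := L2I_mulb ma aM Lu'.
rewrite (dotI_aer Lau Lv Lv' vv'); apply: dotI_ael => //.
by apply: ae_filterS uu' => x h Ix /=; rewrite h.
Qed.

Lemma wdot_ge (k : R) u : (forall x, I x -> k <= a x) -> L2I u ->
  k * dotI u u <= dotI (a \* u) u.
Proof.
move=> ka Lu; have Lau := L2I_mulb ma aM Lu.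
rewrite -(bilinZ L2I_subspace dotI_sym_bilin)//.
have Lku : L2I (k *: (u : E)) := subspaceZ L2I_subspace k Lu.
apply: le_Rintegral.
- exact: measurable_I01.
- exact: L2I_mul_int.
- exact: L2I_mul_int.
- move=> x Ix; change (k * u x * u x <= a x * u x * u x).
  by rewrite -!mulrA ler_wpM2r ?ka// -expr2 sqr_ge0.
Qed.

Lemma wdot_le u : L2I u -> dotI (a \* u) u <= M * dotI u u.
Proof.
move=> Lu; have Lau := L2I_mulb ma aM Lu.
rewrite -(bilinZ L2I_subspace dotI_sym_bilin)//.
have Lku : L2I (M *: (u : E)) := subspaceZ L2I_subspace M Lu.
apply: le_Rintegral.
- exact: measurable_I01.
- exact: L2I_mul_int.
- exact: L2I_mul_int.
- move=> x Ix; change (a x * u x * u x <= M * u x * u x).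
  rewrite -!mulrA ler_wpM2r// -?expr2 ?sqr_ge0//.
  exact: le_trans (ler_norm _) (aM Ix).
Qed.

End Weighted.

Variables (eps : R) (a b : R -> R) (a0 M : R).
Hypothesis eps0 : 0 < eps.
Hypothesis ma : measurable_fun I a.
Hypothesis mb : measurable_fun I b.
Hypothesis aM : forall x, I x -> `|a x| <= M.
Hypothesis bM : forall x, I x -> `|b x| <= M.
Hypothesis a0_gt0 : 0 < a0.
Hypothesis aa0 : forall x, I x -> a0 <= a x.
Hypothesis b0 : forall x, I x -> 0 <= b x.

Let B := Bform eps a b.

Let en u u1 u2 v v1 v2 : R :=
  eps ^+ 2 * dotI u2 v2 + dotI (a \* u1) v1 + dotI (b \* u) v.

Let en_sym u u1 u2 v v1 v2 : L2I u -> L2I u1 -> L2I u2 -> L2I v -> L2I v1 -> L2I v2 ->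
  en u u1 u2 v v1 v2 = en v v1 v2 u u1 u2.
Proof.
move=> Lu Lu1 Lu2 Lv Lv1 Lv2; rewrite /en (dotI_sym_bilin.1 u2)//.
by rewrite ((wdot_sym_bilin ma aM).1 u1)// ((wdot_sym_bilin mb bM).1 u).
Qed.

Let en_lin (c : R) u u1 u2 v v1 v2 w w1 w2 z1 z2 :
  L2I u -> L2I u1 -> L2I u2 -> L2I v -> L2I v1 -> L2I v2 ->
  L2I w -> L2I w1 -> L2I w2 -> L2I z1 -> L2I z2 ->
  ae_eqI z1 (c *: (u1 : E) + v1) -> ae_eqI z2 (c *: (u2 : E) + v2) ->
  en (c *: (u : E) + v) z1 z2 w w1 w2 = c * en u u1 u2 w w1 w2 + en v v1 v2 w w1 w2.
Proof.
move=> Lu Lu1 Lu2 Lv Lv1 Lv2 Lw Lw1 Lw2 Lz1 Lz2 e1 e2.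
have LL1 := L2I_subspace.2 c _ _ Lu1 Lv1; have LL2 := L2I_subspace.2 c _ _ Lu2 Lv2.
rewrite /en (dotI_ael Lz2 LL2 Lw2 e2) (dotI_sym_bilin.2 _ _ _ _ Lu2 Lv2 Lw2).
rewrite (wdot_ae ma aM Lz1 LL1 Lw1 Lw1 e1 (ae_eqI_refl _)).
rewrite ((wdot_sym_bilin ma aM).2 _ _ _ _ Lu1 Lv1 Lw1).
rewrite ((wdot_sym_bilin mb bM).2 _ _ _ _ Lu Lv Lw); ring.
Qed.

Let en_ge u u1 u2 : L2I u -> L2I u1 -> L2I u2 ->
  eps ^+ 2 * dotI u2 u2 + a0 * dotI u1 u1 <= en u u1 u2 u u1 u2.
Proof.
move=> Lu Lu1 Lu2.
have h1 := wdot_ge ma aM aa0 Lu1; have := wdot_ge mb bM b0 Lu.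
rewrite mul0r /en => h2; lra.
Qed.

Let en_le (K : R) u u1 u2 : L2I u -> L2I u1 -> L2I u2 ->
  eps <= 1 -> dotI u u <= K -> dotI u1 u1 <= K -> dotI u2 u2 <= K ->
  en u u1 u2 u u1 u2 <= (1 + M + M) * K.
Proof.
move=> Lu Lu1 Lu2 eps1 h0 h1 h2.
have M0 := bound_ge0 aM.
have k1 := wdot_le ma aM Lu1; have k2 := wdot_le mb bM Lu.
have e2 : eps ^+ 2 <= 1 by rewrite expr_le1// ltW.
have k3 := ler_wpM2l M0 h1; have k4 := ler_wpM2l M0 h0.
have k5 := ler_wpM2r (dotI_psd Lu2) e2.
rewrite /en; rewrite mul1r in k5; lra.
Qed.

Lemma Bform_sym_bilin : @sym_bilin R E H20 B.
Proof.
split=> [u v Hu Hv|c u v w Hu Hv Hw].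
  have [[Lu Lu1 Lu2 _ _] _] := H20_repr Hu; have [[Lv Lv1 Lv2 _ _] _] := H20_repr Hv.
  exact: (en_sym Lu Lu1 Lu2 Lv Lv1 Lv2).
have [Huv e1 e2] := H20_lin c Hu Hv.
have [[Lu Lu1 Lu2 _ _] _] := H20_repr Hu; have [[Lv Lv1 Lv2 _ _] _] := H20_repr Hv.
have [[Lw Lw1 Lw2 _ _] _] := H20_repr Hw; have [[Luv Luv1 Luv2 _ _] _] := H20_repr Huv.
exact: (en_lin Lu Lu1 Lu2 Lv Lv1 Lv2 Lw Lw1 Lw2 Luv1 Luv2 e1 e2).
Qed.

Lemma Bform_coercive u : H20 u ->
  eps ^+ 2 * dotI (wderiv2 u) (wderiv2 u) + a0 * dotI (wderiv u) (wderiv u) <= B u u.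
Proof.
move=> Hu; have [[Lu Lu1 Lu2 _ _] _] := H20_repr Hu.
exact: (en_ge Lu Lu1 Lu2).
Qed.

Lemma dotI_ae2 u v : L2I u -> L2I v -> ae_eqI u v -> dotI u u = dotI v v.
Proof.
by move=> Lu Lv uv; rewrite (dotI_ael Lu Lv Lu uv) (dotI_aer Lv Lu Lv uv).
Qed.

Lemma ae_prim_le u g : L2I u -> L2I g -> ae_eqI u (prim g) -> dotI u u <= dotI g g.
Proof.
move=> Lu Lg ug; have Lp := L2I_prim Lg.
by rewrite (dotI_ae2 Lu Lp ug); exact: dotI_prim_le.
Qed.

Lemma H20_poincare u : H20 u -> dotI u u <= dotI (wderiv u) (wderiv u).
Proof. by move=> /H20_repr[[Lu Lu1 Lu2 _ e0] _]; exact: (ae_prim_le Lu Lu1 e0). Qed.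

Lemma Bform_ge_dotI u : H20 u -> a0 * dotI u u <= B u u.
Proof.
move=> Hu; apply: le_trans (Bform_coercive Hu).
have [[Lu Lu1 Lu2 _ _] _] := H20_repr Hu.
have h := ler_wpM2l (ltW a0_gt0) (H20_poincare Hu).
apply: (le_trans h); rewrite lerDr.
exact: (mulr_ge0 (sqr_ge0 eps) (dotI_psd Lu2)).
Qed.

Lemma Bform_psd : @psd R E H20 B.
Proof.
move=> u Hu; apply: le_trans (Bform_ge_dotI Hu).
apply: mulr_ge0; [exact: ltW|exact: dotI_psd (H20_L2 Hu)].
Qed.

Lemma dotI_sym_bilin_H20 : @sym_bilin R E H20 dotI.
Proof. exact: (sub_sym_bilin H20_L2 dotI_sym_bilin). Qed.

Lemma dotI_psd_H20 : @psd R E H20 dotI.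
Proof. exact: (sub_psd H20_L2 dotI_psd). Qed.

(** By Poincare's inequality the second derivative controls the energy, uniformly
    in [eps <= 1]. *)
Lemma Bform_le u (K : R) : H20 u -> eps <= 1 ->
  dotI (wderiv2 u) (wderiv2 u) <= K -> B u u <= (1 + M + M) * K.
Proof.
move=> Hu eps1 uK; have [[Lu Lu1 Lu2 e1 e0] _] := H20_repr Hu.
have h1 := le_trans (ae_prim_le Lu1 Lu2 e1) uK.
exact: (en_le Lu Lu1 Lu2 eps1 (le_trans (H20_poincare Hu) h1) h1 uK).
Qed.

End EnergyForm.

(** * Completeness of L^2 *)

Section Completeness.
Context {R : realType}.
Implicit Types (u v w g : R -> R).
Local Notation mu := (@lebesgue_measure R).
Local Notation I := (@I01 R).
Local Notation E := (R -> R).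

Lemma dotI_cst1 : dotI (cst 1 : E) (cst 1) = 1.
Proof.
rewrite /dotI; transitivity (\int[mu]_(x in I) (1 : R)).
  by apply: eq_Rintegral => x _ /=; rewrite mulr1.
exact: Rintegral_I01_cst.
Qed.

Lemma integral_norm_le u (e : R) : L2I u -> 0 <= e -> dotI u u <= e ^+ 2 ->
  (\int[mu]_(x in I) `|u x|%:E <= e%:E)%E.
Proof.
move=> Lu e0 ue; have [mu_ iu] := Lu.
have Lnu : L2I (fun x => `|u x|).
  split; first exact: measurableT_comp.
  by under eq_fun do rewrite real_normK ?num_real//.
have inu := L2I_int Lnu.
have -> : (\int[mu]_(x in I) `|u x|%:E = (\int[mu]_(x in I) `|u x|)%:E)%E.
  rewrite /Rintegral fineK//; apply: integrable_fin_num => //.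
  exact: measurable_I01.
rewrite lee_fin -(@ler_pXn2r _ 2) ?nnegrE//; last by apply: Rintegral_ge0.
apply: le_trans ue.
have := psd_CS L2I_subspace dotI_sym_bilin dotI_psd Lnu (L2I_cst 1).
rewrite dotI_cst1 mulr1.
have -> : dotI (fun x => `|u x|) (cst 1) = \int[mu]_(x in I) `|u x|.
  by apply: eq_Rintegral => x _ /=; rewrite mulr1.
move=> /le_trans; apply; rewrite le_eqVlt; apply/orP; left; apply/eqP.
by apply: eq_Rintegral => x _; rewrite -expr2 real_normK ?num_real// expr2.
Qed.

(** A sequence whose increments decay geometrically in L^2 converges almost
    everywhere, because the sum of the increments is integrable. *)
Lemma fast_cauchy_ae_cvg (f : nat -> E) : (forall n, L2I (f n)) ->
  (forall n, dotI ((f n.+1 : E) - f n) ((f n.+1 : E) - f n) <= (1 / (2 ^ (n + 1))%:R) ^+ 2) ->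
  {ae mu, forall x, I x -> cvgn (fun n => f n x)}.
Proof.
move=> Lf hf.
pose D n : E := (f n.+1 : E) - f n.
have LD n : L2I (D n) := subspaceB L2I_subspace (Lf n.+1) (Lf n).
have mD n : measurable_fun I (D n) by case: (LD n).
have mnD n : measurable_fun I (fun x => `|D n x|%:E).
  by apply/measurable_EFinP; exact: measurableT_comp.
pose S x := (\sum_(0 <= n <oo) `|D n x|%:E)%E.
have iS : mu.-integrable I S.
  apply/integrableP; split.
    apply: ge0_emeasurable_sum => [n x Ix _|n _]; first by rewrite lee_fin.
    exact: mnD.
  rewrite (_ : (\int[mu]_(x in I) _)%E = (\int[mu]_(x in I) S x)%E); last first.
    apply: eq_integral => x _; rewrite gee0_abs//.
    by apply: nneseries_ge0 => n _ _; rewrite lee_fin.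
  rewrite /S integral_nneseries//; last first.
    exact: measurable_I01.
  apply: (@le_lt_trans _ _ (\sum_(0 <= n <oo) (1 / (2 ^ (n + 1))%:R)%:E)%E).
    apply: lee_nneseries => [n _ _|n _]; first by apply: integral_ge0 => x _; rewrite lee_fin.
    by apply: (integral_norm_le (LD n) _ (hf n)); rewrite divr_ge0.
  have /cvg_lim -> // := @cvg_geometric_eseries_half R 1 0.
  by rewrite ltry.
have Sae : {ae mu, forall x, I x -> S x \is a fin_num}.
  by apply: (integrable_ae _ iS); exact: measurable_I01.
apply: ae_filterS Sae => x + Ix => /(_ Ix) Sx.
have -> : (fun n => f n x) = (fun n => f 0%N x + series (fun n => D n x) n).
  apply/funext => n; rewrite (eq_sum_telescope (fun n => f n x)); congr (_ + _).
apply: is_cvgD; first exact: is_cvg_cst.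
apply: normed_cvg; apply: nondecreasing_is_cvgn.
  by apply/nondecreasing_seqP => n; rewrite /= !seriesEnat/= big_nat_recr//= lerDl.
exists (fine (S x)) => _ [n _ <-]; rewrite -lee_fin fineK//.
rewrite [X in X%:E](_ : _ = \sum_(0 <= k < n) `|D k x|)// -sumEFin; apply: nneseries_lim_ge => k _ _.
by rewrite lee_fin.
Qed.

Lemma measurable_fun_limn_einf (h : nat -> R -> \bar R) :
  (forall n, measurable_fun I (h n)) ->
  measurable_fun I (fun x => limn_einf (fun n => h n x)).
Proof.
move=> mh; rewrite /limn_einf.
apply: measurableT_comp => //.
apply: (measurable_fun_limn_esup (f := fun n x => (- h n x)%E)) => n.
exact: measurableT_comp.
Qed.

Lemma limn_einf_le (u : nat -> \bar R) (c : \bar R) N :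
  (forall n, (N <= n)%N -> (u n <= c)%E) -> (limn_einf u <= c)%E.
Proof.
move=> uc; rewrite limn_einf_lim; apply: lime_le; first exact: is_cvg_einfs.
apply: nearW => n; apply: ereal_inf_le; exists (u (maxn n N)).
  by exists (maxn n N) => //=; rewrite leq_maxl.
by apply: uc; rewrite leq_maxr.
Qed.

(** The limit is also an L^2 limit, by Fatou's lemma. *)
Lemma fast_cauchy_limit (f : nat -> E) (c : nat -> R) : (forall n, L2I (f n)) ->
  (forall n, dotI ((f n.+1 : E) - f n) ((f n.+1 : E) - f n) <= (1 / (2 ^ (n + 1))%:R) ^+ 2) ->
  (forall i j, (i <= j)%N -> dotI ((f i : E) - f j) ((f i : E) - f j) <= c i) ->
  exists2 g : E, L2I g & forall i, dotI (f i - g) (f i - g) <= c i.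
Proof.
move=> Lf hf hc; have cae := fast_cauchy_ae_cvg Lf hf.
pose g x : R := fine (limn_esup (fun n => (f n x)%:E)).
have mf n : measurable_fun I (f n) by case: (Lf n).
have mg : measurable_fun I g.
  apply: (measurableT_comp (fine_measurable _)) => //.
  apply: (measurable_fun_limn_esup (f := fun n x => (f n x)%:E)) => n.
  exact/measurable_EFinP.
have glim x : cvgn (fun n => f n x) -> (fun n => f n x) @ \oo --> g x.
  move=> cfx; have cE : (fun n => (f n x)%:E) @ \oo --> (limn (fun n => f n x))%:E.
    by apply: cvg_EFin => //; exact: nearW.
  by rewrite /g (cvg_limn_einf_sup cE).2.
have mfg i : measurable_fun I (fun x => (f i x - g x) ^+ 2).
  by apply: measurable_funX; exact: measurable_funB.
have key i : (\int[mu]_(x in I) ((f i x - g x) ^+ 2)%:E <= (c i)%:E)%E.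
  pose h j x := ((f i x - f j x) ^+ 2)%:E.
  have mh j : measurable_fun I (h j).
    by apply/measurable_EFinP; apply: measurable_funX; exact: measurable_funB.
  have h0 j x : I x -> (0 <= h j x)%E by move=> _; rewrite lee_fin sqr_ge0.
  have hl x : cvgn (fun n => f n x) -> limn_einf (fun j => h j x) = ((f i x - g x) ^+ 2)%:E.
    move=> /glim cg; apply: (cvg_limn_einf_sup _).1.
    apply: cvg_EFin; first exact: nearW.
    have cs : (fun j => f i x - f j x) @ \oo --> f i x - g x.
      by apply: cvgB => //; exact: cvg_cst.
    rewrite (_ : fine \o _ = fun j => (f i x - f j x) * (f i x - f j x)).
      by rewrite expr2; exact: cvgM.
    by apply/funext => j /=; rewrite expr2.
  have -> : (\int[mu]_(x in I) ((f i x - g x) ^+ 2)%:E =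
      \int[mu]_(x in I) limn_einf (fun j => h j x))%E.
    apply: ae_eq_integral.
    - exact: measurable_I01.
    - by apply/measurable_EFinP; exact: mfg.
    - exact: measurable_fun_limn_einf.
    - by apply: ae_filterS cae => x + Ix => /(_ Ix) /hl ->.
  apply: (le_trans (fatou mu _ mh h0)); first exact: measurable_I01.
  apply: (@limn_einf_le _ _ i) => j ij.
  have LB := subspaceB L2I_subspace (Lf i) (Lf j).
  have := hc i j ij; rewrite -lee_fin; apply: le_trans.
  rewrite /dotI /Rintegral fineK; last first.
    apply: integrable_fin_num; [exact: measurable_I01|exact: L2I_mul_int].
  rewrite le_eqVlt; apply/orP; left; apply/eqP; apply: eq_integral => x _.
  by rewrite /h expr2.
have Lfg i : L2I (f i - g).
  split; first exact: measurable_funB.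
  apply/integrableP; split; first by apply/measurable_EFinP; exact: mfg.
  apply: le_lt_trans (ltry (c i)); apply: le_trans (key i).
  rewrite le_eqVlt; apply/orP; left; apply/eqP; apply: eq_integral => x _.
  by rewrite gee0_abs// lee_fin sqr_ge0.
exists g.
  have -> : g = f 0%N - (f 0%N - g) by rewrite opprB addrC subrK.
  exact: (subspaceB L2I_subspace (Lf 0%N) (Lfg 0%N)).
move=> i; rewrite -lee_fin; apply: le_trans (key i).
rewrite /dotI /Rintegral fineK; last first.
  apply: integrable_fin_num; [exact: measurable_I01|exact: L2I_mul_int].
rewrite le_eqVlt; apply/orP; left; apply/eqP; apply: eq_integral => x _.
by rewrite -expr2.
Qed.

Lemma L2_complete (f : nat -> E) : (forall n, L2I (f n)) ->
  (forall e : R, 0 < e -> exists N, forall n m, (N <= n)%N -> (N <= m)%N ->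
    dotI ((f n : E) - f m) ((f n : E) - f m) <= e) ->
  exists2 g : E, L2I g & forall e : R, 0 < e -> exists N, forall n, (N <= n)%N ->
    dotI (f n - g) (f n - g) <= e.
Proof.
move=> Lf hC.
pose q n : R := (1 / (2 ^ (n + 1))%:R) ^+ 2.
have q0 n : 0 < q n by rewrite /q exprn_gt0// divr_gt0// ltr0n expn_gt0.
(* f \o k is a subsequence whose increments are at most 2 ^ - (n + 1) *)
have /choice[N hN] : forall n, exists N, forall i j, (N <= i)%N -> (N <= j)%N ->
    dotI ((f i : E) - f j) ((f i : E) - f j) <= q n by move=> n; exact: hC.
pose k n := (\max_(i < n.+1) N i + n)%N.
have kle n m : (n <= m)%N -> (N n <= k m)%N.
  move=> nm; have nm' : (n < m.+1)%N by [].
  apply: leq_trans (leq_addr _ _).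
  exact: (@leq_bigmax _ (fun i : 'I_m.+1 => N i) (Ordinal nm')).
have kN n : (N n <= k n)%N by exact: kle.
have [|i|i j ij|g Lg hg] := @fast_cauchy_limit (fun n => f (k n)) q.
- by move=> n; exact: Lf.
- by apply: hN; [exact: kle|exact: kN].
- by apply: hN; [exact: kN|exact: kle].
exists g => // e e0.
have [M hM] := hC (e / 4) ltac:(lra).
have [n [nM qn]] : exists n, (M <= k n)%N /\ q n <= e / 4.
  exists (maxn M (Num.trunc (e / 4)^-1)).
  set n := maxn _ _; split; first by apply: leq_trans (leq_maxl M _) (leq_addl _ _).
  have p1 : 1 <= (2 ^ (n + 1))%:R :> R by rewrite ler1n expn_gt0.
  have pp := lt_le_trans ltr01 p1; have e4 : 0 < e / 4 by lra.
  have h : 1 / (2 ^ (n + 1))%:R <= e / 4.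
    rewrite div1r invf_ple ?posrE//.
    apply: (le_trans (ltW (truncnS_gt _))); rewrite ler_nat.
    apply: leq_trans (ltnW (ltn_expl (n + 1) (ltnSn 1))).
    by rewrite addn1 ltnS leq_maxr.
  apply: le_trans h; rewrite /q expr2 ler_piMl//.
  by rewrite div1r invf_le1// (lt_le_trans ltr01 p1).
exists M => m Mm.
have -> : f m - g = (f m - f (k n)) + (f (k n) - g) by rewrite addrA subrK.
have L1 := subspaceB L2I_subspace (Lf m) (Lf (k n)).
have L2 := subspaceB L2I_subspace (Lf (k n)) Lg.
apply: (le_trans (psd_leD L2I_subspace dotI_sym_bilin dotI_psd L1 L2)).
have := hM _ _ Mm nM; have := hg n; lra.
Qed.

End Completeness.

(** * Compactness of primitives *)

Section TotalBoundedness.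
Context {R : realType}.

(** Total boundedness yields Cauchy subsequences: when for every [e] the indices
    can be painted with finitely many colours [b] such that [d <= e] within each
    colour, a nonprincipal ultrafilter selects one colour for every [e]. *)
Lemma cauchy_subsequence (d : nat -> nat -> R) :
  (forall e : R, 0 < e -> exists (T : finType) (b : nat -> T),
     forall n m, b n = b m -> d n m <= e) ->
  exists f : nat -> nat, (forall n, (n <= f n)%N) /\
    forall e : R, 0 < e -> exists N, forall n m, (N <= n)%N -> (N <= m)%N ->
      d (f n) (f m) <= e.
Proof.
move=> hd.
have [U [UU sU]] := ultraFilterLemma eventually_filter.
have FU : Filter U by apply: filter_filter.
have [A hA] : exists A : nat -> set nat, forall i, U (A i) /\
    forall n m, A i n -> A i m -> d n m <= i.+1%:R^-1.
  suff /choice[A hA] : forall i : nat, exists A : set nat, U A /\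
    forall n m, A n -> A m -> d n m <= i.+1%:R^-1 by exists A.
  move=> i; have e0 : 0 < i.+1%:R^-1 :> R by rewrite invr_gt0.
  have [T [b hb]] := hd _ e0.
  have [c Uc] : exists c, U [set n | b n = c].
    apply: contrapT => /forallNP nc.
    have : U [set n | forall c, b n <> c].
      apply: filter_forall => c.
      by case: (in_ultra_setVsetC [set n | b n = c] UU) => // /nc.
    by move=> /filter_ex[n /(_ (b n))].
  exists [set n | b n = c]; split => // n m /= bn bm; apply: hb.
  by rewrite bn bm.
have [f hf] : exists f : nat -> nat, forall n, (n <= f n)%N /\
    forall i, (i <= n)%N -> A i (f n).
  suff /choice[f hf] : forall n : nat, exists m, (n <= m)%N /\
    forall i, (i <= n)%N -> A i m by exists f.
  move=> n.
  have U1 : U [set m | forall i : 'I_n.+1, A i m].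
    by apply: filter_forall => i; have [] := hA i.
  have U2 : U [set m | (n <= m)%N] by apply: sU; exists n.
  have [m [m1 m2]] := filter_ex (filterI U1 U2).
  exists m; split => // i ilen; exact: (m1 (Ordinal (ilen : (i < n.+1)%N))).
exists f; split => [n|e e0]; first by have [] := hf n.
exists (Num.trunc e^-1) => n m Nn Nm.
apply: (@le_trans _ _ (Num.trunc e^-1).+1%:R^-1).
  by have [_] := hA (Num.trunc e^-1); apply; [have [_] := hf n|have [_] := hf m]; apply.
by rewrite invf_ple ?posrE// ltW// truncnS_gt.
Qed.

End TotalBoundedness.

Section Rellich.
Context {R : realType}.
Implicit Types (u v w g : R -> R).
Local Notation mu := (@lebesgue_measure R).
Local Notation I := (@I01 R).
Local Notation E := (R -> R).

Lemma dotI_sup_le u (M : R) : L2I u -> (forall x, I x -> `|u x| <= M) ->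
  dotI u u <= M ^+ 2.
Proof.
move=> Lu uM.
have -> : M ^+ 2 = \int[mu]_(x in I) (M ^+ 2 : R).
  by rewrite Rintegral_I01_cst.
apply: le_Rintegral.
- exact: measurable_I01.
- exact: L2I_mul_int.
- exact: intI_cst.
- move=> x Ix; rewrite -expr2 -(real_normK (num_real (u x))).
  by rewrite lerXn2r ?nnegrE ?uM//; exact: le_trans (uM _ Ix).
Qed.

(** Primitives of a bounded sequence of L^2 have a Cauchy subsequence: up to [e],
    by Hoelder continuity, they are determined by their rounded values on a
    finite grid. *)
Lemma prim_precompact (g : nat -> E) (K : R) : 0 < K -> (forall n, L2I (g n)) ->
  (forall n, dotI (g n) (g n) <= K ^+ 2) ->
  exists f : nat -> nat, (forall n, (n <= f n)%N) /\
    forall e : R, 0 < e -> exists N, forall n m, (N <= n)%N -> (N <= m)%N ->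
      dotI ((prim (g (f n)) : E) - prim (g (f m))) ((prim (g (f n)) : E) - prim (g (f m))) <= e.
Proof.
move=> K0 Lg gK.
have bnd n x : `|prim (g n) x| <= K.
  rewrite -(@ler_pXn2r _ 2) ?nnegrE//; last exact: ltW.
  by rewrite real_normK ?num_real//; exact: le_trans (prim_sq_le _ (Lg n)) (gK n).
apply: (cauchy_subsequence (d := fun n m => dotI ((prim (g n) : E) - prim (g m))
  ((prim (g n) : E) - prim (g m)))) => e0 e00.
(* values rounded to multiples of e, on a grid of step 1 / (m + 1) such that
   K ^ 2 / (m + 1) <= e ^ 2; three errors of size e make (3 e) ^ 2 <= e0 *)
pose e := Num.min 1 (e0 / 9).
have ep : 0 < e by rewrite lt_min ltr01 divr_gt0.
have ee : 9 * e ^+ 2 <= e0.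
  have e1 : e <= 1 by rewrite ge_min lexx.
  have e2 : e <= e0 / 9 by rewrite ge_min lexx orbT.
  have : e ^+ 2 <= e by rewrite expr2 ler_piMl// ltW.
  lra.
pose m := Num.trunc (K ^+ 2 / e ^+ 2).
pose k := Num.trunc (2 * K / e).
pose code n : {ffun 'I_m.+2 -> 'I_k.+1} :=
  [ffun j : 'I_m.+2 => inord (Num.trunc ((prim (g n) (j%:R / m.+1%:R) + K) / e))].
exists {ffun 'I_m.+2 -> 'I_k.+1}, code => n n' cE.
have grid (j : 'I_m.+2) :
    `|prim (g n) (j%:R / m.+1%:R) - prim (g n') (j%:R / m.+1%:R)| <= e.
  have := congr1 (fun c : {ffun 'I_m.+2 -> 'I_k.+1} => nat_of_ord (c j)) cE.
  rewrite /code !ffunE.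
  have aux q : let t := (prim (g q) (j%:R / m.+1%:R) + K) / e in
      0 <= t /\ (Num.trunc t < k.+1)%N.
    have := bnd q (j%:R / m.+1%:R); rewrite ler_norml => /andP[b1 b2].
    move=> t; split; first by rewrite divr_ge0 ?(ltW ep)//; lra.
    rewrite ltnS; apply: le_truncn; rewrite ler_pM2r ?invr_gt0//; lra.
  have [t0 tk] := aux n; have [t0' tk'] := aux n'.
  rewrite !inordK// => tt.
  have := truncn_itv t0; have := truncn_itv t0'; rewrite -tt.
  move: t0 t0' tk tk' tt; set p := prim _ _; set p' := prim _ _ => _ _ _ _ _.
  set z := Num.trunc _; rewrite -natr1.
  rewrite !ler_pdivlMr// !ltr_pdivrMr// => /andP[h1 h2] /andP[h3 h4].
  by rewrite ler_norml; apply/andP; split; lra.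
have LB := subspaceB L2I_subspace (L2I_prim (Lg n)) (L2I_prim (Lg n')).
apply: le_trans ee; rewrite (_ : 9 * e ^+ 2 = (3 * e) ^+ 2); last by ring.
apply: dotI_sup_le => // x /I01P/andP[x0 x1].
have xm0 : 0 <= x * m.+1%:R by rewrite mulr_ge0// ltW.
have jlt : (Num.trunc (x * m.+1%:R) < m.+2)%N.
  rewrite ltnS -[X in (_ <= X)%N](@natrK R); apply: le_truncn.
  by rewrite ler_piMl// ltW.
pose j := Ordinal jlt; pose y : R := j%:R / m.+1%:R.
have hy q : `|prim (g q) x - prim (g q) y| <= e.
  have xy : `|x - y| <= m.+1%:R^-1.
    have /andP[h1 h2] := truncn_itv xm0.
    have y1 : y <= x by rewrite /y ler_pdivrMr.
    rewrite ger0_norm ?subr_ge0//.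
    rewrite -(@ler_pM2r _ m.+1%:R)// mulVf// mulrBl /y divfK//.
    by rewrite lerBlDl natr1; exact: ltW.
  rewrite -(@ler_pXn2r _ 2) ?nnegrE ?(ltW ep)// real_normK ?num_real//.
  apply: (le_trans (prim_holder _ _ (Lg q))).
  apply: (@le_trans _ _ (m.+1%:R^-1 * K ^+ 2)).
    by apply: ler_pM => //; exact: dotI_psd.
  rewrite mulrC ler_pdivrMr// mulrC -ler_pdivrMr ?exprn_gt0//.
  by rewrite ltW// truncnS_gt.
have h1 := hy n; have h2 := hy n'; have h3 := grid j.
change (`|prim (g n) x - prim (g n') x| <= 3 * e).
move: h1 h2 h3; rewrite -/y !ler_norml => /andP[? ?] /andP[? ?] /andP[? ?].
by apply/andP; split; lra.
Qed.

End Rellich.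

(** * Compactness and completeness of the energy space *)

Section EnergySpace.
Context {R : realType}.
Implicit Types (u v w g : R -> R).
Local Notation mu := (@lebesgue_measure R).
Local Notation I := (@I01 R).
Local Notation E := (R -> R).

Lemma ae_eqI_B u u' v v' : ae_eqI u u' -> ae_eqI v v' ->
  ae_eqI ((u : E) - v) ((u' : E) - v').
Proof.
by apply: ae_filterS2 => x h1 h2 Ix; change (u x - v x = u' x - v' x); rewrite h1// h2.
Qed.

Lemma H20_sub u v : H20 u -> H20 v ->
  [/\ H20 ((u : E) - v), ae_eqI (wderiv ((u : E) - v)) ((wderiv u : E) - wderiv v) &
   ae_eqI (wderiv2 ((u : E) - v)) ((wderiv2 u : E) - wderiv2 v)].
Proof.
move=> Hu Hv; have := H20_lin (-1) Hv Hu.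
by rewrite !scaleN1r ![- _ + _]addrC.
Qed.

Lemma dotI_sub_ae u u' v v' : L2I u -> L2I u' -> L2I v -> L2I v' ->
  ae_eqI u u' -> ae_eqI v v' ->
  dotI ((u : E) - v) ((u : E) - v) = dotI ((u' : E) - v') ((u' : E) - v').
Proof.
move=> Lu Lu' Lv Lv' uu' vv'; apply: dotI_ae2; last exact: ae_eqI_B.
  exact: (subspaceB L2I_subspace).
exact: (subspaceB L2I_subspace).
Qed.

(** Rellich's theorem for functions vanishing at 0. *)
Lemma rellich (w g : nat -> E) (K : R) : 0 < K ->
  (forall n, L2I (w n)) -> (forall n, L2I (g n)) ->
  (forall n, ae_eqI (w n) (prim (g n))) -> (forall n, dotI (g n) (g n) <= K ^+ 2) ->
  exists f : nat -> nat, (forall n, (n <= f n)%N) /\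
    forall e : R, 0 < e -> exists N, forall n m, (N <= n)%N -> (N <= m)%N ->
      dotI (w (f n) - w (f m)) (w (f n) - w (f m)) <= e.
Proof.
move=> K0 Lw Lg wg gK; have [f [fn fC]] := prim_precompact K0 Lg gK.
exists f; split => // e e0; have [N hN] := fC e e0; exists N => n m Nn Nm.
have Lp i := L2I_prim (Lg i).
by rewrite (dotI_sub_ae (Lw _) (Lp _) (Lw _) (Lp _) (wg _) (wg _)); exact: hN.
Qed.

(** The conditions at 1 pass to the L^2 limit [g0] of second derivatives, so that
    [g0] is the second derivative of [prim (prim g0)], which lies in [H20]. *)
Lemma H20_limit (g : nat -> E) : (forall n, L2I (g n)) ->
  (forall n, prim (g n) 1 = 0) -> (forall n, prim (prim (g n)) 1 = 0) ->
  (forall e : R, 0 < e -> exists N, forall n m, (N <= n)%N -> (N <= m)%N ->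
     dotI (g n - g m) (g n - g m) <= e) ->
  exists v g0 : E, [/\ H20 v, L2I g0, ae_eqI (wderiv2 v) g0 &
    forall e : R, 0 < e -> exists N, forall n, (N <= n)%N ->
     dotI (g n - g0) (g n - g0) <= e].
Proof.
move=> Lg p1 pp1 gC; have [g0 Lg0 glim] := L2_complete Lg gC.
have LB n := subspaceB L2I_subspace (Lg n) Lg0.
have z1 : prim g0 1 = 0.
  apply/eqP; rewrite -sqrf_eq0 eq_le sqr_ge0 andbT.
  apply/ler_addgt0Pl => e e0; rewrite addr0.
  have [n /(_ n (leqnn n)) hn] := glim _ e0.
  have := prim_sq_le 1 (LB n); rewrite primB// p1 sub0r sqrrN => /le_trans; exact.
have z2 : prim (prim g0) 1 = 0.
  apply/eqP; rewrite -sqrf_eq0 eq_le sqr_ge0 andbT.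
  apply/ler_addgt0Pl => e e0; rewrite addr0.
  have [n /(_ n (leqnn n)) hn] := glim _ e0.
  have Lpg := L2I_prim (Lg n); have Lp0 := L2I_prim Lg0.
  have E0 : prim (g n - g0) = (prim (g n) : E) - prim g0.
    by apply/funext => x; exact: primB.
  have := prim_sq_le 1 (L2I_prim (LB n)); rewrite {1}E0 primB// pp1 sub0r sqrrN.
  by move=> /le_trans; apply; apply: le_trans (dotI_prim_le (LB n)) hn.
have Lv := L2I_prim (L2I_prim Lg0).
have [Hv _ e2] := H20_intro Lv Lg0 z1 z2 (ae_eqI_refl _).
by exists (prim (prim g0)), g0.
Qed.

Variables (eps : R) (a b : R -> R) (a0 M : R).
Hypothesis eps0 : 0 < eps.
Hypothesis eps1 : eps <= 1.
Hypothesis ma : measurable_fun I a.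
Hypothesis mb : measurable_fun I b.
Hypothesis aM : forall x, I x -> `|a x| <= M.
Hypothesis bM : forall x, I x -> `|b x| <= M.
Hypothesis a0_gt0 : 0 < a0.
Hypothesis aa0 : forall x, I x -> a0 <= a x.
Hypothesis b0 : forall x, I x -> 0 <= b x.

Let B := Bform eps a b.

Lemma precompact_H20 : precompact_form H20 B dotI.
Proof.
move=> C w Hw Bw.
pose K := `|C| / a0 + 1.
have K1 : 1 <= K by rewrite /K lerDr divr_ge0// ltW.
have K0 : 0 < K by exact: lt_le_trans K1.
have bnd n : dotI (wderiv (w n)) (wderiv (w n)) <= K ^+ 2.
  have h1 := le_trans (Bform_coercive eps ma mb aM bM aa0 b0 (Hw n)) (Bw n).
  have [[_ _ L2 _ _] _] := H20_repr (Hw n).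
  have h2 := mulr_ge0 (sqr_ge0 eps) (dotI_psd L2).
  set d := dotI (wderiv (w n)) _ in h1 *; set d2 := _ * _ in h1 h2.
  have h3 : a0 * d <= C by lra.
  have h4 : d <= `|C| / a0.
    by rewrite ler_pdivlMr// mulrC; apply: (le_trans h3); exact: ler_norm.
  have h5 : K <= K ^+ 2 by rewrite expr2 ler_peMl// ltW.
  by apply: le_trans h5; rewrite /K; lra.
apply: (@rellich w (fun n => wderiv (w n)) K) => //.
- by move=> n; have [[]] := H20_repr (Hw n).
- by move=> n; have [[]] := H20_repr (Hw n).
- by move=> n; have [[]] := H20_repr (Hw n).
Qed.

Lemma complete_H20 : complete_form H20 B dotI.
Proof.
move=> w Hw BC.
have e20 : 0 < eps ^+ 2 by rewrite exprn_gt0.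
have gC : forall e : R, 0 < e -> exists N, forall n m, (N <= n)%N -> (N <= m)%N ->
    dotI ((wderiv2 (w n) : E) - wderiv2 (w m)) ((wderiv2 (w n) : E) - wderiv2 (w m)) <= e.
  move=> e e0; have [N hN] := BC (eps ^+ 2 * e) ltac:(by rewrite mulr_gt0).
  exists N => n m Nn Nm.
  have [Hnm _ e2] := H20_sub (Hw n) (Hw m).
  have [[_ _ Ln _ _] _] := H20_repr (Hw n); have [[_ _ Lm _ _] _] := H20_repr (Hw m).
  have [[_ Lnm1 Lnm _ _] _] := H20_repr Hnm.
  rewrite -(dotI_ae2 Lnm (subspaceB L2I_subspace Ln Lm) e2).
  have h2 := le_trans (Bform_coercive eps ma mb aM bM aa0 b0 Hnm) (hN _ _ Nn Nm).
  have h1 := mulr_ge0 (ltW a0_gt0) (dotI_psd Lnm1).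
  by rewrite -(ler_pM2l e20); apply: le_trans h2; rewrite lerDl.
have [|||v [g0 [Hv Lg0 ev glim]]] := @H20_limit (fun n => wderiv2 (w n)) _ _ _ gC.
- by move=> n; have [[]] := H20_repr (Hw n).
- by move=> n; have [_ []] := H20_repr (Hw n).
- by move=> n; have [_ []] := H20_repr (Hw n).
exists v => // e e0.
have M0 := bound_ge0 aM.
have [N hN] := glim (e / (1 + M + M)) ltac:(by rewrite divr_gt0//; lra).
exists N => n Nn.
have [Hd _ e2] := H20_sub (Hw n) Hv.
have [[Ld Ld1 Ld2 f1 f0] _] := H20_repr Hd.
have [[_ _ Ln _ _] _] := H20_repr (Hw n); have [[_ _ Lv _ _] _] := H20_repr Hv.
have d2 : dotI (wderiv2 (w n - v)) (wderiv2 (w n - v)) <= e / (1 + M + M).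
  apply: le_trans (hN n Nn); rewrite (dotI_ae2 Ld2 (subspaceB L2I_subspace Ln Lv) e2).
  by rewrite (dotI_sub_ae Ln Ln Lv Lg0 (ae_eqI_refl _) ev).
split.
  apply: (le_trans (Bform_le eps0 ma mb aM bM Hd eps1 d2)).
  by rewrite mulrC divfK// gt_eqF//; lra.
apply: (le_trans (H20_poincare Hd)); apply: (le_trans (ae_prim_le Ld1 Ld2 f1)).
apply: (le_trans d2); rewrite ler_pdivrMr; last by lra.
by rewrite ler_peMr ?(ltW e0)//; lra.
Qed.

End EnergySpace.

(** * Closedness of finite-dimensional spaces *)

Section Projections.
Context {R : realType} {E : lmodType R}.
Variables (V : set E) (Q : E -> E -> R).
Hypotheses (sV : lin_subspace V) (bQ : sym_bilin V Q) (pQ : psd V Q).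
Implicit Types S : set E.

(** Every vector of [V] has a [Q]-orthogonal projection on [S]. *)
Definition has_projection S := S `<=` V /\
  forall w, V w -> exists2 f, S f & forall s, S s -> Q s (w - f) = 0.

Lemma projection0 : has_projection [set 0].
Proof.
split=> [_ ->|w Vw]; first exact: sV.1.
exists 0 => // _ ->; rewrite subr0 -(scale0r (0 : E)) (bilinZ sV bQ) ?mul0r//.
exact: sV.1.
Qed.

(** Adding one generator [e]: project along the component [r] of [e] orthogonal to
    [S]; when [r] is degenerate it is orthogonal to everything. *)
Lemma projectionS S e : lin_subspace S -> has_projection S -> V e ->
  has_projection [set s + t *: e | s in S & t in [set: R]].
Proof.
move=> sS [SV hS] Ve.
have [f Sf rO] := hS _ Ve.
pose r := e - f.
have Vf := SV _ Sf; have Vr : V r := subspaceB sV Ve Vf.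
split.
  move=> _ [s Ss [t _ <-]]; apply: (subspaceD sV); first exact: SV.
  exact: (subspaceZ sV).
move=> w Vw; have [g Sg wO] := hS _ Vw.
have Vg := SV _ Sg; have VB := subspaceB sV Vw Vg.
pose t := Q r (w - g) / Q r r.
have rt : Q r (w - g) = t * Q r r.
  have [r0|r0] := eqVneq (Q r r) 0; last by rewrite /t divfK.
  apply/eqP; rewrite r0 mulr0 -sqrf_eq0 eq_le sqr_ge0 andbT.
  by have := psd_CS sV bQ pQ Vr VB; rewrite r0 mul0r.
exists (g - t *: f + t *: e).
  exists (g - t *: f); last by exists t.
  by apply: (subspaceB sS) => //; exact: (subspaceZ sS).
have wE : w - (g - t *: f + t *: e) = (w - g) - t *: r.
  by rewrite /r scalerBr !opprD !opprK !addrA [RHS]addrAC.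
have Vtr : V (t *: r) := subspaceZ sV t Vr.
have sO s : S s -> Q s (w - g - t *: r) = 0.
  move=> Ss; have Vs := SV _ Ss.
  by rewrite (bilinBr sV bQ)// (bilinZr sV bQ)// wO// rO// mulr0 subrr.
have rO' : Q r (w - g - t *: r) = 0.
  by rewrite (bilinBr sV bQ)// (bilinZr sV bQ)// rt subrr.
move=> _ [s Ss [c _ <-]]; rewrite wE.
have Vs := SV _ Ss; have VBB := subspaceB sV VB Vtr.
rewrite (bilinD bQ Vs (subspaceZ sV c Ve) VBB).
rewrite sO// add0r (bilinZ sV bQ)//.
have -> : e = r + f by rewrite /r subrK.
by rewrite (bilinD bQ)// rO' sO// addr0 mulr0.
Qed.

(** A vector that is approximated by vectors of [S] coincides with its projection
    on [S], up to the kernel of [Q]. *)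
Lemma projection_closed S w : lin_subspace S -> has_projection S -> V w ->
  (forall e : R, 0 < e -> exists2 s, S s & Q (w - s) (w - s) <= e) ->
  exists2 f, S f & Q (w - f) (w - f) = 0.
Proof.
move=> sS [SV hS] Vw ws; have [f Sf fO] := hS _ Vw; exists f => //.
have Vf := SV _ Sf; have VB := subspaceB sV Vw Vf.
apply/eqP; rewrite eq_le pQ// andbT; apply/ler_addgt0Pl => e e0; rewrite addr0.
have [s Ss] := ws _ e0; apply: le_trans.
have Vs := SV _ Ss; have Sfs := subspaceB sS Sf Ss; have Vfs := SV _ Sfs.
have -> : w - s = (w - f) + (f - s) by rewrite addrA subrK.
rewrite (bilinD bQ VB Vfs (subspaceD sV VB Vfs)).
rewrite (bilinDr sV bQ VB Vfs VB) (bilinDr sV bQ VB Vfs Vfs).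
rewrite (bQ.1 (w - f) (f - s))// !(fO _ Sfs) addr0 add0r lerDl.
exact: pQ.
Qed.

End Projections.

Section PolynomialsClosed.
Context {R : realType}.
Implicit Types (u v w g : R -> R).
Local Notation mu := (@lebesgue_measure R).
Local Notation I := (@I01 R).
Local Notation E := (R -> R).

(** Polynomial functions of degree less than [n]. *)
Definition poly_funs n : set E :=
  [set f | exists2 q : {poly R}, (size q <= n)%N & f = horner q].

Lemma poly_funs_subspace n : @lin_subspace R E (poly_funs n).
Proof.
split; first by exists 0; rewrite ?size_poly0//; apply/funext => x; rewrite horner0.
move=> c _ _ [q1 s1 ->] [q2 s2 ->]; exists (c *: q1 + q2).
  rewrite (leq_trans (size_polyD _ _))// geq_max s2 andbT.
  exact: leq_trans (size_scale_leq _ _) s1.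
by apply/funext => x; rewrite hornerD hornerZ.
Qed.

Lemma horner_L2 (q : {poly R}) : L2I (horner q).
Proof. by apply: L2I_cont; exact: continuous_horner. Qed.

Lemma poly_funs_projection n (Q : E -> E -> R) : @sym_bilin R E L2I Q ->
  @psd R E L2I Q -> @has_projection R E L2I Q (poly_funs n).
Proof.
move=> bQ pQ; elim: n => [|n IH].
  have -> : poly_funs 0 = [set (0 : E)].
    apply/seteqP; split=> [_ [q + ->]|_ ->].
      rewrite leqn0 size_poly_eq0 => /eqP ->.
      by apply/funext => x; rewrite horner0.
    by exists 0; rewrite ?size_poly0//; apply/funext => x; rewrite horner0.
  exact: (projection0 L2I_subspace bQ).
have -> : poly_funs n.+1 =
    [set s + t *: (horner ('X^n) : E) | s in poly_funs n & t in [set: R]].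
  apply/seteqP; split=> [_ [q sq ->]|_ [_ [q sq ->] [t _ <-]]].
    exists (horner (\poly_(i < n) q`_i)).
      by exists (\poly_(i < n) q`_i) => //; exact: size_poly.
    exists q`_n => //; apply/funext => x.
    rewrite [LHS](_ : _ = (\poly_(i < n) q`_i + q`_n *: 'X^n).[x]); last first.
      by rewrite hornerD hornerZ.
    congr (_.[x]); apply/polyP => i; rewrite coefD coefZ coefXn coef_poly.
    have [ilt|ige] := ltnP i n; first by rewrite ltn_eqF// mulr0 addr0.
    have [->|ne] := eqVneq i n; first by rewrite add0r mulr1.
    rewrite mulr0 addr0 nth_default// (leq_trans sq)// ltn_neqAle eq_sym ne.
    exact: ige.
  exists (q + t *: 'X^n); last by apply/funext => x; rewrite hornerD hornerZ.
  rewrite (leq_trans (size_polyD _ _))// geq_max (leqW sq)/=.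
  by rewrite (leq_trans (size_scale_leq _ _))// size_polyXn.
apply: (projectionS L2I_subspace bQ pQ) => //; first exact: poly_funs_subspace.
exact: horner_L2.
Qed.

(** An L^2 limit of functions which are polynomials of degree less than [n]
    between [c] and [d] is one too: apply [projection_closed] to the inner product
    of L^2 of that interval. *)
Lemma poly_closed_itv n (c d : R) (w : nat -> E) v : 0 <= c -> d <= 1 ->
  (forall k, L2I (w k)) -> L2I v ->
  (forall e : R, 0 < e -> exists k, dotI (w k - v) (w k - v) <= e) ->
  (forall k, exists2 q : {poly R}, (size q <= n)%N &
     {ae mu, forall x, c < x < d -> w k x = q.[x]}) ->
  exists2 q : {poly R}, (size q <= n)%N & {ae mu, forall x, c < x < d -> v x = q.[x]}.
Proof.
move=> c0 d1 Lw Lv wv hw.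
pose J : E := \1_(`]c, d[ : set R).
have JE x : J x = (c < x < d)%R%:R by rewrite /J indicE mem_setE in_itv.
have mJ : measurable_fun I J by exact: measurable_indic.
have J1 x : I x -> `|J x| <= 1.
  by move=> _; rewrite JE; case: (_ && _); rewrite ?normr1 ?normr0.
have J0 x : I x -> 0 <= J x by move=> _; rewrite JE.
pose Q (u v : E) := dotI (J \* u) v.
have bQ : @sym_bilin R E L2I Q := wdot_sym_bilin mJ J1.
have pQ : @psd R E L2I Q.
  by move=> u Lu; have := wdot_ge mJ J1 J0 Lu; rewrite mul0r.
have [|f [q sq ->] f0] := projection_closed L2I_subspace bQ pQ (w := v)
    (poly_funs_subspace n) (poly_funs_projection n bQ pQ) Lv.
  move=> e e0; have [k hk] := wv (e / 2) ltac:(lra).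
  have [q sq hq] := hw k; exists (horner q); first by exists q.
  have Lq := horner_L2 q.
  have L1 := subspaceB L2I_subspace (Lw k) Lv.
  have L2 := subspaceB L2I_subspace (Lw k) Lq.
  have -> : v - horner q = ((w k : E) - horner q) - ((w k : E) - v).
    by rewrite opprB [RHS]addrC addrA subrK.
  apply: (le_trans (psd_leB L2I_subspace bQ pQ L2 L1)).
  have -> : Q ((w k : E) - horner q) ((w k : E) - horner q) = 0.
    rewrite /Q; set z := (w k : E) - horner q.
    have LJ := L2I_mulb mJ J1 L2; have L0 := L2I_cst (0 : R).
    have e1 : ae_eqI (J \* z) (cst 0).
      apply: ae_filterS hq => x + _ /=; rewrite JE.
      case: (c < x < d) => [/(_ isT) h|_]; last by rewrite mul0r.
      by rewrite mul1r; change (w k x - q.[x] = 0); rewrite h subrr.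
    rewrite (dotI_ael LJ L0 L2 e1) dotI_cstl// mul0r.
    done.
  have := wdot_le mJ J1 L1; rewrite mul1r -/(Q _ _); lra.
exists q => //.
have Lq := horner_L2 q; have L1 := subspaceB L2I_subspace Lv Lq.
have LJ := L2I_mulb mJ J1 L1.
have JJ : dotI (J \* ((v : E) - horner q)) (J \* ((v : E) - horner q)) = 0.
  rewrite -f0 /Q; apply: eq_Rintegral => x _ /=; rewrite JE.
  by case: (c < (x : R) < d); rewrite ?mul1r// !mul0r.
apply: ae_filterS (dotI_eq0 LJ JJ) => x /= + xcd.
have /andP[cx xd] := xcd.
have Ix : I x by apply/I01P; rewrite (le_lt_trans c0 cx) (lt_le_trans xd d1).
move=> /(_ Ix); rewrite JE xcd mul1r.
by change (v x - q.[x] = 0 -> v x = q.[x]) => /subr0_eq.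
Qed.

End PolynomialsClosed.

(** * The finite element space *)

Section FiniteElementSpace.
Context {R : realType}.
Variables (beta eps : R) (p N : nat).
Implicit Types (u v w g : R -> R).
Local Notation mu := (@lebesgue_measure R).
Local Notation I := (@I01 R).
Local Notation E := (R -> R).
Local Notation node := (exp_node beta eps p N).

Lemma Vh_subspace : @lin_subspace R E (Vh beta eps p N).
Proof.
split.
  split; first exact: H20_zero.
  move=> j jN; exists 0; rewrite ?size_poly0//.
  by apply: aeW => x _; rewrite horner0.
move=> c u v [Hu hu] [Hv hv]; split; first exact: (H20_subspace.2).
move=> j jN; have [q1 s1 e1] := hu j jN; have [q2 s2 e2] := hv j jN.
exists (c *: q1 + q2).
  rewrite (leq_trans (size_polyD _ _))// geq_max s2 andbT.
  exact: leq_trans (size_scale_leq _ _) s1.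
apply: ae_filterS2 e1 e2 => x h1 h2 xj; rewrite hornerD hornerZ -(h1 xj) -(h2 xj).
by [].
Qed.

Lemma Vh_H20 : (Vh beta eps p N : set E) `<=` H20.
Proof. by move=> u []. Qed.

Hypothesis part : exp_partition beta eps p N.

Lemma node_mono i j : (i <= j)%N -> (j <= N)%N -> node i <= node j.
Proof.
move=> ij; elim: j ij => [|j IH]; first by rewrite leqn0 => /eqP ->.
rewrite leq_eqVlt => /predU1P[->//|ij jN].
have [_ _ hlt] := part.
by apply: (le_trans (IH _ (ltnW jN))) => //; apply: ltW; exact: hlt.
Qed.

Lemma node_ge0 j : (j <= N)%N -> 0 <= node j.
Proof. by move=> jN; have [h0 _ _] := part; rewrite -h0; exact: node_mono. Qed.

Lemma node_le1 j : (j <= N)%N -> node j <= 1.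
Proof. by move=> jN; have [_ h1 _] := part; rewrite -h1; exact: node_mono. Qed.

Lemma mesh_width_ge0 : 0 <= mesh_width beta eps p N.
Proof. exact: bigmax_ge_id. Qed.

Lemma node_gap j : (j < N)%N -> node j.+1 - node j <= mesh_width beta eps p N.
Proof.
move=> jN; rewrite /mesh_width.
exact: (le_bigmax _ (fun j : 'I_N => node j.+1 - node j) (Ordinal jN)).
Qed.

(** Every point of [0, 1] has a node within [h] to its right. *)
Lemma node_near (z : R) : 0 <= z <= 1 ->
  exists2 j, (j <= N)%N & z <= node j <= z + mesh_width beta eps p N.
Proof.
move=> /andP[z0 z1].
have [n0 nN _] := part.
have ex : exists j, z <= node j by exists N; rewrite nN.
have := ex_minnP ex; case=> [[|j] hj minj].
  exists 0%N => //; rewrite hj/= n0.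
  by rewrite addr_ge0// mesh_width_ge0.
have jN : (j < N)%N by apply: minj; rewrite nN.
exists j.+1 => //; rewrite hj/=.
have : node j < z by rewrite ltNge; apply/negP => /minj; rewrite ltnn.
have := node_gap jN; lra.
Qed.

(** The finite element space is closed in the energy space. *)
Lemma Vh_complete (B : E -> E -> R) :
  complete_form H20 B dotI -> complete_form (Vh beta eps p N) B dotI.
Proof.
move=> cpl w Vw BC; have Hw n := Vh_H20 (Vw n).
have [v Hv vlim] := cpl w Hw BC; exists v => //; split => // j jN.
have Lw n := H20_L2 (Hw n).
apply: (@poly_closed_itv R p.+1 _ _ w v) => //.
- by apply: node_ge0; exact: ltnW.
- exact: node_le1.
- exact: H20_L2.
- by move=> e e0; have [n /(_ n (leqnn n))[]] := vlim e e0; exists n.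
- by move=> n; have [_ /(_ j jN)] := Vw n.
Qed.

End FiniteElementSpace.

(** * Spline bumps *)

Section Bumps.
Context {R : realType}.
Implicit Types (u v w g : R -> R).
Local Notation mu := (@lebesgue_measure R).
Local Notation I := (@I01 R).
Local Notation E := (R -> R).

(** [u1] and [u] are the first two iterated primitives of [g] on [0, 1]. *)
Definition primitives g u1 u := [/\ L2I g, L2I u1, L2I u,
  forall x, 0 <= x <= 1 -> prim g x = u1 x &
  forall x, 0 <= x <= 1 -> prim u1 x = u x].

Lemma primitives_lin (c : R) g u1 u g' u1' u' :
  primitives g u1 u -> primitives g' u1' u' ->
  primitives (c *: (g : E) + g') (c *: (u1 : E) + u1') (c *: (u : E) + u').
Proof.
move=> [L0 L1 L2 e1 e2] [L0' L1' L2' e1' e2'].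
split; try exact: L2I_subspace.2.
  by move=> x x01; rewrite primZD// e1// e1'.
by move=> x x01; rewrite primZD// e2// e2'.
Qed.

Lemma primitives0 : primitives (0 : E) (0 : E) (0 : E).
Proof.
have L0 := L2I_cst (0 : R).
have p0 x : prim (0 : E) x = 0.
  change (dotI (below x) (0 : E) = 0).
  by rewrite -(scale0r (0 : E)) (bilinZr L2I_subspace dotI_sym_bilin 0 (L2I_below x) L0) mul0r.
by split => // x _; rewrite p0.
Qed.

Lemma primitives_sum (J : Type) (r : seq J) (c : J -> R) (g u1 u : J -> E) :
  (forall j, primitives (g j) (u1 j) (u j)) ->
  primitives (\sum_(j <- r) c j *: g j) (\sum_(j <- r) c j *: u1 j)
    (\sum_(j <- r) c j *: u j).
Proof.
move=> h; elim: r => [|j r IH]; first by rewrite !big_nil; exact: primitives0.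
by rewrite !big_cons; exact: primitives_lin.
Qed.

(** The truncated power with knot [y]. *)
Definition tpow (n : nat) (y x : R) : R := pos (x - y) ^+ n.

Lemma prim_id x : 0 <= x <= 1 -> prim (cst 1 : E) x = x.
Proof.
move=> x01; rewrite (@prim_of_derive _ id)//= ?subr0//.
by move=> y; exact: cvg_cst.
Qed.

Lemma prim_above y x : 0 <= y <= 1 -> 0 <= x <= 1 -> prim (above (y : R)) x = pos (x - y).
Proof.
move=> y01 x01; have Lb := L2I_below x; have La := L2I_above y.
rewrite /prim dotI_sym_bilin.1// dotI_above//.
have -> : prim (below x) 1 = x.
  rewrite /prim dotI_sym_bilin.1//; last exact: L2I_below.
  by rewrite -[RHS](prim_id x01) /prim; apply: eq_Rintegral => t /set_mem/I01P/andP[_ t1]; rewrite /below t1.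
have -> : prim (below x) y = Num.min x y.
  have m01 : 0 <= Num.min x y <= 1.
    by have /andP[? ?] := x01; have /andP[? ?] := y01; rewrite le_min ge_min; apply/andP; split; [apply/andP|apply/orP; left].
  rewrite -[RHS](prim_id m01) /prim; apply: eq_Rintegral => t _.
  by rewrite /below lt_min mulr1 -natrM mulnb andbC.
have [xy|yx] := leP x y; first by rewrite pos_le0 ?subrr// subr_le0.
by rewrite pos_id// subr_ge0 ltW.
Qed.

Lemma tpow_cont n y : continuous (tpow n y).
Proof.
have hp : continuous (fun x : R => pos (x - y)).
  move=> x; apply: (@continuous_comp _ _ _ (fun x => x - y) pos); last exact: pos_continuous.
  by apply: cvgB; [exact: cvg_id|exact: cvg_cst].
elim: n => [|n IH] x; first exact: cvg_cst.
have -> : tpow n.+1 y = (fun x => pos (x - y) * tpow n y x).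
  by apply/funext => t; rewrite /tpow exprS.
by apply: cvgM; [exact: hp|exact: IH].
Qed.

Lemma L2I_tpow n y : L2I (tpow n y).
Proof. by apply: L2I_cont; exact: tpow_cont. Qed.

Lemma prim_tpow1 (y x : R) : 0 <= y -> 0 <= x <= 1 -> prim (tpow 1 y) x = 1 / 2 * tpow 2 y x.
Proof.
move=> y0 x01.
have d (t : R) : is_derive t 1 (fun x => 1 / 2 * tpow 2 y x) (tpow 1 y t).
  have h : is_derive t 1 (tpow 2 y) (2 * pos (t - y)).
    have h0 := is_derive_pos2 (t - y); have h1 := @is_derive_translate R (fun x => pos x ^+ 2) y t _ h0.
    exact h1.
  rewrite (_ : (fun _ => _) = (1 / 2) *: (tpow 2 y : E))//.
  apply: is_derive_eq; rewrite /tpow ?expr1.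
  by change (1 / 2 * (2 * pos (t - y)) = pos (t - y)); field.
rewrite (prim_of_derive d (@tpow_cont 1 y) x01) [X in _ - X](_ : _ = 0) ?subr0//.
by rewrite /tpow pos_le0 ?expr0n ?mulr0//; lra.
Qed.

Lemma prim_tpow2 (y x : R) : 0 <= y -> 0 <= x <= 1 -> prim (tpow 2 y) x = 1 / 3 * tpow 3 y x.
Proof.
move=> y0 x01.
have d (t : R) : is_derive t 1 (fun x => 1 / 3 * tpow 3 y x) (tpow 2 y t).
  have h : is_derive t 1 (tpow 3 y) (3 * pos (t - y) ^+ 2).
    have h0 := is_derive_pos3 (t - y); have h1 := @is_derive_translate R (fun x => pos x ^+ 3) y t _ h0.
    exact h1.
  rewrite (_ : (fun _ => _) = (1 / 3) *: (tpow 3 y : E))//.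
  apply: is_derive_eq; rewrite /tpow ?expr1.
  by change (1 / 3 * (3 * pos (t - y) ^+ 2) = pos (t - y) ^+ 2); field.
rewrite (prim_of_derive d (@tpow_cont 2 y) x01) [X in _ - X](_ : _ = 0) ?subr0//.
by rewrite /tpow pos_le0 ?expr0n ?mulr0//; lra.
Qed.

Lemma primitives_above y : 0 <= y <= 1 ->
  primitives (above y) (tpow 1 y) ((1 / 2) *: (tpow 2 y : E)).
Proof.
move=> y01; split; [exact: L2I_above|exact: L2I_tpow| |move=> x x01|move=> x x01].
- by apply: (subspaceZ L2I_subspace); exact: L2I_tpow.
- by rewrite prim_above// /tpow expr1.
- by have /andP[y0 _] := y01; exact: prim_tpow1.
Qed.

Lemma primitives_tpow y : 0 <= y ->
  primitives (tpow 1 y) ((1 / 2) *: (tpow 2 y : E)) ((1 / 6) *: (tpow 3 y : E)).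
Proof.
move=> y0; have L2 := L2I_tpow 2 y; have L3 := L2I_tpow 3 y.
split; [exact: L2I_tpow| exact: (subspaceZ L2I_subspace)|exact: (subspaceZ L2I_subspace)| |].
- by move=> x x01; exact: prim_tpow1.
- move=> x x01; rewrite /prim (bilinZr L2I_subspace dotI_sym_bilin (1 / 2) (L2I_below x) L2).
  rewrite -/(prim _ _) prim_tpow2//.
  by change (1 / 2 * (1 / 3 * tpow 3 y x) = 1 / 6 * tpow 3 y x); field.
Qed.

End Bumps.

Section Plateaus.
Context {R : realType}.
Implicit Types (u v w g : R -> R) (x y z c d l : R).
Local Notation mu := (@lebesgue_measure R).
Local Notation I := (@I01 R).
Local Notation E := (R -> R).

Lemma primitives_H20 g u1 u : primitives g u1 u -> u1 1 = 0 -> u 1 = 0 ->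
  H20 u /\ ae_eqI (wderiv2 u) g.
Proof.
move=> [Lg L1 Lu e1 e2] u11 uu1.
have i1 : 0 <= (1 : R) <= 1 by rewrite ler01 lexx.
have pp x : prim (prim g) x = prim u1 x.
  apply: prim_ae => //; first exact: L2I_prim.
  by apply: aeW => t /I01P/andP[t0 t1]; apply: e1; rewrite !ltW.
have [] := @H20_intro R u g => //.
- by rewrite e1.
- by rewrite pp e2.
by apply: aeW => t /I01P/andP[t0 t1]; rewrite pp e2// !ltW.
Qed.

(** [knot_0 a b y] is the cubic spline with the single knot [y] that vanishes
    before [y] and whose second derivative [knot_2 a b y] is [a + b (x - y)]
    after it; [knot_1 a b y] is its first derivative. *)
Definition knot_2 (a b y : R) : E := a *: (above y : E) + b *: (tpow 1 y : E).
Definition knot_1 (a b y : R) : E :=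
  a *: (tpow 1 y : E) + b *: ((1 / 2) *: (tpow 2 y : E)).
Definition knot_0 (a b y : R) : E :=
  a *: ((1 / 2) *: (tpow 2 y : E)) + b *: ((1 / 6) *: (tpow 3 y : E)).

Lemma primitives_knot a b y : 0 <= y <= 1 ->
  primitives (knot_2 a b y) (knot_1 a b y) (knot_0 a b y).
Proof.
move=> y01; have /andP[y0 _] := y01.
have := primitives_lin a (primitives_above y01)
  (primitives_lin b (primitives_tpow y0) primitives0).
by rewrite !addr0.
Qed.

(** [step_0 y z] is the C^1 cubic spline [3 t ^ 2 - 2 t ^ 3] in the variable
    [t = (x - y) / (z - y)] for [x] between [y] and [z], equal to 0 before [y] and
    to 1 after [z]; [step_1 y z] and [step_2 y z] are its derivatives. *)
Definition step_2 y z : E := 1 *: knot_2 (6 / (z - y) ^+ 2) (- (12 / (z - y) ^+ 3)) y +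
  knot_2 (6 / (z - y) ^+ 2) (12 / (z - y) ^+ 3) z.
Definition step_1 y z : E := 1 *: knot_1 (6 / (z - y) ^+ 2) (- (12 / (z - y) ^+ 3)) y +
  knot_1 (6 / (z - y) ^+ 2) (12 / (z - y) ^+ 3) z.
Definition step_0 y z : E := 1 *: knot_0 (6 / (z - y) ^+ 2) (- (12 / (z - y) ^+ 3)) y +
  knot_0 (6 / (z - y) ^+ 2) (12 / (z - y) ^+ 3) z.

Lemma primitives_step y z : 0 <= y <= 1 -> 0 <= z <= 1 ->
  primitives (step_2 y z) (step_1 y z) (step_0 y z).
Proof. by move=> y01 z01; apply: primitives_lin; exact: primitives_knot. Qed.

Lemma step_0E y z x : step_0 y z x =
  6 / (z - y) ^+ 2 * (1 / 2 * pos (x - y) ^+ 2) - 12 / (z - y) ^+ 3 * (1 / 6 * pos (x - y) ^+ 3)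
  + (6 / (z - y) ^+ 2 * (1 / 2 * pos (x - z) ^+ 2) + 12 / (z - y) ^+ 3 * (1 / 6 * pos (x - z) ^+ 3)).
Proof.
transitivity (1 * (6 / (z - y) ^+ 2 * (1 / 2 * pos (x - y) ^+ 2) + - (12 / (z - y) ^+ 3) * (1 / 6 * pos (x - y) ^+ 3))
  + (6 / (z - y) ^+ 2 * (1 / 2 * pos (x - z) ^+ 2) + 12 / (z - y) ^+ 3 * (1 / 6 * pos (x - z) ^+ 3))).
  by [].
by rewrite mul1r mulNr.
Qed.

Lemma step_1E y z x : step_1 y z x =
  6 / (z - y) ^+ 2 * pos (x - y) - 12 / (z - y) ^+ 3 * (1 / 2 * pos (x - y) ^+ 2)
  + (6 / (z - y) ^+ 2 * pos (x - z) + 12 / (z - y) ^+ 3 * (1 / 2 * pos (x - z) ^+ 2)).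
Proof.
transitivity (1 * (6 / (z - y) ^+ 2 * pos (x - y) ^+ 1 + - (12 / (z - y) ^+ 3) * (1 / 2 * pos (x - y) ^+ 2))
  + (6 / (z - y) ^+ 2 * pos (x - z) ^+ 1 + 12 / (z - y) ^+ 3 * (1 / 2 * pos (x - z) ^+ 2))).
  by [].
by rewrite mul1r mulNr !expr1.
Qed.

Lemma step_left y z x : y < z -> x <= y -> step_0 y z x = 0.
Proof.
move=> yz xy; rewrite step_0E !pos_le0; [|lra|lra].
by rewrite !expr0n /= !(mulr0, subr0, addr0).
Qed.

Lemma step_right y z x : y < z -> z <= x -> step_0 y z x = 1 /\ step_1 y z x = 0.
Proof.
move=> yz zx; have zy : z - y != 0 by rewrite subr_eq0 gt_eqF.
rewrite step_0E step_1E !pos_id; [|lra|lra].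
have -> : x - y = (x - z) + (z - y) by ring.
by split; field.
Qed.

Lemma step_2_le y z x l : 0 <= y <= 1 -> 0 <= z <= 1 -> 0 < l -> l <= z - y -> I x ->
  `|step_2 y z x| <= 2 * (6 / l ^+ 2 + 12 / l ^+ 3).
Proof.
move=> /andP[y0 y1] /andP[z0 z1] l0 lyz /I01P/andP[x0 x1].
have L0 : 0 < z - y by lra.
have A0 : 0 <= 6 / (z - y) ^+ 2 by rewrite divr_ge0// exprn_ge0// ltW.
have C0 : 0 <= 12 / (z - y) ^+ 3 by rewrite divr_ge0// exprn_ge0// ltW.
have Al : 6 / (z - y) ^+ 2 <= 6 / l ^+ 2.
  rewrite ler_pM2l// lef_pV2 ?posrE ?exprn_gt0//.
  by rewrite lerXn2r ?nnegrE// ltW.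
have Cl : 12 / (z - y) ^+ 3 <= 12 / l ^+ 3.
  rewrite ler_pM2l// lef_pV2 ?posrE ?exprn_gt0//.
  by rewrite lerXn2r ?nnegrE// ltW.
have posb t : 0 <= t -> 0 <= pos (x - t) <= 1.
  by move=> t0; rewrite pos_ge0/= /pos ge_max ler01 andbT; lra.
have ab t : 0 <= above t x <= 1 by rewrite /above; case: (t < x); rewrite ?lexx ?ler01.
have key (A C s t : R) : 0 <= A -> 0 <= C -> 0 <= s <= 1 -> 0 <= t <= 1 ->
    `|A * s + C * t| <= A + C /\ `|A * s - C * t| <= A + C.
  move=> A00 C00 /andP[s0 s1] /andP[t0 t1].
  have h1 := ler_piMr A00 s1; have h2 := ler_piMr C00 t1.
  have h3 := mulr_ge0 A00 s0; have h4 := mulr_ge0 C00 t0.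
  by split; rewrite ler_norml; apply/andP; split; lra.
have [_ k1] := key _ _ _ _ A0 C0 (ab y) (posb y y0).
have [k2 _] := key _ _ _ _ A0 C0 (ab z) (posb z z0).
have -> : step_2 y z x = (6 / (z - y) ^+ 2 * above y x - 12 / (z - y) ^+ 3 * pos (x - y))
   + (6 / (z - y) ^+ 2 * above z x + 12 / (z - y) ^+ 3 * pos (x - z)).
  transitivity (1 * (6 / (z - y) ^+ 2 * above y x + - (12 / (z - y) ^+ 3) * pos (x - y) ^+ 1)
   + (6 / (z - y) ^+ 2 * above z x + 12 / (z - y) ^+ 3 * pos (x - z) ^+ 1)).
    by [].
  by rewrite mul1r mulNr !expr1.
apply: (le_trans (ler_normD _ _)); lra.
Qed.

(** [u] is a polynomial of degree less than [n] between [c] and [d]. *)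
Definition poly_on c d (n : nat) u := exists2 q : {poly R}, (size q <= n)%N &
  forall x, c < x < d -> u x = q.[x].

Lemma poly_on_lin c d n (k : R) u v : poly_on c d n u -> poly_on c d n v ->
  poly_on c d n (k *: (u : E) + v).
Proof.
move=> [q1 s1 e1] [q2 s2 e2]; exists (k *: q1 + q2).
  rewrite (leq_trans (size_polyD _ _))// geq_max s2 andbT.
  exact: leq_trans (size_scale_leq _ _) s1.
by move=> x xcd; rewrite hornerD hornerZ -e1// -e2.
Qed.

Lemma poly_on0 c d n : poly_on c d n (0 : E).
Proof. by exists 0; rewrite ?size_poly0// => x _; rewrite horner0. Qed.

Lemma poly_onZ c d n (k : R) u : poly_on c d n u -> poly_on c d n (k *: (u : E)).
Proof. by move=> h; rewrite -[_ *: _]addr0; apply: poly_on_lin => //; exact: poly_on0. Qed.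

Lemma poly_on_tpow c d n k y : (k < n)%N -> (0 < k)%N -> y <= c \/ d <= y ->
  poly_on c d n (tpow k y).
Proof.
move=> kn k0 [yc|dy].
  exists (('X - y%:P) ^+ k); first by rewrite size_exp_XsubC.
  move=> x /andP[cx _]; rewrite horner_exp hornerXsubC /tpow pos_id//; lra.
exists 0; rewrite ?size_poly0// => x /andP[_ xd].
by rewrite horner0 /tpow pos_le0 ?expr0n ?gtn_eqF//; lra.
Qed.

Lemma poly_on_step c d n y z : (3 < n)%N -> y <= c \/ d <= y -> z <= c \/ d <= z ->
  poly_on c d n (step_0 y z).
Proof.
move=> n3 hy hz.
have kn a b t : t <= c \/ d <= t -> poly_on c d n (knot_0 a b t).
  move=> ht; apply: poly_on_lin; [|apply: poly_onZ]; apply: poly_onZ.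
    by apply: poly_on_tpow => //; exact: ltnW.
  exact: poly_on_tpow.
by apply: poly_on_lin; exact: kn.
Qed.

(** [bump_0 y0 y1 y2 y3] rises from 0 to 1 on [y0, y1], is 1 on [y1, y2] and
    falls to 0 on [y2, y3]; [bump_1] and [bump_2] are its derivatives. *)
Definition bump_2 (y0 y1 y2 y3 : R) : E := (-1) *: step_2 y2 y3 + step_2 y0 y1.
Definition bump_1 (y0 y1 y2 y3 : R) : E := (-1) *: step_1 y2 y3 + step_1 y0 y1.
Definition bump_0 (y0 y1 y2 y3 : R) : E := (-1) *: step_0 y2 y3 + step_0 y0 y1.

Section OneBump.
Variables (y0 y1 y2 y3 l : R).
Hypotheses (l0 : 0 < l) (y00 : 0 <= y0) (y31 : y3 <= 1).
Hypotheses (l01 : l <= y1 - y0) (l12 : l <= y2 - y1) (l23 : l <= y3 - y2).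

Let i0 : 0 <= y0 <= 1.
Proof. by move: l0 y00 y31 l01 l12 l23 => *; apply/andP; split; lra. Qed.
Let i1 : 0 <= y1 <= 1.
Proof. by move: l0 y00 y31 l01 l12 l23 => *; apply/andP; split; lra. Qed.
Let i2 : 0 <= y2 <= 1.
Proof. by move: l0 y00 y31 l01 l12 l23 => *; apply/andP; split; lra. Qed.
Let i3 : 0 <= y3 <= 1.
Proof. by move: l0 y00 y31 l01 l12 l23 => *; apply/andP; split; lra. Qed.
Let h01 : y0 < y1. Proof. by move: l0 l01 => *; lra. Qed.
Let h12 : y1 < y2. Proof. by move: l0 l12 => *; lra. Qed.
Let h23 : y2 < y3. Proof. by move: l0 l23 => *; lra. Qed.

Lemma primitives_bump :
  primitives (bump_2 y0 y1 y2 y3) (bump_1 y0 y1 y2 y3) (bump_0 y0 y1 y2 y3).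
Proof. by apply: primitives_lin; exact: primitives_step. Qed.

Let bE x : bump_0 y0 y1 y2 y3 x = - step_0 y2 y3 x + step_0 y0 y1 x.
Proof. by rewrite -[- step_0 _ _ _]mulN1r. Qed.

Lemma bump_left x : x <= y0 -> bump_0 y0 y1 y2 y3 x = 0.
Proof.
by move=> xy; have ? := h01; have ? := h12; have ? := h23; rewrite bE !step_left ?oppr0 ?addr0//; lra.
Qed.

Lemma bump_right x : y3 <= x -> bump_0 y0 y1 y2 y3 x = 0.
Proof.
move=> xy; have ? := h12; have ? := h23.
by rewrite bE (step_right h23 xy).1 (step_right h01 _).1 ?addNr//; lra.
Qed.

Lemma bump_1_right x : y3 <= x -> bump_1 y0 y1 y2 y3 x = 0.
Proof.
move=> xy; have ? := h12; have ? := h23.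
transitivity (-1 * step_1 y2 y3 x + step_1 y0 y1 x); first by [].
by rewrite (step_right h23 xy).2 (step_right h01 _).2 ?mulr0 ?addr0//; lra.
Qed.

Lemma bump_plateau x : y1 <= x <= y2 -> bump_0 y0 y1 y2 y3 x = 1.
Proof.
move=> /andP[x1 x2].
by rewrite bE (step_left h23 x2) (step_right h01 x1).1 oppr0 add0r.
Qed.

Lemma bump_2_le x : I x ->
  `|bump_2 y0 y1 y2 y3 x| <= 4 * (6 / l ^+ 2 + 12 / l ^+ 3).
Proof.
move=> Ix; have h1 := step_2_le i0 i1 l0 l01 Ix; have h2 := step_2_le i2 i3 l0 l23 Ix.
have -> : bump_2 y0 y1 y2 y3 x = - step_2 y2 y3 x + step_2 y0 y1 x.
  by rewrite -[- step_2 _ _ _]mulN1r.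
by apply: (le_trans (ler_normD _ _)); rewrite normrN; lra.
Qed.

Lemma poly_on_bump c d n : (3 < n)%N ->
  y0 <= c \/ d <= y0 -> y1 <= c \/ d <= y1 -> y2 <= c \/ d <= y2 -> y3 <= c \/ d <= y3 ->
  poly_on c d n (bump_0 y0 y1 y2 y3).
Proof. by move=> n3 *; apply: poly_on_lin; exact: poly_on_step. Qed.

End OneBump.

Section BumpFamily.
Variables (k : nat) (y0 y1 y2 y3 : 'I_k -> R) (l : R).
Hypotheses (l0 : 0 < l) (y00 : forall i, 0 <= y0 i) (y31 : forall i, y3 i <= 1).
Hypotheses (l01 : forall i, l <= y1 i - y0 i) (l12 : forall i, l <= y2 i - y1 i).
Hypotheses (l23 : forall i, l <= y3 i - y2 i).
Hypothesis sep : forall i j : 'I_k, (i < j)%N -> y3 i <= y0 j.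

Let f i : E := bump_0 (y0 i) (y1 i) (y2 i) (y3 i).
Let f1 i : E := bump_1 (y0 i) (y1 i) (y2 i) (y3 i).
Let f2 i : E := bump_2 (y0 i) (y1 i) (y2 i) (y3 i).
Let G : R := 4 * (6 / l ^+ 2 + 12 / l ^+ 3).

Let sumE (c : 'I_k -> R) (h : 'I_k -> E) x : (\sum_i c i *: h i) x = \sum_i c i * h i x.
Proof. by rewrite fct_sumE. Qed.

Lemma bump_H20 i : H20 (f i).
Proof.
have P := primitives_bump l0 (y00 i) (y31 i) (l01 i) (l12 i) (l23 i).
have [] // := primitives_H20 P; first exact: (bump_1_right l0 (l01 i) (l12 i) (l23 i)).
exact: (bump_right l0 (l01 i) (l12 i) (l23 i)).
Qed.

(** Bounds for the span of a family of bumps with disjoint supports, knots at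
    distance at least [l]: the energy of combinations from above, and in
    [bump_mass] their L^2 norm from below by the contribution of the plateaus. *)
Lemma bump_energy (c : 'I_k -> R) :
  dotI (wderiv2 (\sum_i c i *: f i)) (wderiv2 (\sum_i c i *: f i)) <=
  (G * k%:R) ^+ 2 * \sum_i c i ^+ 2.
Proof.
have P : primitives (\sum_i c i *: f2 i) (\sum_i c i *: f1 i) (\sum_i c i *: f i).
  by apply: primitives_sum => i; exact: (primitives_bump l0).
have [] := primitives_H20 P.
- rewrite sumE big1// => i _.
  by rewrite /f1 (bump_1_right l0 (l01 i) (l12 i) (l23 i))// mulr0.
- rewrite sumE big1// => i _.
  by rewrite /f (bump_right l0 (l01 i) (l12 i) (l23 i))// mulr0.
move=> HF e2; have [[_ _ L2 _ _] _] := H20_repr HF; have [Lg _ _ _ _] := P.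
rewrite (dotI_ae2 L2 Lg e2).
pose S := \sum_i c i ^+ 2.
have S0 : 0 <= S by apply: sumr_ge0 => i _; exact: sqr_ge0.
have cS i : `|c i| <= Num.sqrt S.
  rewrite -sqrtr_sqr ler_wsqrtr// /S (bigD1 i)//= lerDl.
  by apply: sumr_ge0 => j _; exact: sqr_ge0.
have -> : (G * k%:R) ^+ 2 * S = (G * k%:R * Num.sqrt S) ^+ 2.
  by rewrite [RHS]exprMn sqr_sqrtr.
apply: dotI_sup_le => // x Ix; rewrite sumE.
apply: (le_trans (ler_norm_sum _ _ _)).
apply: (@le_trans _ _ (\sum_(i < k) (G * Num.sqrt S))).
  apply: ler_sum => i _; rewrite normrM mulrC ler_pM//.
  exact: (bump_2_le l0 (y00 i) (y31 i) (l01 i) (l12 i) (l23 i) Ix).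
rewrite le_eqVlt; apply/orP; left; apply/eqP.
by rewrite sumr_const card_ord -[LHS]mulr_natr; ring.
Qed.

Lemma bump_mass (c : 'I_k -> R) :
  l * \sum_i c i ^+ 2 <= dotI (\sum_i c i *: f i) (\sum_i c i *: f i).
Proof.
have lp := l0; pose h i : E := (below (y2 i) : E) - below (y1 i).
have hE i x : h i x = (y1 i <= x < y2 i)%R%:R.
  transitivity (below (y2 i) x - below (y1 i) x); first by [].
  rewrite /below; have [x1|x1] := ltP x (y1 i).
    have -> : x < y2 i by have := l12 i; lra.
    by rewrite subrr.
  by rewrite subr0.
have Lh i : L2I (h i) := subspaceB L2I_subspace (L2I_below _) (L2I_below _).
have Lf i : L2I (f i) := H20_L2 (bump_H20 i).
pose F := \sum_i c i *: f i; pose H := \sum_i c i ^+ 2 *: h i.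
have LF : L2I F by exact: (subspace_sum L2I_subspace).
have LH : L2I H by exact: (subspace_sum L2I_subspace).
have L1 := L2I_cst (1 : R).
apply: (@le_trans _ _ (dotI H (cst 1))).
  rewrite /H (bilin_suml L2I_subspace dotI_sym_bilin)// mulr_sumr.
  apply: ler_sum => i _; rewrite mulrC ler_wpM2l ?sqr_ge0//.
  rewrite /h (bilinB dotI_sym_bilin) //; try exact: L2I_below.
  have y1i : 0 <= y1 i <= 1.
    by have := l01 i; have := l12 i; have := l23 i; have := y00 i; have := y31 i; move=> *; apply/andP; split; lra.
  have y2i : 0 <= y2 i <= 1.
    by have := l01 i; have := l12 i; have := l23 i; have := y00 i; have := y31 i; move=> *; apply/andP; split; lra.
  by rewrite -!/(prim _ _) !prim_id.
apply: le_Rintegral.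
- exact: measurable_I01.
- exact: L2I_mul_int.
- exact: L2I_mul_int.
move=> x Ix; rewrite mulr1 -expr2 /H /F !sumE.
have [[j jx]|nj] := pselect (exists j, y1 j <= x < y2 j); last first.
  rewrite big1 ?sqr_ge0// => i _; rewrite hE.
  by case: (boolP (y1 i <= x < y2 i)) => [h0|_]; [case: nj; exists i|rewrite mulr0].
have /andP[jx1 jx2] := jx.
have off i : i != j -> f i x = 0 /\ h i x = 0.
  move=> ij; rewrite hE.
  have li01 := l01 i; have li12 := l12 i; have li23 := l23 i.
  have lj01 := l01 j; have lj12 := l12 j; have lj23 := l23 j.
  have : (i < j)%N || (j < i)%N by rewrite -neq_ltn.
  case/orP => /sep s.
    rewrite /f (bump_right l0 li01 li12 li23); last by lra.
    by split => //; rewrite andbC ltNge (_ : y2 i <= x)//; lra.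
  rewrite /f (bump_left l0 li01 li12 li23); last by lra.
  by split => //; rewrite leNgt (_ : x < y1 i)//; lra.
rewrite (bigD1 j)//= big1 => [|i ij]; last by rewrite (off i ij).2 mulr0.
rewrite [X in _ <= X ^+ 2](bigD1 j)//= [X in _ <= (_ + X) ^+ 2]big1 => [|i ij]; last first.
  by rewrite (off i ij).1 mulr0.
rewrite !addr0 hE jx mulr1 /f (bump_plateau l0 (l01 j) (l23 j)) ?mulr1//.
by rewrite jx1 ltW.
Qed.

End BumpFamily.

End Plateaus.

(** * Comparison of eigenvalues *)

Section MinMaxEigenvalues.
Context {R : realType}.
Implicit Types (u v w g : R -> R).
Local Notation I := (@I01 R).
Local Notation E := (R -> R).
Variables (eps : R) (a b : R -> R) (a0 M : R).
Hypothesis eps0 : 0 < eps.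
Hypothesis eps1 : eps <= 1.
Hypothesis ma : measurable_fun I a.
Hypothesis mb : measurable_fun I b.
Hypothesis aM : forall x, I x -> `|a x| <= M.
Hypothesis bM : forall x, I x -> `|b x| <= M.
Hypothesis a0_gt0 : 0 < a0.
Hypothesis aa0 : forall x, I x -> a0 <= a x.
Hypothesis b0 : forall x, I x -> 0 <= b x.

Let B := Bform eps a b.

Lemma dotI_gt0 u : L2I u -> ~ ae_eqI u (cst 0) <-> 0 < dotI u u.
Proof.
move=> Lu; split=> [nu|+ u0]; last by rewrite (ae_eq0_dotI Lu u0) ltxx.
by rewrite lt_neqAle dotI_psd// andbT eq_sym; apply/eqP => /(dotI_eq0 Lu).
Qed.

Lemma kth_eigenvalue_le (V : set E) (k : nat) (lam m : R) u (f : 'I_k.+1 -> E) :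
  @lin_subspace R E V -> V `<=` H20 -> complete_form V B dotI ->
  kth_eigenpair V B k.+1 lam u -> (forall i, V (f i)) ->
  (forall c : 'I_k.+1 -> R, (exists i, c i != 0) ->
     0 < dotI (\sum_i c i *: f i) (\sum_i c i *: f i) /\
     B (\sum_i c i *: f i) (\sum_i c i *: f i) <=
     m * dotI (\sum_i c i *: f i) (\sum_i c i *: f i)) ->
  lam <= m.
Proof.
move=> sV VH cpl [ls [us [[<- _] hus orth hmax]]] Vf hf.
have bB := sub_sym_bilin VH (Bform_sym_bilin eps ma mb aM bM).
have pB := sub_psd VH (Bform_psd eps ma mb aM bM a0_gt0 aa0 b0).
have bD := sub_sym_bilin VH (@dotI_sym_bilin_H20 R).
have pD := sub_psd VH (@dotI_psd_H20 R).
have cpt : precompact_form V B dotI.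
  move=> C w Vw; apply: (precompact_H20 ma mb aM bM a0_gt0 aa0 b0) => n.
  exact/VH/Vw.
apply: (minmax sV bB bD pB pD cpt cpl (us := us) _ _ _ Vf hf).
- move=> i ik; have [Vi ni Bi] := hus i ik; split => //.
  by apply/dotI_gt0 => //; exact/H20_L2/VH.
- by move=> i j i1 ij jk; have [] := orth i j i1 ij jk.
- move=> nu w Vw Dw Bw ow; apply: (hmax nu w) => //; split => //.
  by apply/dotI_gt0 => //; exact/H20_L2/VH.
Qed.

Lemma eigenvalue_ge (lam : R) u : eigenpair H20 B lam u -> dotI u u = 1 -> a0 <= lam.
Proof.
move=> [Hu _ Bu] u1; have := Bform_ge_dotI eps ma mb aM bM a0_gt0 aa0 b0 Hu.
by rewrite -/B (Bu u Hu) u1 !mulr1.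
Qed.

(** The first discrete eigenfunctions span a space on which the Rayleigh quotient
    is at most [lamh]. *)
Lemma conforming_eigenvalue_ge (V : set E) (k : nat) (lam lamh : R) u uh :
  @lin_subspace R E V -> V `<=` H20 -> kth_eigenpair H20 B k.+1 lam u ->
  kth_eigenpair V B k.+1 lamh uh -> lam <= lamh.
Proof.
move=> sV VH hlam [ls [us [[lk _] hus orth _]]].
pose f (i : 'I_k.+1) := us i.+1.
have fP (i : 'I_k.+1) : eigenpair V B (ls i.+1) (f i) by apply: hus; exact: ltn_ord.
have Hf i : H20 (f i) by apply: VH; have [] := fP i.
have Lf i : L2I (f i) := H20_L2 (Hf i).
have fO (i j : 'I_k.+1) : i != j -> dotI (f i) (f j) = 0.
  have aux (p q : 'I_k.+1) : (p < q)%N -> dotI (f p) (f q) = 0.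
    by move=> pq; have [] := orth p.+1 q.+1 isT pq (ltn_ord q).
  rewrite neq_ltn => /orP[|] ij; first exact: aux.
  by rewrite dotI_sym_bilin.1// aux.
have le_lamh (i : 'I_k.+1) : ls i.+1 <= lamh.
  rewrite -lk; have [->//|ik] := eqVneq (i.+1)%N k.+1.
  have [] := orth i.+1 k.+1 isT _ (leqnn _) => //.
  by rewrite ltn_neqAle ik ltn_ord.
apply: (kth_eigenvalue_le H20_subspace (@subset_refl _ _)
  (complete_H20 eps0 eps1 ma mb aM bM a0_gt0 aa0 b0) hlam Hf) => c [i0 ci0].
set F := \sum_i _.
have HF : H20 F by exact: (subspace_sum H20_subspace).
have LF := H20_L2 HF.
have fF j : dotI (f j) F = c j * dotI (f j) (f j).
  rewrite dotI_sym_bilin.1// (bilin_suml L2I_subspace dotI_sym_bilin)//.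
  by rewrite (bigD1 j)//= big1 ?addr0// => i ij; rewrite fO ?mulr0.
have DF : dotI F F = \sum_i c i ^+ 2 * dotI (f i) (f i).
  rewrite {1}/F (bilin_suml L2I_subspace dotI_sym_bilin)//.
  by apply: eq_bigr => i _; rewrite fF mulrA expr2.
have D0 i : 0 < dotI (f i) (f i).
  by apply/dotI_gt0 => //; have [] := fP i.
split.
  rewrite DF (bigD1 i0)//=; apply: ltr_pwDl.
    by rewrite mulr_gt0// exprn_even_gt0.
  by apply: sumr_ge0 => i _; rewrite mulr_ge0 ?sqr_ge0// ltW.
have VF : V F by apply: (subspace_sum sV) => i; have [] := fP i.
have bB : @sym_bilin R E H20 B := Bform_sym_bilin eps ma mb aM bM.
rewrite {1}/F (bilin_suml H20_subspace bB)//.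
rewrite DF mulr_sumr; apply: ler_sum => i _.
have [_ _ Bi] := fP i; rewrite Bi// fF.
rewrite [leLHS](_ : _ = ls i.+1 * (c i ^+ 2 * dotI (f i) (f i))); last by ring.
by rewrite ler_wpM2r// mulr_ge0 ?sqr_ge0// ltW.
Qed.

(** A bound for discrete eigenvalues, independent of [eps], [beta] and [N]. *)
Lemma discrete_eigenvalue_le (beta : R) (p N k : nat) (lamh l : R) uh :
  (3 <= p)%N -> exp_partition beta eps p N ->
  l = (8 * k.+1%:R)^-1 -> mesh_width beta eps p N <= l ->
  kth_eigenpair (Vh beta eps p N) B k.+1 lamh uh ->
  lamh <= (1 + M + M) * (4 * (6 / l ^+ 2 + 12 / l ^+ 3) * k.+1%:R) ^+ 2 / l.
Proof.
move=> p3 part lE hw hlamh.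
have l0 : 0 < l by rewrite lE invr_gt0 mulr_gt0.
have l8 : 8 * l * k.+1%:R = 1 by rewrite lE mulrAC divff// gt_eqF// mulr_gt0.
have w0 := mesh_width_ge0 beta eps p N.
(* 8 l i and 8 l (i + 1) are the ends of the i-th of k + 1 equal cells, and there
   is a node within l to the right of 8 l i + 2 r l for each r <= 3 *)
have nodes (r : nat) : (r <= 3)%N -> exists n : 'I_k.+1 -> nat, forall i,
    (n i <= N)%N /\
    8 * l * i%:R + 2 * r%:R * l <= exp_node beta eps p N (n i) <=
    8 * l * i%:R + (2 * r%:R + 1) * l.
  move=> r3; suff /choice[n hn] : forall i : 'I_k.+1, exists j, (j <= N)%N /\
    8 * l * i%:R + 2 * r%:R * l <= exp_node beta eps p N j <=
    8 * l * i%:R + (2 * r%:R + 1) * l by exists n.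
  move=> i.
  have [|j jN /andP[j1 j2]] := node_near part (z := 8 * l * i%:R + 2 * r%:R * l).
    have r0 : 0 <= r%:R :> R by [].
    have r3' : r%:R <= 3 :> R by rewrite ler_nat.
    have i0 : 0 <= i%:R :> R by [].
    have ik : i%:R + 1 <= k.+1%:R :> R by rewrite natr1 ler_nat ltn_ord.
    have h1 := ler_wpM2l (ltW l0) ik; have h2 := mulr_ge0 (ltW l0) i0.
    have h3 := ler_wpM2l (ltW l0) r3'; have h4 := mulr_ge0 (ltW l0) r0.
    by apply/andP; split; lra.
  exists j; split => //; rewrite j1/=; apply: (le_trans j2).
  by lra.
have [n0 hn0] := nodes 0%N isT; have [n1 hn1] := nodes 1%N isT.
have [n2 hn2] := nodes 2%N isT; have [n3 hn3] := nodes 3%N isT.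
pose y0 i := exp_node beta eps p N (n0 i); pose y1 i := exp_node beta eps p N (n1 i).
pose y2 i := exp_node beta eps p N (n2 i); pose y3 i := exp_node beta eps p N (n3 i).
have y00 i : 0 <= y0 i by apply: (node_ge0 part); have [] := hn0 i.
have y31 i : y3 i <= 1 by apply: (node_le1 part); have [] := hn3 i.
have l01 i : l <= y1 i - y0 i.
  by have [_ /andP[h1 h2]] := hn0 i; have [_ /andP[h3 h4]] := hn1 i; rewrite /y0 /y1; lra.
have l12 i : l <= y2 i - y1 i.
  by have [_ /andP[h1 h2]] := hn1 i; have [_ /andP[h3 h4]] := hn2 i; rewrite /y1 /y2; lra.
have l23 i : l <= y3 i - y2 i.
  by have [_ /andP[h1 h2]] := hn2 i; have [_ /andP[h3 h4]] := hn3 i; rewrite /y2 /y3; lra.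
have sep (i j : 'I_k.+1) : (i < j)%N -> y3 i <= y0 j.
  move=> ij; have [_ /andP[h1 h2]] := hn3 i; have [_ /andP[h3 h4]] := hn0 j.
  have ij' : i%:R + 1 <= j%:R :> R by rewrite natr1 ler_nat.
  have h5 := ler_wpM2l (ltW l0) ij'; rewrite /y3 /y0; lra.
pose f i : E := bump_0 (y0 i) (y1 i) (y2 i) (y3 i).
have Vf i : Vh beta eps p N (f i).
  split; first exact: (bump_H20 l0 y00 y31 l01 l12 l23).
  move=> j jN.
  have knot n : (n <= N)%N -> exp_node beta eps p N n <= exp_node beta eps p N j \/
      exp_node beta eps p N j.+1 <= exp_node beta eps p N n.
    move=> nN; have [nj|jn] := leqP n j; [left|right].
      by apply: (node_mono part) => //; exact: ltnW.
    exact: (node_mono part).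
  have [q sq qf] : poly_on (exp_node beta eps p N j) (exp_node beta eps p N j.+1) p.+1 (f i).
    apply: poly_on_bump => //; apply: knot.
    - by have [] := hn0 i.
    - by have [] := hn1 i.
    - by have [] := hn2 i.
    - by have [] := hn3 i.
  by exists q => //; exact: aeW.
have sV := Vh_subspace beta eps p N.
have VH : Vh beta eps p N `<=` H20 by exact: Vh_H20.
have cpl := Vh_complete part (complete_H20 eps0 eps1 ma mb aM bM a0_gt0 aa0 b0).
apply: (kth_eigenvalue_le sV VH cpl hlamh Vf) => c [i0 ci0].
have S0 : 0 < \sum_i c i ^+ 2.
  rewrite (bigD1 i0)//=; apply: ltr_pwDl; first by rewrite exprn_even_gt0.
  by apply: sumr_ge0 => i _; exact: sqr_ge0.
have mass := bump_mass l0 y00 y31 l01 l12 l23 sep c.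
have energy := bump_energy l0 y00 y31 l01 l12 l23 c.
have HF : H20 (\sum_i c i *: f i) by apply: VH; exact: (subspace_sum sV).
split; first by apply: lt_le_trans mass; rewrite mulr_gt0.
have M0 := bound_ge0 aM.
apply: (le_trans (Bform_le eps0 ma mb aM bM HF eps1 energy)).
set K := (_ * k.+1%:R) ^+ 2.
rewrite -[leRHS]mulrA -[leRHS]mulrA; apply: ler_wpM2l; first by lra.
apply: ler_wpM2l; first exact: sqr_ge0.
by rewrite mulrC ler_pdivlMr// mulrC.
Qed.

End MinMaxEigenvalues.

Theorem theorem7 (R : realType) (p : nat) (hp : (3 <= p)%N) :
  exists m : nat,
  forall (a b : R -> R) (a0 beta : R),
  Cclosed m a -> Cclosed m b ->
  0 < a0 ->
  (forall x, 0 <= x <= 1 -> a0 <= a x /\ 0 <= b x) ->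
  layer_rate a b m beta ->
  forall k : nat, (1 <= k)%N ->
  exists h0 Cbar : R, 0 < h0 /\ 0 < Cbar /\
  forall (eps : R) (N : nat),
  0 < eps <= 1 ->
  (4 < N)%N -> (4 %| N)%N -> eps < N%:R^-1 ->
  exp_partition beta eps p N ->
  mesh_width beta eps p N <= h0 ->
  forall (lam lamh : R) (u uh : R -> R),
  kth_eigenpair H20 (Bform eps a b) k lam u ->
  kth_eigenpair (Vh beta eps p N) (Bform eps a b) k lamh uh ->
  dotI u u = 1 -> dotI uh uh = 1 -> 0 < dotI u uh ->
  lam <= lamh /\
  lamh <= Cbar * lam * (1 + mesh_width beta eps p N ^+ (2 * p - 2)).
Proof.
(* only bounds for the coefficients enter the estimates, not their derivatives *)
exists 0%N => a b a0 beta [ga [<- ca _]] [gb [<- cb _]] a0_gt0 hab _ [//|k] _.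
have [Ma Ma0 haM] := within_bounded (ca 0%N isT).
have [Mb Mb0 hbM] := within_bounded (cb 0%N isT).
have ma := within_measurable (ca 0%N isT); have mb := within_measurable (cb 0%N isT).
pose M := Ma + Mb.
have I01cc (x : R) : I01 x -> 0 <= x <= 1 by move=> /I01P/andP[x0 x1]; rewrite !ltW.
have aM x : I01 x -> `|ga 0%N x| <= M.
  by move=> /I01cc/haM h; apply: (le_trans h); rewrite lerDl.
have bM x : I01 x -> `|gb 0%N x| <= M.
  by move=> /I01cc/hbM h; apply: (le_trans h); rewrite lerDr.
have aa0 x : I01 x -> a0 <= ga 0%N x by move=> /I01cc/hab[].
have b0 x : I01 x -> 0 <= gb 0%N x by move=> /I01cc/hab[].
pose l : R := (8 * k.+1%:R)^-1.
have l0 : 0 < l by rewrite invr_gt0 mulr_gt0.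
pose C := (1 + M + M) * (4 * (6 / l ^+ 2 + 12 / l ^+ 3) * k.+1%:R) ^+ 2 / l.
have C0 : 0 < C.
  have M0 : 0 <= M by rewrite addr_ge0.
  apply: divr_gt0 => //; apply: mulr_gt0; first by lra.
  apply: exprn_gt0; apply: mulr_gt0 => //; apply: mulr_gt0 => //.
  by apply: addr_gt0; apply: divr_gt0 => //; exact: exprn_gt0.
exists l, (C / a0); split => //; split; first exact: divr_gt0.
move=> eps N /andP[eps0 eps1] _ _ _ part hw lam lamh u uh hlam hlamh u1 _ _.
have sV := Vh_subspace beta eps p N.
have VH : Vh beta eps p N `<=` H20 by exact: Vh_H20.
split.
  exact: (conforming_eigenvalue_ge eps0 eps1 ma mb aM bM a0_gt0 aa0 b0 sV VH hlam hlamh).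
have lamhC : lamh <= C.
  exact: (discrete_eigenvalue_le eps0 eps1 ma mb aM bM a0_gt0 aa0 b0 hp part erefl hw hlamh).
have lam_ge : a0 <= lam.
  have [ls [us [[lsk usk] hus _ _]]] := hlam.
  apply: (eigenvalue_ge ma mb aM bM a0_gt0 aa0 b0 _ u1).
  by rewrite -lsk -usk; apply: hus; rewrite leqnn.
have w0 := mesh_width_ge0 beta eps p N.
apply: (le_trans lamhC); apply: (@le_trans _ _ (C / a0 * lam)).
  by rewrite mulrAC ler_pdivlMr// ler_wpM2l// ltW.
rewrite ler_peMr//; last by rewrite lerDl exprn_ge0.
by apply: mulr_ge0; [exact/ltW/divr_gt0|exact/ltW/(lt_le_trans a0_gt0)].
Qed.
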